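(* Let $\mathcal M$ be a minimal time-like surface of general type in $\mathbb R^4_2$. Then all surfaces of the one-parameter families $\mathcal M_\theta$ and $\bar{\mathcal M}^a_\theta$ ($\theta\in\mathbb R$) of minimal time-like surfaces associated to $\mathcal M$ and $\bar{\mathcal M}^a$, respectively, are strongly isometric to $\mathcal M$. Conversely, let $\mathcal M$ and $\hat{\mathcal M}$ be minimal time-like surfaces of general type in $\mathbb R^4_2$ and let $p_0\in\mathcal M$, $\hat p_0\in\hat{\mathcal M}$ be fixed points. Suppose that there exist neighborhoods of $p_0$ in $\mathcal M$ and of $\hat p_0$ in $\hat{\mathcal M}$ which are strongly isometric to each other, with $p_0$ and $\hat p_0$ corresponding to each other under this isometry. Then there exist a $\theta\in\mathbb R$ and a neighborhood of $\hat p_0$ in $\hat{\mathcal M}$ which is obtained through a proper motion from a neighborhood of $p_\theta$ on the surface $\mathcal M_\theta$ or on the surface $\bar{\mathcal M}^a_\theta$, where $p_\theta$ is the point corresponding to $p_0$ under the natural isometry between $\mathcal M$ and $\mathcal M_\theta$ or $\bar{\mathcal M}^a_\theta$, respectively.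
   Context: All maps are smooth, domains are open and connected, and all considerations are local (domains are shrunk when necessary so that harmonic conjugates exist). $\mathbb R^4_2$ is $\mathbb R^4$ with scalar product $a\cdot b=-a_1b_1+a_2b_2-a_3b_3+a_4b_4$ and its standard orientation; $a^2=a\cdot a$. A proper motion is $x\mapsto Ax+b$ with $A\in\mathbf{SO}(2,2,\mathbb R)$ (linear, preserving the scalar product, $\det A=1$). $\mathbf{AO}(2,2,\mathbb R)$ is the set of linear anti-isometries: linear $A$ with $Aa\cdot Ab=-a\cdot b$ for all $a,b$. Double numbers: $\mathbb D=\{t=u+\mathrm jv:u,v\in\mathbb R\}$, $\mathrm j^2=1$, $\bar t=u-\mathrm jv$, $|t|^2=t\bar t=u^2-v^2$; $\mathbb D_0=\{t:|t|^2=0\}$; $\mathbb R^2$ is identified with $\mathbb D$; $\frac{\partial}{\partial t}=\frac12(\frac{\partial}{\partial u}+\mathrm j\frac{\partial}{\partial v})$. $\mathbb D^4_2$ is $\mathbb D^4$ with the $\mathbb D$-bilinear extension of the scalar product. A time-like surface $\mathcal M=(\mathcal D,x)$ in $\mathbb R^4_2$ is an immersion $x:\mathcal D\to\mathbb R^4_2$ whose induced scalar product on tangent planes is indefinite (signature $(1,1)$). Coordinates $(u,v)$ are isothermal if $x_u^2=-x_v^2$ and $x_u\cdot x_v=0$; always with $E=x_u^2<0$. Let $\sigma$ be the second fundamental form, $(X_1,X_2)$ an orthonormal tangent frame with $X_1^2=-1$, $X_2^2=1$, and $(n_1,n_2)$ an orthonormal normal frame with $n_1^2=-1$, $n_2^2=1$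 such that $(X_1,X_2,n_1,n_2)$ is right (positively) oriented. The surface is minimal if $-\sigma(X_1,X_1)+\sigma(X_2,X_2)=0$. The curvature of the normal connection is $\varkappa=R^N(X_1,X_2)n_2\cdot n_1$, where $R^N(X,Y)n=\nabla^N_X\nabla^N_Yn-\nabla^N_Y\nabla^N_Xn-\nabla^N_{[X,Y]}n$ and $\nabla^N$ is the normal connection. For isothermal $t=u+\mathrm jv$ put $\Phi=x_u+\mathrm jx_v$, $\Phi'=\partial\Phi/\partial t$; $\Phi'^\bot$ is the projection of $\Phi'$ to the complexified normal space (the $\mathbb D$-span of the normal space), along the complexified tangent space. A minimal time-like surface is of general type if ${\Phi'^\bot}^2=\Phi'^\bot\cdot\Phi'^\bot\notin\mathbb D_0$ at every point. A strong isometry between two minimal time-like surfaces in $\mathbb R^4_2$ is an isometry preserving $\varkappa$. Let $\mathcal M=(\mathcal D,x)$ be minimal time-like in isothermal coordinates $t=u+\mathrm jv$. The position vector satisfies $x_{uu}-x_{vv}=0$ and the (hyperbolic) harmonic conjugate $y$ is defined, up to an additive constant, by $y_u=x_v$, $y_v=x_u$. The one-parameter family of minimal surfaces associated to $\mathcal M$ is $\mathcal M_\theta=(\mathcal D,x_\theta)$, $x_\theta=x\cosh\theta+y\sinh\theta$, $\theta\in\mathbb R$; the natural isometry $\mathcal M\to\mathcal M_\theta$ is $x(t)\mapsto x_\theta(t)$. The conjugate minimal surface of $\mathcal M$ is $\bar{\mathcal M}=(\mathrm j\mathcal D,\,y(\mathrm js))$. For a minimal surface $\mathcal N=(\mathcal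 D,z)$, $\mathcal N^a$ denotes any surface $(\mathrm j\mathcal D,\ s\mapsto Az(\mathrm js)+b)$ with $A\in\mathbf{AO}(2,2,\mathbb R)$, $\det A=1$, $b\in\mathbb R^4_2$ (it is determined up to a proper motion). Hence $\bar{\mathcal M}^a$ is a surface $(\mathcal D,\ t\mapsto Ay(t)+b)$ with such $A,b$; the natural isometry $\mathcal M\to\bar{\mathcal M}^a$ is $x(t)\mapsto Ay(t)+b$. $\bar{\mathcal M}^a_\theta$ is the family associated to $\bar{\mathcal M}^a$, and the natural isometry $\mathcal M\to\bar{\mathcal M}^a_\theta$ is the composition $\mathcal M\to\bar{\mathcal M}^a\to\bar{\mathcal M}^a_\theta$ of natural isometries. *)

(* Defs.v *)
From HB Require Import structures.
From mathcomp Require Import all_boot all_order all_algebra.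
From mathcomp Require Import all_classical all_reals all_analysis.
From mathcomp Require Import ring.

Set Implicit Arguments.
Unset Strict Implicit.
Unset Printing Implicit Defensive.

Import Order.TTheory GRing.Theory Num.Theory.
Import numFieldNormedType.Exports.

Local Open Scope classical_set_scope.
Local Open Scope ring_scope.

(* Double numbers u + j v, with j ^ 2 = 1. *)

Record dnum (R : Type) := Dnum { d_re : R; d_im : R }.

Section DnumRing.
Variable R : comNzRingType.
Implicit Types s t : dnum R.

Definition dnum_pair t : R * R := (d_re t, d_im t).
Definition pair_dnum (p : R * R) : dnum R := Dnum p.1 p.2.
Lemma dnum_pairK : cancel dnum_pair pair_dnum.
Proof. by case. Qed.

HB.instance Definition _ := Choice.copy (dnum R) (can_type dnum_pairK).

Lemma dnum_eqP s t : d_re s = d_re t -> d_im s = d_im t -> s = t.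
Proof. by case: s t => [a b] [c d] /= -> ->. Qed.

Definition dnum_add s t := Dnum (d_re s + d_re t) (d_im s + d_im t).
Definition dnum_opp s := Dnum (- d_re s) (- d_im s).
Definition dnum_mul s t :=
  Dnum (d_re s * d_re t + d_im s * d_im t) (d_re s * d_im t + d_im s * d_re t).

Fact daddA : associative dnum_add.
Proof. by move=> ? ? ?; apply: dnum_eqP => /=; ring. Qed.
Fact daddC : commutative dnum_add.
Proof. by move=> ? ?; apply: dnum_eqP => /=; ring. Qed.
Fact dadd0 : left_id (Dnum 0 0) dnum_add.
Proof. by move=> ?; apply: dnum_eqP => /=; ring. Qed.
Fact daddN : left_inverse (Dnum 0 0) dnum_opp dnum_add.
Proof. by move=> ?; apply: dnum_eqP => /=; ring. Qed.
HB.instance Definition _ :=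
  GRing.isZmodule.Build (dnum R) daddA daddC dadd0 daddN.

Fact dmulA : associative dnum_mul.
Proof. by move=> ? ? ?; apply: dnum_eqP => /=; ring. Qed.
Fact dmulC : commutative dnum_mul.
Proof. by move=> ? ?; apply: dnum_eqP => /=; ring. Qed.
Fact dmul1 : left_id (Dnum 1 0) dnum_mul.
Proof. by move=> ?; apply: dnum_eqP => /=; ring. Qed.
Fact dmulD : left_distributive dnum_mul dnum_add.
Proof. by move=> ? ? ?; apply: dnum_eqP => /=; ring. Qed.
Fact dnum1_neq0 : Dnum 1 0 != 0 :> dnum R.
Proof. by apply/eqP => -[/eqP]; rewrite oner_eq0. Qed.
HB.instance Definition _ :=
  GRing.Zmodule_isComNzRing.Build (dnum R) dmulA dmulC dmul1 dmulD dnum1_neq0.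

Definition dj : dnum R := Dnum 0 1.
Definition dconj t : dnum R := Dnum (d_re t) (- d_im t).
Definition isotropic_dnum t : Prop := t * dconj t = 0.

End DnumRing.

(* The scalar product - a1 b1 + a2 b2 - a3 b3 + a4 b4; for K = dnum R this is
   its bilinear extension.  Linear maps act on row vectors from the right. *)

Definition gram (K : comNzRingType) : 'M[K]_4 := diag_mx (\row_i (-1) ^+ i.+1).

Definition dot (K : comNzRingType) (a b : 'rV[K]_4) : K :=
  (a *m gram K *m b^T) 0 0.

Section Linear.
Variable R : realType.

Definition proper_isometry (A : 'M[R]_4) : Prop :=
  (forall a b, dot (a *m A) (b *m A) = dot a b) /\ \det A = 1.

Definition anti_isometry (A : 'M[R]_4) : Prop :=
  forall a b, dot (a *m A) (b *m A) = - dot a b.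

Definition cosh (r : R) : R := (expR r + expR (- r)) / 2.
Definition sinh (r : R) : R := (expR r - expR (- r)) / 2.

End Linear.

Section Smooth.
Variables (R : realType) (n m : nat).
Implicit Types (U V : set 'rV[R]_n).

(* All iterated directional derivatives are (Frechet) differentiable on U. *)
Definition smooth U (f : 'rV[R]_n -> 'rV[R]_m) : Prop :=
  forall (vs : seq 'rV[R]_n) p, U p ->
    differentiable (foldr (fun v g => 'D_v g) f vs) p.

Definition domain U : Prop := open U /\ connected U.

End Smooth.

Definition diffeomorphism (R : realType) n (U V : set 'rV[R]_n)
    (f : 'rV[R]_n -> 'rV[R]_n) : Prop :=
  [/\ smooth U f, f @` U = V &
      exists2 g, smooth V g & forall p, U p -> g (f p) = p].

(* A parametrized surface; only the restriction of [pos] to [dom] matters, and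
   points of the surface are represented by their parameters. *)
Record surface (R : realType) := Surface {
  dom : set 'rV[R]_2;
  pos : 'rV[R]_2 -> 'rV[R]_4 }.

Section LocalGeometry.
Variable R : realType.
Implicit Types (x : 'rV[R]_2 -> 'rV[R]_4) (p : 'rV[R]_2).

Definition du (x : 'rV[R]_2 -> 'rV[R]_4) p : 'rV[R]_4 :=
  'D_(delta_mx 0 0) x p.
Definition dv (x : 'rV[R]_2 -> 'rV[R]_4) p : 'rV[R]_4 :=
  'D_(delta_mx 0 1) x p.

Definition tangent_mx x p : 'M[R]_(1 + 1, 4) := col_mx (du x p) (dv x p).

Definition tangent_plane x p : 'M[R]_4 := <<tangent_mx x p>>%MS.
Definition normal_plane x p : 'M[R]_4 := kermx (gram R *m (tangent_mx x p)^T).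

Definition normal_proj x p : 'M[R]_4 :=
  proj_mx (normal_plane x p) (tangent_plane x p).

(* Tangent vectors are given by their coordinates X in the parameter plane; the
   corresponding vector of the ambient space is 'D_X x p. *)
Definition second_form x p (X Y : 'rV[R]_2) : 'rV[R]_4 :=
  'D_X (fun q => 'D_Y x q) p *m normal_proj x p.

Definition nabla_normal x (X : 'rV[R]_2 -> 'rV[R]_2)
    (n : 'rV[R]_2 -> 'rV[R]_4) : 'rV[R]_2 -> 'rV[R]_4 :=
  fun q => 'D_(X q) n q *m normal_proj x q.

Definition lie_bracket (X Y : 'rV[R]_2 -> 'rV[R]_2) : 'rV[R]_2 -> 'rV[R]_2 :=
  fun q => 'D_(X q) Y q - 'D_(Y q) X q.

Definition normal_curvature_tensor x X Y (n : 'rV[R]_2 -> 'rV[R]_4) p :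
    'rV[R]_4 :=
  nabla_normal x X (nabla_normal x Y n) p
  - nabla_normal x Y (nabla_normal x X n) p
  - nabla_normal x (lie_bracket X Y) n p.

Definition orthonormal_tangent x p (X1 X2 : 'rV[R]_2) : Prop :=
  [/\ dot ('D_X1 x p) ('D_X1 x p) = -1, dot ('D_X2 x p) ('D_X2 x p) = 1
    & dot ('D_X1 x p) ('D_X2 x p) = 0].

Definition orthonormal_normal x p (n1 n2 : 'rV[R]_4) : Prop :=
  [/\ (n1 <= normal_plane x p)%MS, (n2 <= normal_plane x p)%MS,
      dot n1 n1 = -1, dot n2 n2 = 1 & dot n1 n2 = 0].

Definition right_oriented (a b c d : 'rV[R]_4) : Prop :=
  0 < \det (\matrix_(i < 4) [:: a; b; c; d]`_i).

Definition adapted_frame x (U : set 'rV[R]_2) (X1 X2 : 'rV[R]_2 -> 'rV[R]_2)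
    (n1 n2 : 'rV[R]_2 -> 'rV[R]_4) : Prop :=
  [/\ smooth U X1, smooth U X2, smooth U n1, smooth U n2 &
    forall q, U q ->
      [/\ orthonormal_tangent x q (X1 q) (X2 q),
          orthonormal_normal x q (n1 q) (n2 q) &
          right_oriented ('D_(X1 q) x q) ('D_(X2 q) x q) (n1 q) (n2 q)]].

(* The value does not depend on the frame field, which exists locally on every
   time-like surface. *)
Definition normal_curvature x p : R :=
  get [set k | exists U X1 X2 n1 n2,
    [/\ open U, U p, adapted_frame x U X1 X2 n1 n2 &
        k = dot (normal_curvature_tensor x X1 X2 n2 p) (n1 p)]].

Definition to_dnum4 (a b : 'rV[R]_4) : 'rV[dnum R]_4 :=
  map2_mx (@Dnum R) a b.

Definition Phi x p : 'rV[dnum R]_4 := to_dnum4 (du x p) (dv x p).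

(* d/dt = (d/du + j d/dv) / 2, applied to D^4-valued maps through their real
   and imaginary parts. *)
Definition d_t (F : 'rV[R]_2 -> 'rV[dnum R]_4) p : 'rV[dnum R]_4 :=
  let re q := map_mx (@d_re R) (F q) in
  let im q := map_mx (@d_im R) (F q) in
  Dnum (2^-1) 0 *:
    (to_dnum4 (du re p) (du im p) + dj R *: to_dnum4 (dv re p) (dv im p)).

(* The D-linear extension of the real normal projection is the projection to
   the D-span of the normal space along the D-span of the tangent space. *)
Definition Phi'_normal x p : 'rV[dnum R]_4 :=
  d_t (Phi x) p *m map_mx (fun r => Dnum r 0) (normal_proj x p).

End LocalGeometry.

Section Surfaces.
Variable R : realType.
Implicit Types (M N : surface R) (U : set 'rV[R]_2).

Definition timelike M : Prop :=
  [/\ domain (dom M), smooth (dom M) (pos M),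
      (forall p, dom M p -> forall X, 'D_X (pos M) p = 0 -> X = 0) &
      (forall p, dom M p ->
        (exists X, dot ('D_X (pos M) p) ('D_X (pos M) p) < 0) /\
        (exists Y, 0 < dot ('D_Y (pos M) p) ('D_Y (pos M) p)))].

Definition minimal_timelike M : Prop :=
  timelike M /\
  forall p, dom M p -> forall X1 X2, orthonormal_tangent (pos M) p X1 X2 ->
    - second_form (pos M) p X1 X1 + second_form (pos M) p X2 X2 = 0.

Definition isothermal M : Prop :=
  forall p, dom M p ->
    let xu := du (pos M) p in let xv := dv (pos M) p in
    [/\ dot xu xu = - dot xv xv, dot xu xv = 0 & dot xu xu < 0].

(* tau : D -> dom M introduces isothermal coordinates on an open part of M. *)
Definition isothermal_coordinates M (D : set 'rV[R]_2)
    (tau : 'rV[R]_2 -> 'rV[R]_2) : Prop :=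
  [/\ domain D, domain (tau @` D), tau @` D `<=` dom M,
      diffeomorphism D (tau @` D) tau &
      isothermal (Surface D (pos M \o tau))].

(* Isothermal coordinates exist around each point of a time-like surface, and
   the condition does not depend on their choice. *)
Definition general_type M : Prop :=
  forall D tau, isothermal_coordinates M D tau -> forall t, D t ->
    let w := Phi'_normal (pos M \o tau) t in ~ isotropic_dnum (dot w w).

Definition subsurface M U : surface R := Surface U (pos M).

Definition neighborhood M p U : Prop :=
  [/\ domain U, U p & U `<=` dom M].

Definition strong_isometry M N (f : 'rV[R]_2 -> 'rV[R]_2) : Prop :=
  [/\ minimal_timelike M, minimal_timelike N, diffeomorphism (dom M) (dom N) f,
      (forall p, dom M p -> forall X Y,
        dot ('D_('D_X f p) (pos N) (f p)) ('D_('D_Y f p) (pos N) (f p))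
        = dot ('D_X (pos M) p) ('D_Y (pos M) p)) &
      (forall p, dom M p ->
        normal_curvature (pos N) (f p) = normal_curvature (pos M) p)].

Definition strongly_isometric M N : Prop := exists f, strong_isometry M N f.

Definition harmonic_conjugate M (y : 'rV[R]_2 -> 'rV[R]_4) : Prop :=
  smooth (dom M) y /\
  forall p, dom M p -> du y p = dv (pos M) p /\ dv y p = du (pos M) p.

(* A member of the one-parameter family of minimal surfaces associated to M, for
   y a harmonic conjugate of M. *)
Definition associated M y (theta : R) : surface R :=
  Surface (dom M) (fun t => cosh theta *: pos M t + sinh theta *: y t).

(* Multiplication by j, with R^2 identified with D: j (u + j v) = v + j u. *)
Definition jmul (t : 'rV[R]_2) : 'rV[R]_2 := \row_i t 0 (rev_ord i).

(* The conjugate surface of M, for y a harmonic conjugate of M *)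
Definition conjugate_surface M (y : 'rV[R]_2 -> 'rV[R]_4) : surface R :=
  Surface (jmul @` dom M) (fun s => y (jmul s)).

(* Used for anti-isometries A: the swap of the coordinates restores the sign
   convention dot (du x) (du x) < 0, which A alone reverses. *)
Definition anti_surface N (A : 'M[R]_4) (b : 'rV[R]_4) : surface R :=
  Surface (jmul @` dom N) (fun s => pos N (jmul s) *m A + b).

(* Some neighborhood of the point q of N is obtained, up to a change of
   parameters, through a proper motion from a neighborhood of the point p of
   M. *)
Definition locally_properly_congruent M p N q : Prop :=
  exists U V h (B : 'M[R]_4) c,
    [/\ neighborhood M p U, neighborhood N q V, proper_isometry B,
        diffeomorphism U V h /\ h p = q &
        forall t, U t -> pos N (h t) = pos M t *m B + c].

End Surfaces.

(* Main.v *)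
Require Import Defs.
From mathcomp Require Import all_boot all_order all_algebra.
From mathcomp Require Import all_classical all_reals all_analysis.
From mathcomp Require Import ring lra.

Set Implicit Arguments.
Unset Strict Implicit.
Unset Printing Implicit Defensive.

Import Order.TTheory GRing.Theory Num.Theory.
Import numFieldNormedType.Exports.

Local Open Scope classical_set_scope.
Local Open Scope ring_scope.

(** In isothermal parameters put P = x_u + x_v and Q = x_u - x_v; both vectors
    are isotropic.  The surface is minimal iff x_uu = x_vv, that is, iff P is
    constant in the direction (1, -1) and Q in the direction (1, 1).  Write P'
    for the derivative of P along (1, 1) and Q' for that of Q along (1, -1).
    Passing to x_theta replaces (P, Q) by (e^theta P, e^-theta Q), and passing
    to the conjugate surface followed by an anti-isometry A replaces (P, Q) by
    (PA, -QA).

    Invariance.  The Ricci equation ([ricci]) expresses the curvature of the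
    normal connection in any adapted frame by a determinant of first and second
    derivatives of x; in isothermal parameters the frame drops out and
    varkappa = 2 det(x_u, x_v, x_uu, x_uv) / (-E)^3 with E = x_u^2
    ([frame_curvature_isothermal]).  Up to constants E is P.Q and the
    determinant is det(P, Q, P', Q'), and both are unchanged by the two
    substitutions above.  Hence the identity of the parameter domain is a strong
    isometry ([iso_minimal_linear], [strong_isometry_data]).

    Converse.  Pulled back to isothermal parameters of the first surface, the
    second one has the same P.Q and the same det(P, Q, P', Q')
    ([strong_isometry_pullback]).  The numbers P'^2 and Q'^2 are the squares of
    the normal parts of P' and Q', so they do not vanish for surfaces of general
    type ([general_type_normal_sq]).  The Gram determinant of (P, Q, P', Q')
    shows that the product P'^2 Q'^2 is the same for both surfaces
    ([normal_sq_prod_eq]).  As P'^2 is constant along (1, -1) and Q'^2 along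
    (1, 1), the two values of P'^2 have a constant ratio c, and those of Q'^2
    the ratio 1/c ([normal_sq_ratio]).  If c = e^(2 theta), the family of M
    contains a surface for which P.Q, P'^2, Q'^2 and det(P, Q, P', Q') all agree
    with those of the second surface; if c = -e^(2 theta), the other family does.

    It remains to see that these four functions determine the surface up to a
    proper motion ([congruence]).  Let C be the vector product of P, Q and P'.
    The Gram matrices of the frames (P, Q, P', C) of the two surfaces agree, so
    an isometry H of the ambient space maps one frame to the other at each
    point.  The derivatives of the frame along (1, -1) are P_- = 0, Q_- = Q',
    P'_- = 0 and C_-; their scalar products with the frame are expressed by the
    four functions, so H maps them to those of the second surface, and H is
    constant along (1, -1) ([half_rigidity]).  With the roles of P and Q
    exchanged the same H is constant along (1, 1).  So H is constant, and
    integrating gives the motion. *)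

(** * Smooth maps *)

Section Differentiability.
Variables (R : realType) (V : normedModType R).

(** The zero map serves as differential, and the remainder vanishes near the
    point. *)
Lemma differentiable_near0 (W : normedModType R) (h : V -> W) p :
  (\forall q \near p, h q = 0) -> differentiable h p.
Proof.
move=> h0; have hp0 := nbhs_singleton h0.
have e0 : h \o shift p = cst (h p) + (\0 : {linear V -> W}) +o_ 0 id.
  apply/eqaddoP => _/posnumP[e].
  have h0' : \forall q \near (0 : V), h (q + p) = 0.
    by move: h0; rewrite (near_shift 0) subr0.
  near=> q; rewrite !fctE /= hp0.
  rewrite (near h0' q) //.
  by rewrite addr0 subr0 normr0 mulr_ge0.
have d0 : 'd h p = (\0 : {linear V -> W}) :> (V -> W).
  by apply: diff_unique e0; exact: cst_continuous.
apply/diff_locallyP; split; first by rewrite d0; exact: cst_continuous.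
by rewrite d0.
Unshelve. all: by end_near. Qed.

(** [smooth] constrains a map on an open set only, so differentiability has to
    be transported along equality near a point. *)
Lemma near_eq_differentiable (W : normedModType R) (f g : V -> W) p :
  (\forall q \near p, f q = g q) -> differentiable f p -> differentiable g p.
Proof.
move=> fg df; rewrite (_ : g = f + (g - f)); last first.
  by apply/funext => q; rewrite !fctE addrC subrK.
apply: differentiableD => //; apply: differentiable_near0.
by near=> q; rewrite !fctE (near fg q) ?subrr.
Unshelve. all: by end_near. Qed.

Lemma differentiable_mxP m n (f : V -> 'M[R]_(m, n)) p :
  differentiable f p <-> forall i j, differentiable (fun q => f q i j) p.
Proof.
split=> [df i j|df].
  rewrite (_ : (fun _ => _) = (fun N : 'M[R]_(m, n) => N i j) \o f) //.
  by apply: differentiable_comp => //; exact: differentiable_coord.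
rewrite (_ : f = \sum_(i < m) \sum_(j < n) (fun q => f q i j *: delta_mx i j)).
  apply: differentiable_sum => i; apply: differentiable_sum => j.
  exact: differentiableZl.
apply/funext => q; rewrite [LHS]matrix_sum_delta.
rewrite fct_sumE; apply: eq_bigr => i _; by rewrite fct_sumE.
Qed.

Lemma open_near (T : topologicalType) (U : set T) (Q : T -> Prop) p :
  open U -> U p -> (forall q, U q -> Q q) -> \forall q \near p, Q q.
Proof.
by move=> oU Up UQ; apply: filterS (open_nbhs_nbhs (conj oU Up)).
Qed.

End Differentiability.

Section Ck.
Variables (R : realType) (V : normedModType R).
Implicit Types (U : set V).

(** [smooth] speaks of all words of directional derivatives at once; this
    recursion on the order makes closure properties provable by induction. *)
Fixpoint Ck (W : normedModType R) k U (f : V -> W) : Prop :=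
  (forall p, U p -> differentiable f p) /\
  (if k is k'.+1 then forall v, Ck k' U ('D_v f) else True).

Definition Cinf (W : normedModType R) U (f : V -> W) := forall k, Ck k U f.

Section OneTarget.
Variable W : normedModType R.
Implicit Types f g : V -> W.

Lemma Ck_diff k U f p : Ck k U f -> U p -> differentiable f p.
Proof. by case: k => [|k] [df _]; exact: df. Qed.

Lemma CkW k U f : Ck k.+1 U f -> Ck k U f.
Proof.
elim: k f => [|k IH] f [df dd]; first by split.
by split=> // v; exact/IH/dd.
Qed.

Lemma Ck_sub k U U' f : U' `<=` U -> Ck k U f -> Ck k U' f.
Proof.
move=> sU; elim: k f => [|k IH] f [df dd]; first by split=> // p /sU; exact: df.
by split=> [p /sU|v]; [exact: df|exact/IH/dd].
Qed.

Lemma eq_on_derive U f g v p : open U -> (forall q, U q -> f q = g q) ->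
  U p -> 'D_v f p = 'D_v g p.
Proof. by move=> oU fg Up; apply: near_eq_derive; exact: open_near fg. Qed.

Lemma Ck_eq k U f g : open U -> (forall q, U q -> f q = g q) ->
  Ck k U f -> Ck k U g.
Proof.
move=> oU; elim: k f g => [|k IH] f g fg [df dd].
  split=> // p Up; apply: near_eq_differentiable (df p Up).
  exact: open_near fg.
split=> [p Up|v]; first by apply: near_eq_differentiable (df p Up);
  exact: open_near fg.
apply: IH (dd v) => q Uq; exact: eq_on_derive fg Uq.
Qed.

Lemma Ck_cst k U (a : W) : Ck k U (fun=> a).
Proof.
elim: k a => [|k IH] a; first by split=> // p _; exact: differentiable_cst.
split=> [p _|v]; first exact: differentiable_cst.
rewrite (_ : 'D_v _ = fun=> 0); first exact: IH.
by apply/funext => p; exact: derive_cst.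
Qed.

Lemma CkD k U f g : open U -> Ck k U f -> Ck k U g -> Ck k U (fun q => f q + g q).
Proof.
move=> oU; elim: k f g => [|k IH] f g [df ddf] [dg ddg].
  by split => // p Up; apply: differentiableD; [exact: df|exact: dg].
split=> [p Up|v].
  by apply: differentiableD; [exact: df|exact: dg].
apply: Ck_eq oU _ (IH _ _ (ddf v) (ddg v)) => q Uq.
by rewrite [RHS]deriveD //; apply: diff_derivable; [exact: df|exact: dg].
Qed.

End OneTarget.

Implicit Types f g : V -> R.

Lemma CkM k U f g : open U -> Ck k U f -> Ck k U g -> Ck k U (fun q => f q * g q).
Proof.
move=> oU; elim: k f g => [|k IH] f g hf hg.
  split => // p Up.
  by apply: differentiableM; [exact: Ck_diff hf Up|exact: Ck_diff hg Up].
split=> [p Up|v].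
  by apply: differentiableM; [exact: Ck_diff hf Up|exact: Ck_diff hg Up].
have := CkD oU (IH _ _ (CkW hf) (hg.2 v)) (IH _ _ (CkW hg) (hf.2 v)).
apply: Ck_eq oU _ => q Uq.
by rewrite [RHS]deriveM //; apply: diff_derivable;
  [exact: Ck_diff hf Uq|exact: Ck_diff hg Uq].
Qed.

Lemma Ck_sum (I : Type) (s : seq I) k U (F : I -> V -> R) : open U ->
  (forall i, Ck k U (F i)) -> Ck k U (fun q => \sum_(i <- s) F i q).
Proof.
move=> oU hF; elim: s => [|i s IH].
  rewrite (_ : (fun _ => _) = fun=> 0); first exact: Ck_cst.
  by apply/funext => q; rewrite big_nil.
rewrite (_ : (fun _ => _) = fun q => F i q + \sum_(i <- s) F i q).
  exact: CkD.
by apply/funext => q; rewrite big_cons.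
Qed.

(** The derivative of 1/f is again a product of lower order terms: - (1/f)^2
    f_v. *)
Lemma CkV k U f : open U -> (forall q, U q -> f q != 0) -> Ck k U f ->
  Ck k U (fun q => (f q)^-1).
Proof.
move=> oU f0; elim: k => [|k IH] hf.
  by split => // p Up; apply: differentiableV; [exact: Ck_diff hf Up|exact: f0].
split=> [p Up|v].
  by apply: differentiableV; [exact: Ck_diff hf Up|exact: f0].
have hV := IH (CkW hf).
have := CkM oU (Ck_cst k U (-1 : R)) (CkM oU (CkM oU hV hV) (hf.2 v)).
apply: Ck_eq oU _ => q Uq.
rewrite [RHS]deriveV ?f0 //; last by apply: diff_derivable; exact: Ck_diff hf Uq.
by rewrite mulN1r scaleNr expr2 invfM.
Qed.

Lemma derivable_sqrt_comp f q v : 0 < f q -> differentiable f q ->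
  differentiable (fun q => Num.sqrt (f q)) q /\
  'D_v (fun q => Num.sqrt (f q)) q = (2 * Num.sqrt (f q))^-1 * 'D_v f q.
Proof.
move=> f0 df.
have [ds es] := is_derive1_sqrt f0.
have ds' : differentiable (Num.sqrt : R -> R) (f q) by apply/derivable1_diffP.
rewrite (_ : (fun _ => _) = (Num.sqrt : R -> R) \o f) //.
have dc := differentiable_comp df ds'.
split => //.
have -> : 'D_v ((Num.sqrt : R -> R) \o f) q =
    'd (Num.sqrt : R -> R) (f q) ('D_v f q *: (1 : R)).
  by rewrite deriveE // diff_comp //= -(deriveE v df) /GRing.scale /= mulr1.
rewrite linearZ /= -(deriveE (1 : R) ds') es; exact: mulrC.
Qed.

(** The derivative f_v / (2 sqrt f) involves sqrt f again, at one order less.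
    *)
Lemma Ck_sqrt k U f : open U -> (forall q, U q -> 0 < f q) -> Ck k U f ->
  Ck k U (fun q => Num.sqrt (f q)).
Proof.
move=> oU f0; elim: k => [|k IH] hf.
  split => // p Up.
  by have [] := derivable_sqrt_comp 0 (f0 _ Up) (Ck_diff hf Up).
split=> [p Up|v].
  by have [] := derivable_sqrt_comp 0 (f0 _ Up) (Ck_diff hf Up).
have h2 := CkM oU (Ck_cst k U (2 : R)) (IH (CkW hf)).
have hn : forall q, U q -> 2 * Num.sqrt (f q) != 0.
  by move=> q Uq; rewrite mulf_neq0 ?pnatr_eq0 // gt_eqF // sqrtr_gt0 f0.
have := CkM oU (CkV oU hn h2) (hf.2 v).
apply: Ck_eq oU _ => q Uq.
by have [_ ->] := derivable_sqrt_comp v (f0 _ Uq) (Ck_diff hf Uq).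
Qed.

Lemma Ck_mxP m n k U (f : V -> 'M[R]_(m, n)) : open U ->
  Ck k U f <-> forall i j, Ck k U (fun q => f q i j).
Proof.
move=> oU; elim: k f => [|k IH] f.
  split=> [[df _] i j|h]; split=> // p Up.
    by have /differentiable_mxP := df p Up.
  by apply/differentiable_mxP => i j; exact: Ck_diff (h i j) Up.
split=> [[df dd] i j|h].
  split=> [p Up|v]; first by have /differentiable_mxP := df p Up.
  have /IH /(_ i j) := dd v; apply: Ck_eq oU _ => q Uq.
  by rewrite derive_mx ?mxE //; apply: diff_derivable; exact: df.
have df p : U p -> differentiable f p.
  by move=> Up; apply/differentiable_mxP => i j; exact: Ck_diff (h i j) Up.
split=> // v; apply/IH => i j; have := (h i j).2 v.
apply: Ck_eq oU _ => q Uq.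
by rewrite derive_mx ?mxE //; apply: diff_derivable; exact: df.
Qed.

End Ck.

(** * Rules for directional derivatives *)

Section SmoothCinf.
Variables (R : realType) (n m : nat).

Lemma smoothP U (f : 'rV[R]_n -> 'rV[R]_m) : smooth U f <-> Cinf U f.
Proof.
split=> [sf k|cf vs].
  suff: forall vs, Ck k U (foldr (fun v g => 'D_v g) f vs) by move/(_ [::]).
  elim: k => [|k IH] vs; first by split=> // p; exact: sf.
  split=> [p|v]; first exact: sf.
  exact: (IH (v :: vs)).
suff h : Cinf U (foldr (fun v g => 'D_v g) f vs).
  by move=> p Up; exact: Ck_diff (h 0%N) Up.
elim: vs => [//|v vs IH] k; exact: (IH k.+1).2.
Qed.

End SmoothCinf.

Section Rules.
Variables (R : realType) (V : normedModType R).
Implicit Types (p v : V).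

Lemma derive_comp (V' : normedModType R) (W : normedModType R)
    (g : V -> V') (f : V' -> W) p v :
  differentiable g p -> differentiable f (g p) ->
  'D_v (f \o g) p = 'D_('D_v g p) f (g p).
Proof.
move=> dg df; rewrite deriveE; last exact: differentiable_comp.
by rewrite diff_comp //= -(deriveE v dg) -deriveE.
Qed.

Lemma derive_lin (W : normedModType R) (f : V -> W) p a b v w :
  differentiable f p -> 'D_(a *: v + b *: w) f p = a *: 'D_v f p + b *: 'D_w f p.
Proof. by move=> df; rewrite !deriveE // linearP linearZ. Qed.

Lemma derive_scale_dir (W : normedModType R) (f : V -> W) p a v :
  differentiable f p -> 'D_(a *: v) f p = a *: 'D_v f p.
Proof. by move=> df; rewrite !deriveE // linearZ. Qed.

Lemma derive_coord m n (f : V -> 'M[R]_(m, n)) p v i j :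
  differentiable f p -> ('D_v f p) i j = 'D_v (fun q => f q i j) p.
Proof.
by move=> df; rewrite derive_mx ?mxE //; exact: diff_derivable.
Qed.

Lemma derive_mulmx m n l (f : V -> 'M[R]_(m, n)) (g : V -> 'M[R]_(n, l)) p v :
  differentiable f p -> differentiable g p ->
  'D_v (fun q => f q *m g q) p = 'D_v f p *m g p + f p *m 'D_v g p.
Proof.
move=> df dg.
have dfc i j : differentiable (fun q => f q i j) p.
  by have /differentiable_mxP := df.
have dgc i j : differentiable (fun q => g q i j) p.
  by have /differentiable_mxP := dg.
have e i j : (fun q => (f q *m g q) i j) =
    \sum_(k < n) ((fun q => f q i k) * (fun q => g q k j)).
  by apply/funext => q; rewrite mxE fct_sumE.
have dfg : differentiable (fun q => f q *m g q) p.
  apply/differentiable_mxP => i j; rewrite e; apply: differentiable_sum => k.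
  exact: differentiableM.
apply/matrixP => i j; rewrite derive_coord // e derive_sum; last first.
  by move=> k; apply: derivableM; exact: diff_derivable.
rewrite !mxE -big_split; apply: eq_bigr => k _ /=.
rewrite deriveM; [|exact: diff_derivable..].
by rewrite !derive_coord // addrC; congr (_ + _); exact: mulrC.
Qed.

Lemma differentiable_mulmx m n l (f : V -> 'M[R]_(m, n)) (g : V -> 'M[R]_(n, l)) p :
  differentiable f p -> differentiable g p ->
  differentiable (fun q => f q *m g q) p.
Proof.
move=> /differentiable_mxP df /differentiable_mxP dg.
apply/differentiable_mxP => i j.
rewrite (_ : (fun _ => _) =
    \sum_(k < n) ((fun q => f q i k) * (fun q => g q k j))).
  by apply: differentiable_sum => k; exact: differentiableM.
by apply/funext => q; rewrite mxE fct_sumE.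
Qed.

Lemma derive_mulmxr m n l (f : V -> 'M[R]_(m, n)) (A : 'M[R]_(n, l)) p v :
  differentiable f p -> 'D_v (fun q => f q *m A) p = 'D_v f p *m A.
Proof.
move=> df; rewrite (@derive_mulmx _ _ _ f (fun=> A)) //.
by rewrite derive_cst mulmx0 addr0.
Qed.

Lemma derive_tr m n (f : V -> 'M[R]_(m, n)) p v :
  differentiable f p -> 'D_v (fun q => (f q)^T) p = ('D_v f p)^T
  /\ differentiable (fun q => (f q)^T) p.
Proof.
move=> df; have /differentiable_mxP dfc := df.
have d : differentiable (fun q => (f q)^T) p.
  apply/differentiable_mxP => i j; rewrite (_ : (fun _ => _) = fun q => f q j i) //.
  by apply/funext => q; rewrite mxE.
split=> //; apply/matrixP => i j; rewrite derive_coord // mxE derive_coord //.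
by congr ('D_v _ p); apply/funext => q; rewrite mxE.
Qed.

Lemma derive_dot (f g : V -> 'rV[R]_4) p v :
  differentiable f p -> differentiable g p ->
  'D_v (fun q => dot (f q) (g q)) p = dot ('D_v f p) (g p) + dot (f p) ('D_v g p).
Proof.
move=> df dg; have [eg dgt] := derive_tr v dg.
have dc : differentiable (fun=> gram R : 'M[R]_4) p by exact: differentiable_cst.
have dfG := differentiable_mulmx df dc.
rewrite /dot -(@derive_coord _ _ (fun q => f q *m gram R *m (g q)^T)); last first.
  exact: differentiable_mulmx.
rewrite (@derive_mulmx _ _ _ (fun q => f q *m gram R)) // eg mxE.
by rewrite derive_mulmxr.
Qed.

Lemma derive_scale m n (s : V -> R) (f : V -> 'M[R]_(m, n)) p v :
  differentiable s p -> differentiable f p ->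
  'D_v (fun q => s q *: f q) p = 'D_v s p *: f p + s p *: 'D_v f p
  /\ differentiable (fun q => s q *: f q) p.
Proof.
move=> ds /[dup] df /differentiable_mxP dfc.
have e i j : (fun q => (s q *: f q) i j) = s * (fun q => f q i j).
  by apply/funext => q; rewrite mxE.
have d : differentiable (fun q => s q *: f q) p.
  by apply/differentiable_mxP => i j; rewrite e; exact: differentiableM.
split=> //; apply/matrixP => i j; rewrite derive_coord // e.
rewrite deriveM; [|exact: diff_derivable..].
by rewrite !mxE derive_coord // addrC; congr (_ + _); exact: mulrC.
Qed.

End Rules.

Section CinfRules.
Variables (R : realType) (V : normedModType R) (U : set V).
Hypothesis oU : open U.

Lemma Cinf_diff (W : normedModType R) (f : V -> W) p :
  Cinf U f -> U p -> differentiable f p.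
Proof. by move=> /(_ 0%N); exact: Ck_diff. Qed.

Lemma Cinf_derive (W : normedModType R) (f : V -> W) v :
  Cinf U f -> Cinf U ('D_v f).
Proof. by move=> cf k; exact: (cf k.+1).2. Qed.

Lemma Cinf_eq (W : normedModType R) (f g : V -> W) :
  (forall q, U q -> f q = g q) -> Cinf U f -> Cinf U g.
Proof. by move=> fg cf k; exact: Ck_eq oU fg (cf k). Qed.

Lemma Cinf_sub (W : normedModType R) U' (f : V -> W) :
  U' `<=` U -> Cinf U f -> Cinf U' f.
Proof. by move=> sU cf k; exact: Ck_sub sU (cf k). Qed.

Lemma Cinf_cst (W : normedModType R) (a : W) : Cinf U (fun=> a).
Proof. by move=> k; exact: Ck_cst. Qed.

Lemma CinfD (W : normedModType R) (f g : V -> W) :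
  Cinf U f -> Cinf U g -> Cinf U (fun q => f q + g q).
Proof. by move=> cf cg k; exact: CkD. Qed.

Lemma CinfM (f g : V -> R) :
  Cinf U f -> Cinf U g -> Cinf U (fun q => f q * g q).
Proof. by move=> cf cg k; exact: CkM. Qed.

Lemma Cinf_sum (I : Type) (s : seq I) (F : I -> V -> R) :
  (forall i, Cinf U (F i)) -> Cinf U (fun q => \sum_(i <- s) F i q).
Proof. by move=> h k; apply: Ck_sum => // i; exact: h. Qed.

Lemma CinfV (f : V -> R) : (forall q, U q -> f q != 0) ->
  Cinf U f -> Cinf U (fun q => (f q)^-1).
Proof. by move=> f0 cf k; exact: CkV. Qed.

Lemma Cinf_sqrt (f : V -> R) : (forall q, U q -> 0 < f q) ->
  Cinf U f -> Cinf U (fun q => Num.sqrt (f q)).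
Proof. by move=> f0 cf k; exact: Ck_sqrt. Qed.

Lemma Cinf_mxP m n (f : V -> 'M[R]_(m, n)) :
  Cinf U f <-> forall i j, Cinf U (fun q => f q i j).
Proof.
split=> [cf i j k|h k]; first by have /Ck_mxP := cf k; exact.
by apply/Ck_mxP => // i j; exact: h.
Qed.

Lemma Cinf_scale m n (s : V -> R) (f : V -> 'M[R]_(m, n)) :
  Cinf U s -> Cinf U f -> Cinf U (fun q => s q *: f q).
Proof.
move=> cs /Cinf_mxP cf; apply/Cinf_mxP => i j.
by apply: Cinf_eq (CinfM cs (cf i j)) => q _; rewrite mxE.
Qed.

Lemma Cinf_mulmx m n l (f : V -> 'M[R]_(m, n)) (g : V -> 'M[R]_(n, l)) :
  Cinf U f -> Cinf U g -> Cinf U (fun q => f q *m g q).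
Proof.
move=> /Cinf_mxP cf /Cinf_mxP cg; apply/Cinf_mxP => i j.
apply: (@Cinf_eq _ (fun q => \sum_k (f q i k * g q k j))).
  by move=> q _; rewrite mxE.
by apply: Cinf_sum => k; exact: CinfM.
Qed.

Lemma Cinf_tr m n (f : V -> 'M[R]_(m, n)) :
  Cinf U f -> Cinf U (fun q => (f q)^T).
Proof.
move=> /Cinf_mxP cf; apply/Cinf_mxP => i j.
by apply: Cinf_eq (cf j i) => q _; rewrite mxE.
Qed.

Lemma Cinf_dot (f g : V -> 'rV[R]_4) :
  Cinf U f -> Cinf U g -> Cinf U (fun q => dot (f q) (g q)).
Proof.
move=> cf cg.
by have /Cinf_mxP := Cinf_mulmx (Cinf_mulmx cf (Cinf_cst (gram R))) (Cinf_tr cg); exact.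
Qed.

End CinfRules.

Section Composition.
Variables (R : realType) (n : nat).

Lemma derive_row_sum (V W : normedModType R) (f : 'rV[R]_n -> W) q v :
  differentiable f q -> 'D_v f q = \sum_i v 0 i *: 'D_(delta_mx 0 i) f q.
Proof.
move=> df; rewrite {1}(row_sum_delta v) deriveE // linear_sum.
by apply: eq_bigr => i _; rewrite linearZ deriveE.
Qed.

(** By the chain rule a derivative of f o g is a sum of products of
    derivatives of g with compositions (D_i f) o g, to which the induction
    hypothesis applies. *)
Lemma Ck_comp (V : normedModType R) k U U' (g : V -> 'rV[R]_n) (f : 'rV[R]_n -> R) :
  open U -> (forall q, U q -> U' (g q)) ->
  Ck k U g -> Ck k U' f -> Ck k U (f \o g).
Proof.
move=> oU gU; elim: k f => [|k IH] f cg cf.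
  split=> // p Up; apply: differentiable_comp; first exact: Ck_diff cg Up.
  exact: Ck_diff cf (gU _ Up).
split=> [p Up|v].
  apply: differentiable_comp; first exact: Ck_diff cg Up.
  exact: Ck_diff cf (gU _ Up).
have h : Ck k U (fun q => \sum_i ('D_v g q) 0 i * ('D_(delta_mx 0 i) f \o g) q).
  apply: Ck_sum => // i; apply: CkM => //.
    by have /Ck_mxP := cg.2 v; exact.
  by apply: IH; [exact: CkW|exact: cf.2].
apply: Ck_eq oU _ h => q Uq.
rewrite (@derive_comp _ _ _ _ g f); [|exact: Ck_diff cg Uq|exact: Ck_diff cf (gU _ Uq)].
by rewrite [RHS]derive_row_sum //; exact: Ck_diff cf (gU _ Uq).
Qed.

Lemma Cinf_comp (V : normedModType R) m l U U' (g : V -> 'rV[R]_n)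
    (f : 'rV[R]_n -> 'M[R]_(m, l)) : open U -> open U' ->
  (forall q, U q -> U' (g q)) ->
  Cinf U g -> Cinf U' f -> Cinf U (f \o g).
Proof.
move=> oU oU' gU cg cf k; apply/(Ck_mxP _ _ oU) => i j.
apply: (Ck_comp oU gU (cg k) (f := fun q => f q i j)).
by have /(Ck_mxP _ _ oU') := cf k; exact.
Qed.

End Composition.

(** * Symmetry of second derivatives, and maps with zero derivative *)

Section Lines.
Variables (R : realType) (V : normedModType R).
Implicit Types (p v w : V).

Lemma is_derive_line (f : V -> R) (u v : V) (t : R) :
  differentiable f (u + t *: v) ->
  is_derive t (1 : R) (fun t : R => f (u + t *: v)) ('D_v f (u + t *: v)).
Proof.
move=> df.
have [ds es] : is_diff t ( *:%R^~ v : R -> V) ( *:%R^~ v) by exact: is_diff_scalel.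
have dcu : differentiable (cst u : R -> V) t by exact: differentiable_cst.
have dl1 : differentiable (fun t : R => u + t *: v) t by exact: differentiableD.
have dv : 'D_(1 : R) (fun t : R => u + t *: v) t = v.
  rewrite [LHS](@deriveD R R V (cst u : R -> V) ( *:%R^~ v : R -> V)); [|exact: diff_derivable..].
  by rewrite derive_cst add0r deriveE // es scale1r.
have dc : differentiable (f \o (fun t : R => u + t *: v)) t.
  exact: differentiable_comp.
apply: DeriveDef; first exact: diff_derivable.
have := @derive_comp _ _ _ _ (fun t : R => u + t *: v) f t (1 : R) dl1 df.
by rewrite dv.
Qed.

Lemma derive0_line_cst (f : V -> R) (u v : V) :
  (forall t : R, 0 <= t <= 1 -> differentiable f (u + t *: v)) ->
  (forall t : R, 0 <= t <= 1 -> 'D_v f (u + t *: v) = 0) ->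
  f (u + v) = f u.
Proof.
move=> df d0.
have hd (t : R) : t \in `[0, 1]%R ->
    is_derive t (1 : R) (fun t : R => f (u + t *: v)) ('D_v f (u + t *: v)).
  by rewrite in_itv /= => ht; apply: is_derive_line; exact: df.
have hc : {within `[0 : R, 1], continuous (fun t : R => f (u + t *: v))}.
  by apply: derivable_within_continuous => t /hd [].
have [c c01] := @MVT_segment R (fun t : R => f (u + t *: v))
  (fun t : R => 'D_v f (u + t *: v)) 0 1 ler01
  (fun t ht => hd t (subset_itv_oo_cc ht)) hc.
rewrite scale1r scale0r addr0 d0; last by move: c01; rewrite in_itv.
by rewrite mul0r => /subr0_eq.
Qed.

(** The mean value theorem along v reduces the second difference to an
    increment of D_v f, and differentiability of D_v f at p evaluates this
    increment up to o(s). *)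
Lemma second_difference (f : V -> R) p v w :
  (\forall q \near p, differentiable f q) -> differentiable ('D_v f) p ->
  forall e : R, 0 < e -> exists2 d : R, 0 < d & forall s : R, 0 < s < d ->
    `|f (p + s *: v + s *: w) - f (p + s *: v) - f (p + s *: w) + f p
      - s ^+ 2 * 'D_w ('D_v f) p| <= e * s ^+ 2.
Proof.
move=> ndf dg e e0; set g := 'D_v f.
set N := `|v| + `|w| + 1.
have N0 : 0 < N by rewrite ltr_pwDr // addr_ge0.
(* the two remainders of D_v f contribute at most eta * s * N each *)
set eta := e / (2 * N).
have eta0 : 0 < eta by rewrite divr_gt0 // mulr_gt0.
have /nbhs_ballP[d1 /= d10 hd1] := ndf.
have [d2 d20 hd2] : exists2 d2 : R, 0 < d2 & forall h : V, `|h| < d2 ->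
    `|g (p + h) - g p - 'd g p h| <= eta * `|h|.
  have /eqaddoP hdg := diff_locally dg.
  have /nbhs_ballP[d2 /= d20 hd2] := hdg eta eta0; exists d2 => // h hh.
  have := hd2 h; rewrite -ball_normE /= sub0r normrN => /(_ hh).
  by rewrite !fctE /= [p + h]addrC opprD addrA.
exists (Num.min d1 d2 / N); first by rewrite divr_gt0 // lt_min d10.
move=> s /andP[s0 sd].
have sN : s * N < Num.min d1 d2 by rewrite -ltr_pdivlMr.
have small (t : R) u : 0 <= t <= s -> `|u| <= s * `|w| ->
    `|t *: v + u| <= s * (`|v| + `|w|) /\ `|t *: v + u| < Num.min d1 d2.
  move=> /andP[t0 ts] hu.
  have h : `|t *: v + u| <= s * (`|v| + `|w|).
    rewrite (le_trans (ler_normD _ _)) // mulrDr lerD // normrZ ger0_norm //.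
    by rewrite ler_wpM2r.
  split=> //; apply: le_lt_trans h (le_lt_trans _ sN).
  by rewrite ler_pM2l // /N lerDl.
have hw1 : `|s *: w| <= s * `|w| by rewrite normrZ gtr0_norm.
have hw0 : `|0 : V| <= s * `|w| by rewrite normr0 mulr_ge0 // ltW.
have dif (t : R) u : 0 <= t <= s -> `|u| <= s * `|w| ->
    differentiable f (p + u + t *: v).
  move=> ht hu; apply: hd1; rewrite -ball_normE /=.
  rewrite -addrA opprD addrA subrr sub0r normrN addrC.
  by have [_] := small _ _ ht hu; rewrite lt_min => /andP[].
pose F (t : R) := f (p + s *: w + t *: v) - f (p + t *: v).
pose F' (t : R) := g (p + s *: w + t *: v) - g (p + t *: v).
have hF (t : R) : t \in `[0, s]%R -> is_derive t (1 : R) F (F' t).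
  rewrite in_itv /= => ht.
  have h1 := is_derive_line (dif t _ ht hw1).
  have h2 := is_derive_line (dif t _ ht hw0).
  rewrite addr0 in h2.
  exact: is_deriveB.
have hc : {within `[0 : R, s], continuous F}.
  by apply: derivable_within_continuous => t /hF [].
have [c cs] := @MVT_segment R F F' 0 s (ltW s0)
  (fun t ht => hF t (subset_itv_oo_cc ht)) hc.
rewrite in_itv /= in cs.
rewrite /F scale0r !addr0 subr0 => eF.
have -> : f (p + s *: v + s *: w) - f (p + s *: v) - f (p + s *: w) + f p
    = F' c * s.
  by rewrite -eF [p + s *: v + _]addrAC; ring.
have [h1 k1] := small _ _ cs hw1.
have [h2 k2] := small _ _ cs hw0.
have b1 := hd2 (c *: v + s *: w); have b2 := hd2 (c *: v).
rewrite lt_min in k1; have /andP[_ {}k1] := k1.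
rewrite addr0 in h2 k2.
rewrite lt_min in k2; have /andP[_ {}k2] := k2.
have {}b1 := b1 k1; have {}b2 := b2 k2.
have dgw : 'D_w g p = 'd g p w by rewrite deriveE.
have -> : F' c * s - s ^+ 2 * 'D_w g p =
   s * ((g (p + (c *: v + s *: w)) - g p - 'd g p (c *: v + s *: w))
   - (g (p + c *: v) - g p - 'd g p (c *: v))).
  have -> : 'd g p (c *: v + s *: w) = 'd g p (c *: v) + s * 'd g p w.
    by rewrite linearD; congr (_ + _); exact: linearZ.
  rewrite dgw /F' [p + s *: w + _]addrAC -addrA.
  by ring.
rewrite normrM gtr0_norm // expr2 mulrCA ler_pM2l //.
apply: le_trans (ler_normB _ _) _.
apply: le_trans (lerD b1 b2) _.
apply: (@le_trans _ _ (eta * (s * N) + eta * (s * N))).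
  rewrite lerD // ler_pM2l //.
    by apply: le_trans h1 _; rewrite ler_pM2l // lerDl.
  by apply: le_trans h2 _; rewrite ler_pM2l // lerDl.
rewrite -mulrDl /eta; have -> : (e / (2 * N) + e / (2 * N)) = e / N.
  by field; rewrite gt_eqF.
by rewrite mulrCA divfK ?gt_eqF // mulrC.
Qed.

(** The second difference is symmetric in v and w, so both iterated
    derivatives are its limit after division by s ^ 2. *)
Lemma schwarz_at (f : V -> R) p v w :
  (\forall q \near p, differentiable f q) ->
  differentiable ('D_v f) p -> differentiable ('D_w f) p ->
  'D_v ('D_w f) p = 'D_w ('D_v f) p.
Proof.
move=> ndf dv dw; apply/eqP; rewrite -subr_eq0 -normr_eq0 eq_le normr_ge0 andbT.
apply/ler_addgt0Pr => e e0; rewrite add0r.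
have e20 : 0 < e / 2 by rewrite divr_gt0.
have [d1 d10 h1] := second_difference w ndf dv e20.
have [d2 d20 h2] := second_difference v ndf dw e20.
pose s := Num.min d1 d2 / 2.
have m0 : 0 < Num.min d1 d2 by rewrite lt_min d10.
have s0 : 0 < s by rewrite divr_gt0.
have sm : s < Num.min d1 d2 by rewrite /s ltr_pdivrMr // ltr_pMr // ltr1n.
move: (sm); rewrite lt_min => /andP[s1 s2].
have {h1} := h1 s; rewrite s0 s1 => /(_ isT) h1.
have {h2} := h2 s; rewrite s0 s2 => /(_ isT) h2.
have s20 : 0 < s ^+ 2 by rewrite exprn_gt0.
rewrite -(ler_pM2r s20) -{1}(gtr0_norm s20) -normrM.
move: h1 h2; rewrite [p + s *: w + s *: v]addrAC.
set a := f _; set b := f (p + s *: v); set c := f (p + s *: w).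
set X := 'D_w _ p; set Y := 'D_v _ p => h1 h2.
have -> : (Y - X) * s ^+ 2 = (a - b - c + f p - s ^+ 2 * X)
   - (a - c - b + f p - s ^+ 2 * Y) by ring.
apply: le_trans (ler_normB _ _) _; apply: le_trans (lerD h1 h2) _.
by rewrite -mulrDl -splitr.
Qed.

Lemma schwarz U m n (f : V -> 'M[R]_(m, n)) p v w :
  open U -> Cinf U f -> U p -> 'D_v ('D_w f) p = 'D_w ('D_v f) p.
Proof.
move=> oU cf Up; have /(Cinf_mxP oU) cfc := cf.
have dd u z i j : ('D_u ('D_z f) p) i j = 'D_u ('D_z (fun q => f q i j)) p.
  rewrite derive_coord; last exact: Cinf_diff (Cinf_derive _ cf) Up.
  apply: (eq_on_derive _ oU _ Up) => q Uq.
  by rewrite derive_coord //; exact: Cinf_diff cf Uq.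
apply/matrixP => i j.
refine (etrans (dd v w i j) (etrans _ (esym (dd w v i j)))).
apply: (@schwarz_at (fun q => f q i j)).
- by apply: (open_near oU Up) => q Uq; exact: Cinf_diff (cfc i j) Uq.
- exact: Cinf_diff (Cinf_derive _ (cfc i j)) Up.
- exact: Cinf_diff (Cinf_derive _ (cfc i j)) Up.
Qed.

End Lines.

Section Balls.
Variables (R : realType) (V : normedModType R).

Lemma ball_segment (p q u : V) (r t : R) :
  ball p r q -> ball p r u -> 0 <= t <= 1 -> ball p r (q + t *: (u - q)).
Proof.
rewrite -ball_normE /= => hq hu /andP[t0 t1].
have -> : p - (q + t *: (u - q)) = (1 - t) *: (p - q) + t *: (p - u).
  rewrite opprD addrA -scalerN opprB scalerBl scale1r -[RHS]addrA; congr (_ + _).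
  by rewrite addrC -scalerBr opprB [p - u + _]addrC addrA subrK.
apply: le_lt_trans (ler_normD _ _) _; rewrite !normrZ !ger0_norm ?subr_ge0 //.
have [->|tn0] := eqVneq t 0; first by rewrite subr0 mul1r mul0r addr0.
have tp : 0 < t by rewrite lt_def tn0.
have h1 : t * `|p - u| < t * r by rewrite ltr_pM2l.
have h2 : (1 - t) * `|p - q| <= (1 - t) * r by rewrite ler_wpM2l ?subr_ge0 // ltW.
by apply: lt_le_trans (ler_ltD h2 h1) _; rewrite -mulrDl subrK mul1r.
Qed.

Lemma connected_ball (p : V) (r : R) : 0 < r -> connected (ball p r).
Proof.
move=> r0.
have -> : ball p r =
    \bigcup_(q in ball p r) ((fun t : R => p + t *: (q - p)) @` `[0, 1]).
  apply/seteqP; split=> [q bq|q [u bu [t /=]]].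
    exists q => //; exists 1; first by rewrite /= in_itv /= ler01 lexx.
    by rewrite scale1r addrC subrK.
  rewrite in_itv /= => t01 <-; apply: ball_segment => //.
  exact: ballxx.
apply: bigcup_connected => [|q bq].
  exists p => q bq; exists 0; first by rewrite /= in_itv /= ler01 lexx.
  by rewrite scale0r addr0.
apply: connected_continuous_connected; first exact: segment_connected.
apply: continuous_subspaceT => t.
by apply: cvgD; [exact: cvg_cst|apply: cvgZr_tmp; exact: cvg_id].
Qed.

Lemma open_sub_ball (U : set V) p : open U -> U p ->
  exists2 r : R, 0 < r & ball p r `<=` U.
Proof.
by move=> oU Up; have /nbhs_ballP[r r0 h] := open_nbhs_nbhs (conj oU Up); exists r.
Qed.

(** The mean value theorem on the segment from the centre. *)
Lemma ball_derive0_cst (p : V) (r : R) m n (f : V -> 'M[R]_(m, n)) : 0 < r ->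
  (forall q, ball p r q -> differentiable f q) ->
  (forall q v, ball p r q -> 'D_v f q = 0) ->
  forall q, ball p r q -> f q = f p.
Proof.
move=> r0 df d0 q bq; apply/matrixP => i j.
rewrite -[in LHS](subrKC p q).
have bt (t : R) : 0 <= t <= 1 -> ball p r (p + t *: (q - p)).
  by move=> t01; apply: ball_segment => //; exact: ballxx.
apply: (@derive0_line_cst _ _ (fun q => f q i j)) => t /bt bt'.
  by have /differentiable_mxP := df _ bt'.
by rewrite -derive_coord ?d0 ?mxE //; exact: df.
Qed.

End Balls.

(** * Scalar product and determinants in dimension four *)

Section Algebra4.
Variable K : comNzRingType.
Implicit Types (a b c d v w : 'rV[K]_4).

(** Entries are indexed by nat so that polynomial identities in coordinates
    reach [ring] in normal form. *)
Definition co a (k : nat) : K := a 0 (inord k).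

Lemma coE a (i : 'I_4) : a 0 i = co a i.
Proof. by rewrite /co inord_val. Qed.

Lemma sum4E (F : nat -> K) : \sum_(i < 4) F i = F 0%N + F 1%N + F 2%N + F 3%N.
Proof. by rewrite !big_ord_recl big_ord0 /= addr0 !addrA. Qed.

Lemma dotE a b : dot a b =
  - (co a 0 * co b 0) + co a 1 * co b 1 - co a 2 * co b 2 + co a 3 * co b 3.
Proof.
rewrite /dot /gram mul_mx_diag mxE.
under eq_bigr => i _ do rewrite !mxE !coE.
rewrite (sum4E (fun i => co a i * (-1) ^+ i.+1 * co b i)).
by rewrite expr1 -signr_odd /= -[(-1) ^+ 3]signr_odd -[(-1) ^+ 4]signr_odd /=; ring.
Qed.

Lemma coD a b k : co (a + b) k = co a k + co b k. Proof. by rewrite /co mxE. Qed.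
Lemma coN a k : co (- a) k = - co a k. Proof. by rewrite /co mxE. Qed.
Lemma coZ s a k : co (s *: a) k = s * co a k. Proof. by rewrite /co mxE. Qed.
Lemma co0 k : co 0 k = 0. Proof. by rewrite /co mxE. Qed.
Definition co_lin := (coD, coN, coZ, co0).

Lemma dotC a b : dot a b = dot b a. Proof. by rewrite !dotE; ring. Qed.
Lemma dotDl a b c : dot (a + b) c = dot a c + dot b c.
Proof. by rewrite !dotE !co_lin; ring. Qed.
Lemma dotDr a b c : dot c (a + b) = dot c a + dot c b.
Proof. by rewrite !dotE !co_lin; ring. Qed.
Lemma dotZl s a b : dot (s *: a) b = s * dot a b.
Proof. by rewrite !dotE !co_lin; ring. Qed.
Lemma dotZr s a b : dot a (s *: b) = s * dot a b.
Proof. by rewrite !dotE !co_lin; ring. Qed.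
Lemma dotNl a b : dot (- a) b = - dot a b.
Proof. by rewrite !dotE !co_lin; ring. Qed.
Lemma dotNr a b : dot a (- b) = - dot a b.
Proof. by rewrite !dotE !co_lin; ring. Qed.
Lemma dot0l a : dot 0 a = 0. Proof. by rewrite !dotE !co_lin; ring. Qed.
Lemma dot0r a : dot a 0 = 0. Proof. by rewrite dotC dot0l. Qed.
Definition dot_lin := (dotDl, dotDr, dotZl, dotZr, dotNl, dotNr, dot0l, dot0r).

Lemma det_gram : \det (gram K) = 1.
Proof.
rewrite /gram det_diag !big_ord_recl big_ord0 !mxE /=.
by rewrite expr1 -signr_odd /= -[(-1) ^+ 3]signr_odd -[(-1) ^+ 4]signr_odd /=; ring.
Qed.

Lemma det_fun_recl n (f : nat -> nat -> K) :
  \det (\matrix_(i < n.+1, j < n.+1) f i j) =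
  \sum_(j < n.+1) (-1) ^+ j * f 0%N j *
    \det (\matrix_(i < n, k < n) f i.+1 (bump j k)).
Proof.
rewrite (expand_det_row _ ord0); apply: eq_bigr => j _.
rewrite mxE /cofactor add0n mulrCA mulrA; congr (_ * \det _).
by apply/matrixP => i k; rewrite !mxE.
Qed.

Lemma det2_fun (f : nat -> nat -> K) : \det (\matrix_(i < 2, j < 2) f i j) =
  f 0 0 * f 1 1 - f 0 1 * f 1 0.
Proof.
rewrite det_fun_recl !big_ord_recl big_ord0 !det_mx11 !mxE /= /bump /=.
by ring.
Qed.

Lemma det3_fun (f : nat -> nat -> K) : \det (\matrix_(i < 3, j < 3) f i j) =
    f 0 0 * (f 1 1 * f 2 2 - f 1 2 * f 2 1)
  - f 0 1 * (f 1 0 * f 2 2 - f 1 2 * f 2 0)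
  + f 0 2 * (f 1 0 * f 2 1 - f 1 1 * f 2 0).
Proof.
rewrite det_fun_recl !big_ord_recl big_ord0 /=.
rewrite !(det2_fun (fun i k => f i.+1 (bump _ k))) /bump /=; ring.
Qed.

Lemma det4_fun (f : nat -> nat -> K) : \det (\matrix_(i < 4, j < 4) f i j) =
  let m i j k l := f i%N 0%N * (f j 1%N * (f k 2%N * f l 3%N)) in
    m 0 1 2 3 - m 0 1 3 2 - m 0 2 1 3 + m 0 2 3 1 + m 0 3 1 2 - m 0 3 2 1
  - m 1 0 2 3 + m 1 0 3 2 + m 1 2 0 3 - m 1 2 3 0 - m 1 3 0 2 + m 1 3 2 0
  + m 2 0 1 3 - m 2 0 3 1 - m 2 1 0 3 + m 2 1 3 0 + m 2 3 0 1 - m 2 3 1 0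
  - m 3 0 1 2 + m 3 0 2 1 + m 3 1 0 2 - m 3 1 2 0 - m 3 2 0 1 + m 3 2 1 0%N.
Proof.
rewrite det_fun_recl !big_ord_recl big_ord0 /=.
rewrite !(det3_fun (fun i k => f i.+1 (bump _ k))) /bump /=; ring.
Qed.

Definition rows4 a b c d : 'M[K]_4 := \matrix_(i < 4) [:: a; b; c; d]`_i.
Definition det4 a b c d : K := \det (rows4 a b c d).

Lemma det4E a b c d : det4 a b c d =
  let m i j k l := co [:: a; b; c; d]`_i 0%N * (co [:: a; b; c; d]`_j 1%N *
    (co [:: a; b; c; d]`_k 2%N * co [:: a; b; c; d]`_l 3%N)) in
    m 0 1 2 3 - m 0 1 3 2 - m 0 2 1 3 + m 0 2 3 1 + m 0 3 1 2 - m 0 3 2 1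
  - m 1 0 2 3 + m 1 0 3 2 + m 1 2 0 3 - m 1 2 3 0 - m 1 3 0 2 + m 1 3 2 0
  + m 2 0 1 3 - m 2 0 3 1 - m 2 1 0 3 + m 2 1 3 0 + m 2 3 0 1 - m 2 3 1 0
  - m 3 0 1 2 + m 3 0 2 1 + m 3 1 0 2 - m 3 1 2 0 - m 3 2 0 1 + m 3 2 1 0%N.
Proof.
rewrite -[RHS](det4_fun (fun i j => co [:: a; b; c; d]`_i j)).
by congr (\det _); apply/matrixP => i j; rewrite !mxE coE.
Qed.

Lemma det4_mulmx a b c d (A : 'M[K]_4) :
  det4 (a *m A) (b *m A) (c *m A) (d *m A) = det4 a b c d * \det A.
Proof.
rewrite /det4 -det_mulmx; congr (\det _); apply/row_matrixP => i.
rewrite row_mul !rowK; move: i => [[|[|[|[|//]]]] /= ilt] //.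
Qed.

Lemma det4_lin p q r s p' q' r' s' a b c d :
  det4 (p *: a + q *: b) (r *: a + s *: b) (p' *: c + q' *: d) (r' *: c + s' *: d)
  = (p * s - q * r) * (p' * s' - q' * r') * det4 a b c d.
Proof. rewrite !det4E /= !co_lin; ring. Qed.

(** Scalar products of two frames are the entries of one matrix product. *)
Lemma rows4_gram a b c d a' b' c' d' i j :
  (rows4 a b c d *m gram K *m (rows4 a' b' c' d')^T) i j =
  dot [:: a; b; c; d]`_i [:: a'; b'; c'; d']`_j.
Proof.
have -> : [:: a; b; c; d]`_i = row i (rows4 a b c d) by rewrite rowK.
have -> : [:: a'; b'; c'; d']`_j = row j (rows4 a' b' c' d') by rewrite rowK.
rewrite /dot -row_mul [LHS]mxE [RHS]mxE; apply: eq_bigr => k _.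
by congr (_ * _); rewrite [RHS]mxE // [LHS]mxE [RHS]mxE.
Qed.

(** The matrix of the scalar product has determinant 1. *)
Lemma det4_gram a b c d a' b' c' d' :
  det4 a b c d * det4 a' b' c' d' =
  \det (\matrix_(i < 4, j < 4) dot [:: a; b; c; d]`_i [:: a'; b'; c'; d']`_j).
Proof.
rewrite /det4 -[\det (rows4 a' b' c' d')]det_tr -[in LHS](mulr1 (\det _)) -det_gram.
rewrite -!det_mulmx; congr (\det _); apply/matrixP => i j.
by rewrite [RHS]mxE rows4_gram.
Qed.

(** The vector product of three vectors: its scalar product with w is det4 a b
    c w ([dot_cross]). *)
Definition cross a b c : 'rV[K]_4 :=
  \row_j ((-1) ^+ j.+1 * det4 a b c (delta_mx 0 j)).

Lemma det4Dr a b c d d' : det4 a b c (d + d') = det4 a b c d + det4 a b c d'.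
Proof. rewrite !det4E /= !co_lin; ring. Qed.
Lemma det4Zr a b c d s : det4 a b c (s *: d) = s * det4 a b c d.
Proof. rewrite !det4E /= !co_lin; ring. Qed.

Lemma dot_cross a b c w : dot (cross a b c) w = det4 a b c w.
Proof.
rewrite {2}[w]row_sum_delta.
have -> : det4 a b c (\sum_j w 0 j *: delta_mx 0 j) =
    \sum_j w 0 j * det4 a b c (delta_mx 0 j).
  apply: (big_rec2 (fun x y => det4 a b c x = y)).
    by rewrite -[0](scale0r 0) det4Zr mul0r.
  by move=> i x y _ <-; rewrite det4Dr det4Zr.
rewrite /dot /gram mul_mx_diag mxE; apply: eq_bigr => j _; rewrite !mxE.
by rewrite [_ * _ * (-1) ^+ _]mulrAC -exprD addnn -signr_odd odd_double mul1r mulrC.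
Qed.

Lemma det4_rep1 a b c : det4 a b c a = 0.
Proof. rewrite !det4E /=; ring. Qed.
Lemma det4_rep2 a b c : det4 a b c b = 0.
Proof. rewrite !det4E /=; ring. Qed.
Lemma det4_rep3 a b c : det4 a b c c = 0.
Proof. rewrite !det4E /=; ring. Qed.

Lemma co_cross a b c k : (k < 4)%N -> co (cross a b c) k =
  (-1) ^+ k.+1 * det4 a b c (\row_j (j == k :> nat)%:R).
Proof.
move=> k4; rewrite /co mxE inordK //; congr (_ * det4 _ _ _ _).
by apply/rowP => j; rewrite !mxE /= -val_eqE /= inordK.
Qed.

(** The right-hand side is the Gram determinant of (a, b, c). *)
Lemma dot_cross_cross a b c : dot (cross a b c) (cross a b c) =
    dot a a * (dot b b * dot c c - dot b c * dot b c)
  - dot a b * (dot a b * dot c c - dot b c * dot a c)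
  + dot a c * (dot a b * dot b c - dot b b * dot a c).
Proof.
rewrite (dotE (cross a b c)) !co_cross // !det4E /= /co !mxE !inordK //=.
rewrite !dotE /co; ring.
Qed.

End Algebra4.

(** * Bases and orthogonal projections *)

Section Bases.
Variable R : realType.
Implicit Types (a b c d v w : 'rV[R]_4).

Lemma unit_gram : gram R \in unitmx.
Proof. by rewrite unitmxE det_gram unitr1. Qed.

Lemma dot_rows4_eq0 w a b c d : det4 a b c d != 0 ->
  dot w a = 0 -> dot w b = 0 -> dot w c = 0 -> dot w d = 0 -> w = 0.
Proof.
move=> D0 wa wb wc wd.
have uF : (rows4 a b c d)^T \in unitmx by rewrite unitmx_tr unitmxE unitfE.
have h : w *m gram R *m (rows4 a b c d)^T = 0.
  apply/rowP => j; rewrite [RHS]mxE.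
  have -> : (w *m gram R *m (rows4 a b c d)^T) 0 j = dot w [:: a; b; c; d]`_j.
    have -> : [:: a; b; c; d]`_j = row j (rows4 a b c d) by rewrite rowK.
    rewrite /dot [LHS]mxE [RHS]mxE; apply: eq_bigr => k _.
    by congr (_ * _); rewrite [LHS]mxE [RHS]mxE [RHS]mxE.
  by case: j => -[|[|[|[|//]]]].
have {}h : w *m gram R = 0 by rewrite -[LHS](mulmxK uF) h mul0mx.
by rewrite -[LHS](mulmxK unit_gram) h mul0mx.
Qed.

Lemma dot_nondeg w : (forall v, dot w v = 0) -> w = 0.
Proof.
move=> h; apply/rowP => j; have := h (delta_mx 0 j).
rewrite /dot /gram mul_mx_diag mxE (bigD1 j) //= big1 => [|i ij]; last first.
  by rewrite !mxE (negPf ij) /= mulr0.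
rewrite !mxE !eqxx mulr1 addr0 => /eqP.
by rewrite mulf_eq0 signr_eq0 orbF => /eqP.
Qed.

Definition orthonormal4 (t1 t2 n1 n2 : 'rV[R]_4) : Prop :=
  [/\ dot t1 t1 = -1, dot t2 t2 = 1, dot n1 n1 = -1 & dot n2 n2 = 1] /\
  [/\ dot t1 t2 = 0, dot n1 n2 = 0 &
   [/\ dot t1 n1 = 0, dot t1 n2 = 0, dot t2 n1 = 0 & dot t2 n2 = 0]].

(** The Gram determinant of the basis is 1. *)
Lemma orthonormal4_det t1 t2 n1 n2 :
  orthonormal4 t1 t2 n1 n2 -> det4 t1 t2 n1 n2 ^+ 2 = 1.
Proof.
move=> [[h1 h2 h3 h4] [h5 h6 [h7 h8 h9 h10]]].
rewrite expr2 det4_gram.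
rewrite (det4_fun (fun i j => dot [:: t1; t2; n1; n2]`_i [:: t1; t2; n1; n2]`_j)) /=.
rewrite (dotC t2 t1) (dotC n2 n1) (dotC n1 t1) (dotC n1 t2) (dotC n2 t1) (dotC n2 t2).
rewrite h1 h2 h3 h4 h5 h6 h7 h8 h9 h10; ring.
Qed.

Lemma orthonormal4_det1 t1 t2 n1 n2 :
  orthonormal4 t1 t2 n1 n2 -> 0 < det4 t1 t2 n1 n2 -> det4 t1 t2 n1 n2 = 1.
Proof.
move=> /orthonormal4_det /eqP; rewrite sqrf_eq1 => /orP[/eqP //|/eqP ->].
by rewrite oppr_gt0 ltr10.
Qed.

Lemma orthonormal4_decomp t1 t2 n1 n2 w : orthonormal4 t1 t2 n1 n2 ->
  w = - dot w t1 *: t1 + dot w t2 *: t2 - dot w n1 *: n1 + dot w n2 *: n2.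
Proof.
move=> h; have := orthonormal4_det h.
move: h => [[h1 h2 h3 h4] [h5 h6 [h7 h8 h9 h10]]] hd.
have D0 : det4 t1 t2 n1 n2 != 0.
  by apply/eqP => D0; move: hd; rewrite D0 expr0n /= => /esym/eqP; rewrite oner_eq0.
apply/subr0_eq/(dot_rows4_eq0 D0); rewrite !dot_lin.
all: rewrite ?(dotC t2 t1) ?(dotC n2 n1) ?(dotC n1 t1) ?(dotC n1 t2) ?(dotC n2 t1) ?(dotC n2 t2).
all: rewrite ?h1 ?h2 ?h3 ?h4 ?h5 ?h6 ?h7 ?h8 ?h9 ?h10; ring.
Qed.

Lemma parseval4 t1 t2 n1 n2 v w : orthonormal4 t1 t2 n1 n2 ->
  dot v w = - (dot v t1 * dot w t1) + dot v t2 * dot w t2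
            - dot v n1 * dot w n1 + dot v n2 * dot w n2.
Proof.
move=> h; rewrite {1}(orthonormal4_decomp w h) !dot_lin; ring.
Qed.

(** Multiply by det4 t1 t2 n1 n2 = 1 and expand the matrix of scalar products:
    only the 2 x 2 block of normal components survives. *)
Lemma det4_normal t1 t2 n1 n2 v w : orthonormal4 t1 t2 n1 n2 ->
  det4 t1 t2 n1 n2 = 1 ->
  det4 t1 t2 v w = - (dot v n1 * dot w n2) + dot v n2 * dot w n1.
Proof.
move=> [[h1 h2 h3 h4] [h5 h6 [h7 h8 h9 h10]]] d1.
rewrite -[LHS]mulr1 -d1 det4_gram.
rewrite (det4_fun (fun i j => dot [:: t1; t2; v; w]`_i [:: t1; t2; n1; n2]`_j)) /=.
rewrite (dotC t2 t1) h1 h2 h5 h7 h8 h9 h10; ring.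
Qed.

Definition same_dots a b c d w (a' b' c' d' w' : 'rV[R]_4) : Prop :=
  [/\ dot w a = dot w' a', dot w b = dot w' b', dot w c = dot w' c'
    & dot w d = dot w' d'].

Section Matching.
Variables a b c d a' b' c' d' : 'rV[R]_4.
Hypothesis D0 : det4 a b c d != 0.
Hypothesis DD : det4 a' b' c' d' = det4 a b c d.
Hypothesis ha : same_dots a b c d a a' b' c' d' a'.
Hypothesis hb : same_dots a b c d b a' b' c' d' b'.
Hypothesis hc : same_dots a b c d c a' b' c' d' c'.
Hypothesis hd : same_dots a b c d d a' b' c' d' d'.

Definition match_mx : 'M[R]_4 := invmx (rows4 a b c d) *m rows4 a' b' c' d'.

Let uF : rows4 a b c d \in unitmx.
Proof. by rewrite unitmxE unitfE. Qed.

Lemma match_mxE : rows4 a b c d *m match_mx = rows4 a' b' c' d'.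
Proof. by rewrite /match_mx mulKVmx. Qed.

Let gramE : rows4 a' b' c' d' *m gram R *m (rows4 a' b' c' d')^T =
  rows4 a b c d *m gram R *m (rows4 a b c d)^T.
Proof.
have [a1 a2 a3 a4] := ha; have [b1 b2 b3 b4] := hb.
have [c1 c2 c3 c4] := hc; have [d1 d2 d3 d4] := hd.
apply/matrixP => i j; rewrite !rows4_gram.
by case: i => -[|[|[|[|//]]]] ilt; case: j => -[|[|[|[|//]]]] jlt /=.
Qed.

(** Equal Gram matrices of the two frames. *)
Lemma match_mx_gram : match_mx *m gram R *m match_mx^T = gram R.
Proof.
rewrite /match_mx trmx_mul trmx_inv.
transitivity (invmx (rows4 a b c d) *m (rows4 a' b' c' d' *m gram R *m
    (rows4 a' b' c' d')^T) *m invmx (rows4 a b c d)^T); first by rewrite !mulmxA.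
rewrite gramE !mulmxA mulVmx // mul1mx mulmxK // unitmx_tr //.
Qed.

Lemma match_mx_isometry : proper_isometry match_mx.
Proof.
split=> [v w|]; last first.
  rewrite /match_mx det_mulmx det_inv -/(det4 a b c d) -/(det4 a' b' c' d') DD.
  by rewrite mulVf.
rewrite /dot trmx_mul; congr (fun_of_matrix _ 0 0).
transitivity (v *m (match_mx *m gram R *m match_mx^T) *m w^T).
  by rewrite !mulmxA.
by rewrite match_mx_gram.
Qed.

(** A vector is determined by its scalar products with a basis, and the map
    preserves scalar products. *)
Lemma match_mxP w w' : same_dots a b c d w a' b' c' d' w' -> w *m match_mx = w'.
Proof.
move=> [w1 w2 w3 w4].
have D0' : det4 a' b' c' d' != 0 by rewrite DD.
have [iso _] := match_mx_isometry.
have rw i : [:: a; b; c; d]`_i *m match_mx = [:: a'; b'; c'; d']`_i.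
  case: (ltnP i 4) => hi; last by rewrite !nth_default // mul0mx.
  have := congr1 (row (Ordinal hi)) match_mxE.
  by rewrite row_mul !rowK.
have r0 : a *m match_mx = a' := rw 0%N.
have r1 : b *m match_mx = b' := rw 1%N.
have r2 : c *m match_mx = c' := rw 2%N.
have r3 : d *m match_mx = d' := rw 3%N.
apply/subr0_eq/(dot_rows4_eq0 D0'); rewrite dotDl dotNl.
- by rewrite -w1 -r0 iso subrr.
- by rewrite -w2 -r1 iso subrr.
- by rewrite -w3 -r2 iso subrr.
- by rewrite -w4 -r3 iso subrr.
Qed.

End Matching.

End Bases.

Section Projection.
Variable R : realType.
Implicit Types (a b n w : 'rV[R]_4).

(** [normal_plane] and [normal_proj] depend on the surface only through two
    tangent vectors; the linear algebra is done for arbitrary a and b. *)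
Definition orth_plane a b : 'M[R]_4 := kermx (gram R *m (col_mx a b)^T).
Definition orth_proj a b : 'M[R]_4 := proj_mx (orth_plane a b) <<col_mx a b>>%MS.

Lemma orth_planeP a b n :
  reflect (dot n a = 0 /\ dot n b = 0) (n <= orth_plane a b)%MS.
Proof.
apply: (iffP sub_kermxP).
  rewrite tr_col_mx mulmxA mul_mx_row => h.
  have /eq_row_mx[h1 h2] : row_mx (n *m gram R *m a^T) (n *m gram R *m b^T) =
    row_mx 0 0 by rewrite h row_mx0.
  by rewrite /dot h1 h2 !mxE.
move=> [h1 h2]; rewrite tr_col_mx mulmxA mul_mx_row -row_mx0.
by congr row_mx; apply/matrixP => i j; rewrite !ord1 [RHS]mxE.
Qed.

(** A non-degenerate plane and its orthogonal complement are supplementary;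
    the coefficients s and t below solve the 2 x 2 system for the tangential
    part of w. *)
Lemma orth_projP a b w :
  dot a a * dot b b - dot a b ^+ 2 != 0 ->
  [/\ dot (w *m orth_proj a b) a = 0,
      dot (w *m orth_proj a b) b = 0,
      (exists s t, w - w *m orth_proj a b = s *: a + t *: b) &
      forall n, dot n a = 0 -> dot n b = 0 -> n *m orth_proj a b = n].
Proof.
move=> g0.
have direct : (orth_plane a b :&: <<col_mx a b>> = 0)%MS.
  apply/eqP; rewrite -submx0; apply/row_subP => i.
  set r := row i _.
  have : (r <= orth_plane a b :&: <<col_mx a b>>)%MS by exact: row_sub.
  rewrite sub_capmx => /andP[/orth_planeP[h1 h2]].
  rewrite genmxE => /submxP[D].
  rewrite -[D]hsubmxK mul_row_col [lsubmx D]mx11_scalar [rsubmx D]mx11_scalar.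
  rewrite !mul_scalar_mx; set s := lsubmx D 0 0; set t := rsubmx D 0 0 => rE.
  move: h1 h2; rewrite rE !dot_lin (dotC b a) => h1 h2.
  have hs : s * (dot a a * dot b b - dot a b ^+ 2) =
     dot b b * (s * dot a a + t * dot a b) - dot a b * (s * dot a b + t * dot b b) by ring.
  have ht : t * (dot a a * dot b b - dot a b ^+ 2) =
     dot a a * (s * dot a b + t * dot b b) - dot a b * (s * dot a a + t * dot a b) by ring.
  move: hs ht; rewrite h1 h2 !mulr0 subrr.
  move=> /eqP; rewrite mulf_eq0 (negPf g0) orbF => /eqP ->.
  move=> /eqP; rewrite mulf_eq0 (negPf g0) orbF => /eqP ->.
  by rewrite !scale0r addr0 sub0mx.
have tan s t : ((s *: a + t *: b)%R <= <<col_mx a b>>)%MS.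
  rewrite genmxE; apply/submxP.
  exists (row_mx s%:M t%:M); rewrite mul_row_col !mul_scalar_mx //.
have full : (w <= orth_plane a b + <<col_mx a b>>)%MS.
  set g := dot a a * dot b b - dot a b ^+ 2.
  pose s := (dot w a * dot b b - dot w b * dot a b) / g.
  pose t := (dot w b * dot a a - dot w a * dot a b) / g.
  rewrite -[w](subrK (s *: a + t *: b)); apply: addmx_sub_adds; last exact: tan.
  apply/orth_planeP; rewrite !dot_lin (dotC b a) /s /t /g.
  by split; field.
have wE := add_proj_mx direct full.
have /orth_planeP[h1 h2] := proj_mx_sub (orth_plane a b) <<col_mx a b>>%MS w.
split=> //.
  have : (w *m proj_mx <<col_mx a b>> (orth_plane a b) <= col_mx a b)%MS.
    by rewrite -(genmxE (col_mx a b)); exact: proj_mx_sub.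
  move=> /submxP[D hD].
  exists (lsubmx D 0 0), (rsubmx D 0 0).
  rewrite -{1}wE addrC addKr hD -{1}[D]hsubmxK mul_row_col.
  by rewrite [lsubmx D]mx11_scalar [rsubmx D]mx11_scalar !mul_scalar_mx !mxE.
move=> n n1 n2; apply: proj_mx_id direct _; exact/orth_planeP.
Qed.

Lemma normal_planeP (x : 'rV[R]_2 -> 'rV[R]_4) p n :
  reflect (dot n (du x p) = 0 /\ dot n (dv x p) = 0) (n <= normal_plane x p)%MS.
Proof. exact: orth_planeP. Qed.

Lemma normal_projE (x : 'rV[R]_2 -> 'rV[R]_4) p :
  normal_proj x p = orth_proj (du x p) (dv x p).
Proof. by []. Qed.

End Projection.

Local Opaque derive.

(** * Smooth matrices and derivatives along vector fields *)

Section CinfMatrix.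
Variables (R : realType) (V : normedModType R) (U : set V).
Hypothesis oU : open U.

Lemma CinfN (W : normedModType R) (f : V -> W) : Cinf U f -> Cinf U (fun q => - f q).
Proof.
move=> cf k; elim: k f cf => [|k IH] f cf.
  by split=> // p Up; apply: differentiableN; exact: Cinf_diff cf Up.
split=> [p Up|v]; first by apply: differentiableN; exact: Cinf_diff cf Up.
apply: (Ck_eq oU _ (IH _ (Cinf_derive v cf))) => q Uq.
by rewrite [RHS]deriveN //; apply: diff_derivable; exact: Cinf_diff cf Uq.
Qed.

Lemma CinfB (W : normedModType R) (f g : V -> W) :
  Cinf U f -> Cinf U g -> Cinf U (fun q => f q - g q).
Proof. by move=> cf cg; apply: CinfD => //; exact: CinfN. Qed.

Lemma Cinf_prod (I : Type) (s : seq I) (F : I -> V -> R) :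
  (forall i, Cinf U (F i)) -> Cinf U (fun q => \prod_(i <- s) F i q).
Proof.
move=> h; elim: s => [|i s IH].
  apply: (Cinf_eq oU (f := fun=> 1 : R)); last exact: Cinf_cst.
  by move=> q _; rewrite big_nil.
apply: (Cinf_eq oU (f := fun q => F i q * \prod_(i <- s) F i q)).
  by move=> q _; rewrite big_cons.
exact: CinfM.
Qed.

Lemma Cinf_det n (A : V -> 'M[R]_n) : Cinf U A -> Cinf U (fun q => \det (A q)).
Proof.
move=> /(Cinf_mxP oU) cA; apply: Cinf_sum => // s.
apply: CinfM => //; first exact: Cinf_cst.
by apply: Cinf_prod => i; exact: cA.
Qed.

Lemma Cinf_invmx n (A : V -> 'M[R]_n) : (forall q, U q -> \det (A q) != 0) ->
  Cinf U A -> Cinf U (fun q => invmx (A q)).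
Proof.
move=> dA cA.
apply: (Cinf_eq oU (f := fun q => (\det (A q))^-1 *: \adj (A q))).
  by move=> q Uq; rewrite /invmx unitmxE unitfE dA.
apply: Cinf_scale => //; first by apply: CinfV => //; exact: Cinf_det.
apply/(Cinf_mxP oU) => i j.
apply: (Cinf_eq oU (f := fun q => (-1) ^+ (j + i) * \det (row' j (col' i (A q))))).
  by move=> q Uq; rewrite mxE /cofactor.
apply: CinfM => //; first exact: Cinf_cst.
apply: Cinf_det; apply/(Cinf_mxP oU) => k l.
have /(Cinf_mxP oU) := cA => /(_ (lift j k) (lift i l)).
by apply: Cinf_eq => // q _; rewrite !mxE.
Qed.

Implicit Types a b c d : V -> 'rV[R]_4.

Lemma Cinf_rows4 a b c d : Cinf U a -> Cinf U b -> Cinf U c -> Cinf U d ->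
  Cinf U (fun q => rows4 (a q) (b q) (c q) (d q)).
Proof.
move=> /(Cinf_mxP oU) ca /(Cinf_mxP oU) cb /(Cinf_mxP oU) cc /(Cinf_mxP oU) cd.
apply/(Cinf_mxP oU) => i j.
apply: (Cinf_eq oU (f := fun q => [:: a q; b q; c q; d q]`_i 0 j)).
  by move=> q _; rewrite mxE.
by case: i => -[|[|[|[|//]]]].
Qed.

Lemma Cinf_det4 a b c d : Cinf U a -> Cinf U b -> Cinf U c -> Cinf U d ->
  Cinf U (fun q => det4 (a q) (b q) (c q) (d q)).
Proof. by move=> ca cb cc cd; apply: Cinf_det; exact: Cinf_rows4. Qed.

Lemma Cinf_cross a b c : Cinf U a -> Cinf U b -> Cinf U c ->
  Cinf U (fun q => cross (a q) (b q) (c q)).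
Proof.
move=> ca cb cc; apply/(Cinf_mxP oU) => i j.
apply: (Cinf_eq oU
  (f := fun q => (-1) ^+ j.+1 * det4 (a q) (b q) (c q) (delta_mx 0 j))).
  by move=> q _; rewrite mxE.
apply: CinfM => //; first exact: Cinf_cst.
by apply: (Cinf_det4 (d := fun=> delta_mx 0 j)) => //; exact: Cinf_cst.
Qed.

End CinfMatrix.

Section Pointwise.
Variables (R : realType) (V W : normedModType R).
Implicit Types f g : V -> W.

Lemma derive_add f g p v : differentiable f p -> differentiable g p ->
  'D_v (fun q => f q + g q) p = 'D_v f p + 'D_v g p.
Proof. by move=> df dg; apply: deriveD; exact: diff_derivable. Qed.

Lemma derive_sub f g p v : differentiable f p -> differentiable g p ->
  'D_v (fun q => f q - g q) p = 'D_v f p - 'D_v g p.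
Proof. by move=> df dg; apply: deriveB; exact: diff_derivable. Qed.

Lemma derive_opp f p v : differentiable f p ->
  'D_v (fun q => - f q) p = - 'D_v f p.
Proof. by move=> df; apply: deriveN; exact: diff_derivable. Qed.

Lemma derive_const (a : W) (p v : V) : 'D_v (fun=> a) p = 0.
Proof. exact: derive_cst. Qed.

Lemma derive_Zc (s : R) f p v : differentiable f p ->
  'D_v (fun q => s *: f q) p = s *: 'D_v f p.
Proof. by move=> df; apply: deriveZ; exact: diff_derivable. Qed.

End Pointwise.

Section Plane.
Variables (R : realType).
Local Notation V := 'rV[R]_2.

Lemma row2E (v : V) : v = v 0 0 *: delta_mx 0 0 + v 0 1 *: delta_mx 0 1.
Proof.
rewrite {1}[v]row_sum_delta big_ord_recl big_ord1.
have -> : lift ord0 ord0 = 1 :> 'I_2 by exact: val_inj.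
by have -> : ord0 = 0 :> 'I_2 by exact: val_inj.
Qed.

Lemma derive2E (W : normedModType R) (f : V -> W) q v : differentiable f q ->
  'D_v f q = v 0 0 *: 'D_(delta_mx 0 0) f q + v 0 1 *: 'D_(delta_mx 0 1) f q.
Proof. by move=> df; rewrite {1}(row2E v) derive_lin. Qed.

Lemma derive_along_Cinf U (f : V -> 'rV[R]_4) (Y : V -> V) : open U ->
  Cinf U f -> Cinf U Y -> Cinf U (fun q => 'D_(Y q) f q).
Proof.
move=> oU cf /(Cinf_mxP oU) cY.
apply: (Cinf_eq oU (f := fun q => Y q 0 0 *: 'D_(delta_mx 0 0) f q
   + Y q 0 1 *: 'D_(delta_mx 0 1) f q)).
  by move=> q Uq; rewrite [RHS]derive2E //; exact: Cinf_diff cf Uq.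
by apply: CinfD => //; apply: Cinf_scale => //; exact: Cinf_derive.
Qed.

(** The product rule applied to the components of the field Y; the second term
    differentiates along the constant vector Y p. *)
Lemma derive_along U (f : V -> 'rV[R]_4) (Y : V -> V) X p : open U ->
  Cinf U f -> Cinf U Y -> U p ->
  'D_X (fun q => 'D_(Y q) f q) p = 'D_('D_X Y p) f p + 'D_X ('D_(Y p) f) p.
Proof.
move=> oU cf cY Up; have /(Cinf_mxP oU) cYc := cY.
have dd v : differentiable ('D_v f) p by exact: Cinf_diff (Cinf_derive v cf) Up.
have dYc i j : differentiable (fun q => Y q i j) p by exact: Cinf_diff (cYc i j) Up.
have df : differentiable f p by exact: Cinf_diff cf Up.
have dY : differentiable Y p by exact: Cinf_diff cY Up.
pose g0 q := Y q 0 0 *: 'D_(delta_mx 0 0) f q.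
pose g1 q := Y q 0 1 *: 'D_(delta_mx 0 1) f q.
have [s0 t0] := derive_scale X (dYc 0 0) (dd (delta_mx 0 0)).
have [s1 t1] := derive_scale X (dYc 0 1) (dd (delta_mx 0 1)).
have e1 : 'D_X (fun q => 'D_(Y q) f q) p = 'D_X g0 p + 'D_X g1 p.
  rewrite -(derive_add X t0 t1).
  apply: (eq_on_derive _ oU _ Up) => q Uq.
  by apply: derive2E; exact: Cinf_diff cf Uq.
have dz (s : R) v : differentiable (fun q => s *: 'D_v f q) p.
  exact: differentiableZ.
have e2 : 'D_X ('D_(Y p) f) p = Y p 0 0 *: 'D_X ('D_(delta_mx 0 0) f) p
     + Y p 0 1 *: 'D_X ('D_(delta_mx 0 1) f) p.
  rewrite -(derive_Zc (Y p 0 0) X (dd (delta_mx 0 0))).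
  rewrite -(derive_Zc (Y p 0 1) X (dd (delta_mx 0 1))).
  rewrite -(derive_add X (dz _ _) (dz _ _)).
  apply: (eq_on_derive _ oU _ Up) => q Uq.
  by apply: derive2E; exact: Cinf_diff cf Uq.
have e3 := derive2E ('D_X Y p) df.
have c0 := derive_coord X 0 0 dY.
have c1 := derive_coord X 0 1 dY.
have {}e3 := etrans e3 (congr2 (fun s t => s *: _ + t *: _) c0 c1).
refine (etrans e1 (etrans (congr2 +%R s0 s1) _)).
refine (etrans _ (esym (congr2 +%R e3 e2))).
exact: addrACA.
Qed.

End Plane.

(** * Adapted frames *)

Section Frames.
Variable R : realType.
Local Notation V := 'rV[R]_2.
Implicit Types (x : V -> 'rV[R]_4) (p q X Y : V).

(** The Gram determinant of the two combinations, here -1, is the square of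
    the coefficient determinant times that of a and b. *)
Lemma gram2_basis (a b : 'rV[R]_4) (s1 r1 s2 r2 : R) :
  dot (s1 *: a + r1 *: b) (s1 *: a + r1 *: b) = -1 ->
  dot (s2 *: a + r2 *: b) (s2 *: a + r2 *: b) = 1 ->
  dot (s1 *: a + r1 *: b) (s2 *: a + r2 *: b) = 0 ->
  s1 * r2 - r1 * s2 != 0 /\ dot a a * dot b b - dot a b ^+ 2 != 0.
Proof.
move=> h1 h2 h3.
have h : (s1 * r2 - r1 * s2) ^+ 2 * (dot a a * dot b b - dot a b ^+ 2) = -1.
  transitivity (dot (s1 *: a + r1 *: b) (s1 *: a + r1 *: b) *
   dot (s2 *: a + r2 *: b) (s2 *: a + r2 *: b)
   - dot (s1 *: a + r1 *: b) (s2 *: a + r2 *: b) ^+ 2).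
    by rewrite !dot_lin (dotC b a); ring.
  by rewrite h1 h2 h3; ring.
have n0 : (s1 * r2 - r1 * s2) ^+ 2 * (dot a a * dot b b - dot a b ^+ 2) != 0.
  by rewrite h oppr_eq0 oner_eq0.
by move: n0; rewrite mulf_eq0 negb_or expf_eq0 /= => /andP.
Qed.

Lemma dot_comb0 (n a b : 'rV[R]_4) s t :
  dot n a = 0 -> dot n b = 0 -> dot n (s *: a + t *: b) = 0.
Proof. by move=> h1 h2; rewrite dotDr !dotZr h1 h2 !mulr0 addr0. Qed.

Lemma dot_subr_comb (w w' n a b : 'rV[R]_4) s t : w - w' = s *: a + t *: b ->
  dot n a = 0 -> dot n b = 0 -> dot w' n = dot w n.
Proof.
move=> e h1 h2; apply/esym/subr0_eq; rewrite -dotNl -dotDl e dotC.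
exact: dot_comb0.
Qed.

Lemma orthonormal4_normal (t1 t2 n1 n2 w : 'rV[R]_4) : orthonormal4 t1 t2 n1 n2 ->
  dot w t1 = 0 -> dot w t2 = 0 -> w = - dot w n1 *: n1 + dot w n2 *: n2.
Proof.
move=> ho4 h1 h2; rewrite {1}(orthonormal4_decomp w ho4) h1 h2.
by rewrite oppr0 !scale0r !add0r scaleNr.
Qed.

Lemma du_dvE x q X : differentiable x q ->
  'D_X x q = X 0 0 *: du x q + X 0 1 *: dv x q.
Proof. exact: derive2E. Qed.

Lemma orthonormal_tangent_basis x q X1 X2 : differentiable x q ->
  orthonormal_tangent x q X1 X2 ->
  X1 0 0 * X2 0 1 - X1 0 1 * X2 0 0 != 0 /\
  dot (du x q) (du x q) * dot (dv x q) (dv x q) - dot (du x q) (dv x q) ^+ 2 != 0.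
Proof.
move=> dx []; rewrite (du_dvE X1 dx) (du_dvE X2 dx); exact: gram2_basis.
Qed.

Lemma orthonormal_tangent_span x q X1 X2 : differentiable x q ->
  orthonormal_tangent x q X1 X2 ->
  forall v : V, exists s t, v = s *: X1 + t *: X2.
Proof.
move=> dx /(orthonormal_tangent_basis dx)[+ _].
set g := _ - _ => g0 v.
exists ((v 0 0 * X2 0 1 - v 0 1 * X2 0 0) / g), ((v 0 1 * X1 0 0 - v 0 0 * X1 0 1) / g).
have e (w : V) (i : 'I_2) : i = 0 \/ i = 1.
  by case: i => -[|[|//]] ?; [left|right]; exact: val_inj.
by apply/rowP => i; rewrite !mxE; case: (e v i) => ->; rewrite /g; field.
Qed.

Lemma normal_to_frame x q X1 X2 (n : 'rV[R]_4) : differentiable x q ->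
  orthonormal_tangent x q X1 X2 ->
  dot n ('D_X1 x q) = 0 -> dot n ('D_X2 x q) = 0 -> forall v, dot n ('D_v x q) = 0.
Proof.
move=> dx ho h1 h2 v; have [s [t ->]] := orthonormal_tangent_span dx ho v.
have -> := derive_lin s t X1 X2 dx.
exact: dot_comb0.
Qed.

Lemma normal_planeD x q (n : 'rV[R]_4) : differentiable x q ->
  (n <= normal_plane x q)%MS <-> forall v, dot n ('D_v x q) = 0.
Proof.
move=> dx; split=> [/normal_planeP[h1 h2] v|h].
  by have -> := du_dvE v dx; exact: dot_comb0.
by apply/normal_planeP; split; exact: h.
Qed.

(** The pointwise part of [adapted_frame]. *)
Definition adapted_at x q X1 X2 (n1 n2 : 'rV[R]_4) : Prop :=
  [/\ orthonormal_tangent x q X1 X2, orthonormal_normal x q n1 n2 &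
      right_oriented ('D_X1 x q) ('D_X2 x q) n1 n2].

(** In an adapted frame the normal projection has the explicit form - (w.n1)
    n1 + (w.n2) n2, which can be differentiated. *)
Lemma adapted_atP x q X1 X2 n1 n2 : differentiable x q ->
  adapted_at x q X1 X2 n1 n2 ->
  [/\ orthonormal4 ('D_X1 x q) ('D_X2 x q) n1 n2,
      det4 ('D_X1 x q) ('D_X2 x q) n1 n2 = 1,
      (forall v, dot n1 ('D_v x q) = 0), (forall v, dot n2 ('D_v x q) = 0) &
      forall w, w *m normal_proj x q = - dot w n1 *: n1 + dot w n2 *: n2].
Proof.
move=> dx [ho [m1 m2 n11 n22 n12] hr].
have h1 := (normal_planeD n1 dx).1 m1; have h2 := (normal_planeD n2 dx).1 m2.
have ho4 : orthonormal4 ('D_X1 x q) ('D_X2 x q) n1 n2.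
  case: ho => t1 t2 t12; split; first by split.
  by split => //; split; rewrite dotC ?h1 ?h2.
split=> //; first exact: orthonormal4_det1 ho4 hr.
move=> w; rewrite normal_projE.
have [_ g0] := orthonormal_tangent_basis dx ho.
have [a1 a2 [s [t hst]] _] := orth_projP w g0.
set w' := w *m _ in a1 a2 hst *.
have tw v : dot w' ('D_v x q) = 0.
  by have -> := du_dvE v dx; exact: dot_comb0.
have k1 := dot_subr_comb hst (h1 (delta_mx 0 0)) (h1 (delta_mx 0 1)).
have k2 := dot_subr_comb hst (h2 (delta_mx 0 0)) (h2 (delta_mx 0 1)).
rewrite -k1 -k2; exact: orthonormal4_normal ho4 (tw _) (tw _).
Qed.

Lemma open_lt0 (T : topologicalType) (U : set T) (f : T -> R) : open U ->
  (forall z, U z -> {for z, continuous f}) -> open [set z | U z /\ f z < 0].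
Proof.
move=> oU cf; rewrite openE => z0 [Uq fq].
near=> z; split; first by near: z; exact: open_nbhs_nbhs.
by near: z; apply: (cvgr_lt (f z0)) => //; exact: cf.
Unshelve. all: by end_near. Qed.

(** A vector orthogonal to a; for a ^ 2 = -1 it is non-zero and lies in the
    negative definite plane of the first and third coordinates. Its normal
    part, normalized, is the first vector of the normal frame. *)
Definition rot4 (a : 'rV[R]_4) : 'rV[R]_4 := \row_j [:: co a 2; 0; - co a 0; 0]`_j.

Lemma co_rot a k : (k < 4)%N -> co (rot4 a) k = [:: co a 2; 0; - co a 0; 0]`_k.
Proof. by move=> k4; rewrite {1}/co mxE inordK. Qed.

Lemma dot_rot a : dot (rot4 a) a = 0.
Proof. by rewrite dotE !co_rot //=; ring. Qed.

Lemma dot_rot_rot a : dot a a = -1 -> dot (rot4 a) (rot4 a) < 0.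
Proof.
rewrite !dotE !co_rot //=.
have := sqr_ge0 (co a 1); have := sqr_ge0 (co a 3); rewrite !expr2 => h1 h2 h3.
by lra.
Qed.

Lemma gram_schmidt_dot (b t : 'rV[R]_4) : dot t t = -1 ->
  dot (b + dot b t *: t) t = 0 /\
  dot (b + dot b t *: t) (b + dot b t *: t) = dot b b + dot b t ^+ 2.
Proof. by move=> h; rewrite !dot_lin (dotC t b) h; split; ring. Qed.

Section Fields.
Variables (U : set V).
Hypothesis oU : open U.
Implicit Types (a b t : V -> 'rV[R]_4).

(** The factor that normalizes a field of square g. *)
Lemma inv_sqrt_field (g : V -> R) : Cinf U g -> (forall q, U q -> 0 < g q) ->
  exists2 r : V -> R, Cinf U r & forall q, U q -> r q * (r q * g q) = 1.
Proof.
move=> cg g0; exists (fun q => (Num.sqrt (g q))^-1).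
  have h q : U q -> Num.sqrt (g q) != 0 by move=> Uq; rewrite gt_eqF // sqrtr_gt0 g0.
  refine (CinfV oU h (Cinf_sqrt oU g0 cg)).
move=> q Uq; rewrite mulrA -expr2 exprVn sqr_sqrtr; last exact/ltW/g0.
by rewrite mulVf // gt_eqF // g0.
Qed.

Lemma unit_field a (e : R) : e ^+ 2 = 1 -> Cinf U a ->
  (forall q, U q -> 0 < e * dot (a q) (a q)) ->
  exists2 r : V -> R, Cinf U r &
    forall q, U q -> dot (r q *: a q) (r q *: a q) = e.
Proof.
move=> e2 ca a0.
have ce := CinfM oU (Cinf_cst U e) (Cinf_dot oU ca ca).
have [r cr rE] := inv_sqrt_field ce a0.
exists r => // q Uq; rewrite !dot_lin.
transitivity (e * (r q * (r q * (e * dot (a q) (a q))))); last by rewrite rE // mulr1.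
by rewrite -[LHS]mul1r -e2; ring.
Qed.

(** As a is time-like, subtracting the a-component of b can only increase the
    square of b; so both fields can be normalized. For t ^ 2 = -1 the
    projection is b + (b.t) t. *)
Lemma gram_schmidt_field a b : Cinf U a -> Cinf U b ->
  (forall q, U q -> dot (a q) (a q) < 0) ->
  (forall q, U q -> 0 < dot (b q) (b q)) ->
  exists r m s : V -> R, [/\ Cinf U r, Cinf U m, Cinf U s &
    forall q, U q ->
      [/\ dot (r q *: a q) (r q *: a q) = -1,
          dot (s q *: (b q + m q *: (r q *: a q))) (s q *: (b q + m q *: (r q *: a q))) = 1
        & dot (r q *: a q) (s q *: (b q + m q *: (r q *: a q))) = 0]].
Proof.
move=> ca cb a0 b0.
have e2 : (-1) ^+ 2 = 1 :> R by rewrite sqrrN expr1n.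
have a0' q : U q -> 0 < -1 * dot (a q) (a q) by move=> Uq; rewrite mulN1r oppr_gt0 a0.
have [r cr rE] := unit_field e2 ca a0'.
have ct := Cinf_scale oU cr ca.
have cm := Cinf_dot oU cb ct.
have ck := CinfD oU cb (Cinf_scale oU cm ct).
set t := (fun q => r q *: a q) in ct cm ck.
have kk q : U q -> 0 < 1 * dot (b q + dot (b q) (t q) *: t q)
     (b q + dot (b q) (t q) *: t q).
  move=> Uq; have [_ h] := gram_schmidt_dot (b q) (rE q Uq).
  by rewrite mul1r h ltr_wpDr ?b0 // sqr_ge0.
have [s cs sE] := unit_field (expr1n _ 2) ck kk.
exists r, (fun q => dot (b q) (t q)), s; split=> // q Uq; split.
- exact: rE.
- exact: sE.
- have [h _] := gram_schmidt_dot (b q) (rE q Uq).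
  by rewrite dotZr dotC h mulr0.
Qed.

Lemma Cinf_rot a : Cinf U a -> Cinf U (fun q => rot4 (a q)).
Proof.
move=> /(Cinf_mxP oU) ca; apply/(Cinf_mxP oU) => i j.
apply: (Cinf_eq oU (f := fun q => [:: co (a q) 2; 0; - co (a q) 0; 0]`_j)).
  by move=> q _; rewrite mxE.
case: j => -[|[|[|[|//]]]] /= _; try exact: (Cinf_cst U (0 : R)).
  exact: ca.
by apply: CinfN => //; exact: ca.
Qed.

(** Let w be [rot4] of t1. It is orthogonal to t1 and w ^ 2 < 0, so w - (w.t2)
    t2 is a time-like normal field; the vector product of t1, t2 and its
    normalization completes a right-oriented orthonormal frame. *)
Lemma normal_frame_field t1 t2 : Cinf U t1 -> Cinf U t2 ->
  (forall q, U q -> [/\ dot (t1 q) (t1 q) = -1, dot (t2 q) (t2 q) = 1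
     & dot (t1 q) (t2 q) = 0]) ->
  exists n1 n2 : V -> 'rV[R]_4, [/\ Cinf U n1, Cinf U n2 &
    forall q, U q -> orthonormal4 (t1 q) (t2 q) (n1 q) (n2 q) /\
      det4 (t1 q) (t2 q) (n1 q) (n2 q) = 1].
Proof.
move=> c1 c2 ho.
have cw := Cinf_rot c1.
have cl := Cinf_dot oU cw c2.
have cN := CinfB oU cw (Cinf_scale oU cl c2).
set N := (fun q => _ - _) in cN.
have N1 q : U q -> dot (N q) (t1 q) = 0.
  move=> /ho[_ _ h]; rewrite /N dotDl dotNl dotZl dot_rot dotC.
  by rewrite dotC (dotC (t2 q)) h mulr0 subr0.
have N2 q : U q -> dot (N q) (t2 q) = 0.
  by move=> /ho[_ h _]; rewrite /N dotDl dotNl dotZl h mulr1 subrr.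
have NN q : U q -> 0 < -1 * dot (N q) (N q).
  move=> Uq; rewrite mulN1r {2}/N dotDr dotNr dotZr N2 // mulr0 subr0 /N dotDl dotNl dotZl.
  rewrite (dotC (t2 q)) -expr2 opprB subr_gt0.
  have [h _ _] := ho q Uq.
  by apply: lt_le_trans (dot_rot_rot h) (sqr_ge0 _).
have e2 : (-1) ^+ 2 = 1 :> R by rewrite sqrrN expr1n.
have [r cr rE] := unit_field e2 cN NN.
have cn := Cinf_scale oU cr cN.
exists (fun q => r q *: N q), (fun q => cross (t1 q) (t2 q) (r q *: N q)).
split=> //; first exact: Cinf_cross.
move=> q Uq; have [h1 h2 h3] := ho q Uq.
have k1 : dot (t1 q) (r q *: N q) = 0 by rewrite dotC dotZl N1 // mulr0.
have k2 : dot (t2 q) (r q *: N q) = 0 by rewrite dotC dotZl N2 // mulr0.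
have k3 := rE q Uq.
have k4 : dot (cross (t1 q) (t2 q) (r q *: N q)) (cross (t1 q) (t2 q) (r q *: N q)) = 1.
  by rewrite dot_cross_cross h1 h2 h3 k1 k2 k3; ring.
split; last by rewrite -dot_cross.
split; split=> //; first by rewrite dotC dot_cross det4_rep3.
by split=> //; rewrite dotC dot_cross ?det4_rep1 ?det4_rep2.
Qed.

End Fields.

(** Constant parameter vectors that are time-like and space-like at p stay so
    near p; orthonormalize their images. *)
Lemma adapted_frame_exists x (U0 : set V) p : open U0 -> Cinf U0 x -> U0 p ->
  (exists X, dot ('D_X x p) ('D_X x p) < 0) ->
  (exists Y, 0 < dot ('D_Y x p) ('D_Y x p)) ->
  exists U (X1 X2 : V -> V) n1 n2, [/\ open U, U p & adapted_frame x U X1 X2 n1 n2].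
Proof.
move=> oU0 cx U0p [Xc hX] [Yc hY].
have cX0 := Cinf_derive Xc cx.
have cY0 := Cinf_derive Yc cx.
have cgX := Cinf_dot oU0 cX0 cX0.
have cgY := CinfN oU0 (Cinf_dot oU0 cY0 cY0).
have oX := open_lt0 oU0 (fun q Uq => differentiable_continuous (Cinf_diff cgX Uq)).
have oY := open_lt0 oU0 (fun q Uq => differentiable_continuous (Cinf_diff cgY Uq)).
have oU := openI oX oY.
set U := _ `&` _ in oU.
have sU : U `<=` U0 by move=> q [[]].
have Up : U p by split; split=> //; rewrite oppr_lt0.
have UX q : U q -> dot ('D_Xc x q) ('D_Xc x q) < 0 by case=> [[]].
have UY q : U q -> 0 < dot ('D_Yc x q) ('D_Yc x q).
  by case=> _ [_]; rewrite oppr_lt0.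
clearbody U => {oX oY cgX cgY}.
have dx q (Uq : U q) := Cinf_diff cx (sU q Uq).
have [r [m [s [cr cm cs hE]]]] :=
  gram_schmidt_field oU (Cinf_sub sU cX0) (Cinf_sub sU cY0) UX UY.
have ct1 := Cinf_scale oU cr (Cinf_sub sU cX0).
have ct2 := Cinf_scale oU cs (CinfD oU (Cinf_sub sU cY0) (Cinf_scale oU cm ct1)).
have [n1 [n2 [cn1 cn2 nE]]] := normal_frame_field oU ct1 ct2 hE.
have cX1 := Cinf_scale oU cr (Cinf_cst U Xc).
have cX2 := Cinf_scale oU cs (CinfD oU (Cinf_cst U Yc) (Cinf_scale oU cm cX1)).
have e1 q : U q -> 'D_(r q *: Xc) x q = r q *: 'D_Xc x q.
  by move=> Uq; exact: derive_scale_dir (dx q Uq).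
have e2 q : U q -> 'D_(s q *: (Yc + m q *: (r q *: Xc))) x q =
    s q *: ('D_Yc x q + m q *: (r q *: 'D_Xc x q)).
  move=> Uq; refine (etrans (derive_scale_dir _ _ (dx q Uq)) (congr1 _ _)).
  have := derive_lin 1 (m q) Yc (r q *: Xc) (dx q Uq); rewrite !scale1r => ->.
  by congr (_ + _ *: _); exact: e1.
have /smoothP sX1 := cX1; have /smoothP sX2 := cX2.
have /smoothP sn1 := cn1; have /smoothP sn2 := cn2.
exists U, (fun q => r q *: Xc), (fun q => s q *: (Yc + m q *: (r q *: Xc))), n1, n2.
split=> //; split=> // q Uq.
have ho : orthonormal_tangent x q (r q *: Xc) (s q *: (Yc + m q *: (r q *: Xc))).
  by move: (hE q Uq); rewrite -(e2 q Uq) -(e1 q Uq).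
have [ho4 d4] := nE q Uq.
move: ho4 d4; rewrite -(e2 q Uq) -(e1 q Uq) => ho4 d4.
have [[_ _ h3 h4] [_ h5 [h6 h7 h8 h9]]] := ho4.
split=> //; last by rewrite /right_oriented -/(det4 _ _ _ _) d4.
split=> //; apply/(normal_planeD _ (dx q Uq)); apply: (normal_to_frame (dx q Uq) ho).
- by rewrite dotC.
- by rewrite dotC.
- by rewrite dotC.
- by rewrite dotC.
Qed.

End Frames.

(** * The Ricci equation *)

Section Ricci.
Variable R : realType.
Local Notation V := 'rV[R]_2.
Implicit Types (x : V -> 'rV[R]_4) (p q : V).

Lemma derive_dot_cst (U : set V) (f g : V -> 'rV[R]_4) (c : R) p v : open U ->
  Cinf U f -> Cinf U g -> U p -> (forall q, U q -> dot (f q) (g q) = c) ->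
  dot ('D_v f p) (g p) + dot (f p) ('D_v g p) = 0.
Proof.
move=> oU cf cg Up h.
refine (etrans (esym (derive_dot v (Cinf_diff cf Up) (Cinf_diff cg Up))) _).
refine (etrans (eq_on_derive v oU h Up) _).
exact: derive_const.
Qed.

(** The value of the normal curvature in an adapted frame with tangent vectors
    X and Y at p. The normal vectors have been eliminated: a determinant
    det(t1, t2, v, w) only sees the normal parts of v and w. *)
Definition frame_curvature x p (X Y : V) : R :=
  det4 ('D_X x p) ('D_Y x p) ('D_X ('D_X x) p + 'D_Y ('D_Y x) p) ('D_X ('D_Y x) p).

Lemma dot_comb_n1 (n1 n2 : 'rV[R]_4) s t : dot n1 n1 = -1 -> dot n1 n2 = 0 ->
  dot (- s *: n1 + t *: n2) n1 = s.
Proof. by move=> h1 h2; rewrite !dot_lin (dotC n2) h1 h2; ring. Qed.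

Lemma dot_scale_n1 (n1 d : 'rV[R]_4) (s t : R) : dot n1 n1 = -1 -> dot d n1 = 0 ->
  dot (t *: n1 + s *: d) n1 = - t.
Proof. by move=> h1 h2; rewrite !dot_lin h1 h2; ring. Qed.

Variables (U : set V) (x : V -> 'rV[R]_4).
Variables (X1 X2 : V -> V) (n1 n2 : V -> 'rV[R]_4).
Hypothesis oU : open U.
Hypothesis cx : Cinf U x.
Hypothesis cX1 : Cinf U X1.
Hypothesis cX2 : Cinf U X2.
Hypothesis c1 : Cinf U n1.
Hypothesis c2 : Cinf U n2.
Hypothesis had : forall q, U q -> adapted_at x q (X1 q) (X2 q) (n1 q) (n2 q).

Let dx q (Uq : U q) : differentiable x q := Cinf_diff cx Uq.

Let n11 q : U q -> dot (n1 q) (n1 q) = -1.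
Proof. by move=> Uq; have [_ []] := had Uq. Qed.
Let n22 q : U q -> dot (n2 q) (n2 q) = 1.
Proof. by move=> Uq; have [_ []] := had Uq. Qed.
Let n12 q : U q -> dot (n1 q) (n2 q) = 0.
Proof. by move=> Uq; have [_ []] := had Uq. Qed.

Lemma double_eq0 (a : R) : a + a = 0 -> a = 0.
Proof. by move=> h; lra. Qed.

Let dn1 q v : U q -> dot ('D_v n1 q) (n1 q) = 0.
Proof.
move=> Uq; have h := derive_dot_cst v oU c1 c1 Uq n11.
apply: double_eq0; exact: etrans (congr1 (fun t => _ + t) (dotC _ _)) h.
Qed.

Let dn2 q v : U q -> dot ('D_v n2 q) (n2 q) = 0.
Proof.
move=> Uq; have h := derive_dot_cst v oU c2 c2 Uq n22.
apply: double_eq0; exact: etrans (congr1 (fun t => _ + t) (dotC _ _)) h.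
Qed.

Let projE q w : U q ->
  w *m normal_proj x q = - dot w (n1 q) *: n1 q + dot w (n2 q) *: n2 q.
Proof. by move=> Uq; have [_ _ _ _] := adapted_atP (dx Uq) (had Uq); exact. Qed.

Let nablaE Y q : U q -> nabla_normal x Y n2 q =
  - dot ('D_(Y q) n2 q) (n1 q) *: n1 q.
Proof.
move=> Uq; refine (etrans (projE _ Uq) _).
refine (etrans (congr1 (fun t => _ + t *: _) (dn2 _ Uq)) _).
by rewrite scale0r addr0.
Qed.

Let dot_nabla Y (m : V -> 'rV[R]_4) q : U q ->
  dot (nabla_normal x Y m q) (n1 q) = dot ('D_(Y q) m q) (n1 q).
Proof.
move=> Uq; refine (etrans (congr1 (fun w => dot w (n1 q)) (projE _ Uq)) _).
exact: dot_comb_n1 (n11 Uq) (n12 Uq).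
Qed.

Let nabla_nabla X Y p : Cinf U Y -> U p ->
  dot (nabla_normal x X (nabla_normal x Y n2) p) (n1 p) =
  dot ('D_('D_(X p) Y p) n2 p + 'D_(X p) ('D_(Y p) n2) p) (n1 p)
  + dot ('D_(Y p) n2 p) ('D_(X p) n1 p).
Proof.
move=> cY Up.
have cd := derive_along_Cinf oU c2 cY.
have cw := Cinf_dot oU cd c1.
have cs := CinfN oU cw.
have e1 : 'D_(X p) (nabla_normal x Y n2) p =
    'D_(X p) (fun q => - dot ('D_(Y q) n2 q) (n1 q) *: n1 q) p.
  refine (eq_on_derive (X p) oU (nablaE Y) Up).
have [e2 _] := derive_scale (X p) (Cinf_diff cs Up) (Cinf_diff c1 Up).
have e3 : 'D_(X p) (fun q => - dot ('D_(Y q) n2 q) (n1 q)) p =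
    - 'D_(X p) (fun q => dot ('D_(Y q) n2 q) (n1 q)) p.
  exact: derive_opp (X p) (Cinf_diff cw Up).
have e4 := derive_dot (X p) (Cinf_diff cd Up) (Cinf_diff c1 Up).
have e5 := derive_along (X p) oU c2 cY Up.
refine (etrans (dot_nabla X _ Up) _).
refine (etrans (congr1 (fun w => dot w (n1 p)) (etrans e1 e2)) _).
refine (etrans (dot_scale_n1 _ _ (n11 Up) (dn1 (X p) Up)) _).
refine (etrans (congr1 -%R e3) _).
refine (etrans (opprK _) _).
refine (etrans e4 _).
by refine (congr1 (fun w => dot w (n1 p) + _) e5).
Qed.

Lemma curvature_alg (m a12 b12 a21 b21 l : 'rV[R]_4) (s t : R) :
  b12 = b21 -> l = a12 - a21 ->
  dot (a12 + b12) m + s - (dot (a21 + b21) m + t) - dot l m = s - t.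
Proof. by move=> -> ->; rewrite !dot_lin; ring. Qed.

Lemma derive_sub_dir (W : normedModType R) (f : V -> W) q v w :
  differentiable f q -> 'D_(v - w) f q = 'D_v f q - 'D_w f q.
Proof.
move=> df; have := derive_lin 1 (-1) v w df.
by rewrite !scale1r !scaleN1r.
Qed.

Lemma dot_sub3 (a b c m : 'rV[R]_4) : dot (a - b - c) m = dot a m - dot b m - dot c m.
Proof. by rewrite !dot_lin. Qed.

Let curvature1 p : U p ->
  dot (normal_curvature_tensor x X1 X2 n2 p) (n1 p) =
  dot ('D_(X2 p) n2 p) ('D_(X1 p) n1 p) - dot ('D_(X1 p) n2 p) ('D_(X2 p) n1 p).
Proof.
move=> Up.
have h12 := nabla_nabla X1 cX2 Up; have h21 := nabla_nabla X2 cX1 Up.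
have hl := dot_nabla (lie_bracket X1 X2) n2 Up.
refine (etrans (dot_sub3 _ _ _ _) _).
refine (etrans (congr2 (fun a b => a - b) (congr2 (fun a b => a - b) h12 h21) hl) _).
apply: curvature_alg; first exact: schwarz oU c2 Up.
exact: derive_sub_dir (Cinf_diff c2 Up).
Qed.

(** In an orthonormal basis, dot u2 w1 and dot u1 w2 reduce to tangential
    components, which are minus the components of the second fundamental form.
    *)
Lemma ricci_alg (t1 t2 m1 m2 u1 u2 w1 w2 s11 s12 s22 : 'rV[R]_4) :
  orthonormal4 t1 t2 m1 m2 -> det4 t1 t2 m1 m2 = 1 ->
  dot u1 m2 = 0 -> dot u2 m2 = 0 -> dot w1 m1 = 0 -> dot w2 m1 = 0 ->
  dot w1 t1 + dot m1 s11 = 0 -> dot w1 t2 + dot m1 s12 = 0 ->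
  dot w2 t1 + dot m1 s12 = 0 -> dot w2 t2 + dot m1 s22 = 0 ->
  dot u1 t1 + dot m2 s11 = 0 -> dot u1 t2 + dot m2 s12 = 0 ->
  dot u2 t1 + dot m2 s12 = 0 -> dot u2 t2 + dot m2 s22 = 0 ->
  dot u2 w1 - dot u1 w2 = det4 t1 t2 (s11 + s22) s12.
Proof.
move=> ho d1 k1 k2 k3 k4.
have e (a b : R) : a + b = 0 -> a = - b by move=> h; lra.
move=> /e w11 /e w12 /e w21 /e w22 /e u11 /e u12 /e u21 /e u22.
rewrite (parseval4 u2 w1 ho) (parseval4 u1 w2 ho) (det4_normal _ _ ho d1).
rewrite k1 k2 k3 k4 w11 w12 w21 w22 u11 u12 u21 u22 !dotDl.
by rewrite !(dotC s11) !(dotC s22) !(dotC s12); ring.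
Qed.

(** With nabla n2 = - omega n1, where omega(Y) = dot (D_Y n2) n1, the
    curvature is the exterior derivative of omega, i.e. (D_X2 n2).(D_X1 n1) -
    (D_X1 n2).(D_X2 n1), as the second derivatives of n2 cancel against the
    Lie bracket term. Differentiating n.(D_X x) = 0 turns the tangential
    components of D n into those of the second fundamental form. *)
Lemma ricci p : U p ->
  dot (normal_curvature_tensor x X1 X2 n2 p) (n1 p) = frame_curvature x p (X1 p) (X2 p).
Proof.
move=> Up; refine (etrans (curvature1 Up) _).
have [ho d1 _ _ _] := adapted_atP (dx Up) (had Up).
have hn1 v q : U q -> dot (n1 q) ('D_v x q) = 0.
  by move=> Uq; have [_ _ h _ _] := adapted_atP (dx Uq) (had Uq); exact: h.
have hn2 v q : U q -> dot (n2 q) ('D_v x q) = 0.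
  by move=> Uq; have [_ _ _ h _] := adapted_atP (dx Uq) (had Uq); exact: h.
have hd1 v w := derive_dot_cst w oU c1 (Cinf_derive v cx) Up (hn1 v).
have hd2 v w := derive_dot_cst w oU c2 (Cinf_derive v cx) Up (hn2 v).
have sw : 'D_(X2 p) ('D_(X1 p) x) p = 'D_(X1 p) ('D_(X2 p) x) p.
  exact: schwarz oU cx Up.
have hd1' : dot ('D_(X2 p) n1 p) ('D_(X1 p) x p) +
    dot (n1 p) ('D_(X1 p) ('D_(X2 p) x) p) = 0.
  exact: etrans (congr1 (fun w => _ + dot _ w) (esym sw)) (hd1 _ _).
have hd2' : dot ('D_(X2 p) n2 p) ('D_(X1 p) x p) +
    dot (n2 p) ('D_(X1 p) ('D_(X2 p) x) p) = 0.
  exact: etrans (congr1 (fun w => _ + dot _ w) (esym sw)) (hd2 _ _).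
exact: (ricci_alg ho d1 (dn2 (X1 p) Up) (dn2 (X2 p) Up) (dn1 (X1 p) Up) (dn1 (X2 p) Up)
  (hd1 _ _) (hd1 _ _) hd1' (hd1 _ _) (hd2 _ _) (hd2 _ _) hd2' (hd2 _ _)).
Qed.

End Ricci.

Local Opaque derive dot det4 cross.

(** * Normal curvature: isothermal parameters and change of parameters *)

Section Curvature.
Variable R : realType.
Local Notation V := 'rV[R]_2.
Implicit Types (x : V -> 'rV[R]_4) (p q X Y : V) (U : set V).

(** [normal_curvature] is a chosen element of the set of values over all
    adapted frames; the set is inhabited by [adapted_frame_exists], and
    [ricci] evaluates whichever frame was chosen. *)
Lemma normal_curvature_frame x U p : open U -> Cinf U x -> U p ->
  (exists X, dot ('D_X x p) ('D_X x p) < 0) ->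
  (exists Y, 0 < dot ('D_Y x p) ('D_Y x p)) ->
  exists (X1 X2 : V) n1 n2, adapted_at x p X1 X2 n1 n2 /\
    normal_curvature x p = frame_curvature x p X1 X2.
Proof.
move=> oU cx Up hX hY.
have [U' [X1 [X2 [n1 [n2 [oU' Up' hf]]]]]] := adapted_frame_exists oU cx Up hX hY.
have [] := @getPex _ [set k | exists U (X1 X2 : V -> V) n1 n2,
    [/\ open U, U p, adapted_frame x U X1 X2 n1 n2 &
        k = dot (normal_curvature_tensor x X1 X2 n2 p) (n1 p)]].
  by exists (dot (normal_curvature_tensor x X1 X2 n2 p) (n1 p)), U', X1, X2, n1, n2.
rewrite -/(normal_curvature x p).
move=> W [Y1 [Y2 [m1 [m2 [oW Wp [sY1 sY2 sm1 sm2 hW] ->]]]]].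
have oI := openI oW oU.
have sW : W `&` U `<=` W by move=> q [].
have sU : W `&` U `<=` U by move=> q [].
exists (Y1 p), (Y2 p), (m1 p), (m2 p); split; first exact: hW.
move: sY1 sY2 sm1 sm2 => /smoothP cY1 /smoothP cY2 /smoothP c1 /smoothP c2.
by refine (ricci oI (Cinf_sub sU cx) (Cinf_sub sW cY1) (Cinf_sub sW cY2)
  (Cinf_sub sW c1) (Cinf_sub sW c2) (fun q Wq => hW q (sW q Wq)) (conj Wp Up)).
Qed.

Local Notation e0 := (delta_mx 0 0 : V).
Local Notation e1 := (delta_mx 0 1 : V).

Lemma second_derivative_alg (W : lmodType R) (a b c : W) (s t s' t' : R) :
  s *: (s' *: a + t' *: b) + t *: (s' *: b + t' *: c) =
  (s * s') *: a + (s * t' + t * s') *: b + (t * t') *: c.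
Proof.
by rewrite !scalerDr !scalerA scalerDl !addrA.
Qed.

Lemma second_derivativeE x U p X Y : open U -> Cinf U x -> U p ->
  'D_X ('D_Y x) p = (X 0 0 * Y 0 0) *: 'D_e0 ('D_e0 x) p
   + (X 0 0 * Y 0 1 + X 0 1 * Y 0 0) *: 'D_e0 ('D_e1 x) p
   + (X 0 1 * Y 0 1) *: 'D_e1 ('D_e1 x) p.
Proof.
move=> oU cx Up.
have dd v := Cinf_diff (Cinf_derive v cx) Up.
have h v : 'D_v ('D_Y x) p = Y 0 0 *: 'D_v ('D_e0 x) p + Y 0 1 *: 'D_v ('D_e1 x) p.
  have e : 'D_v ('D_Y x) p = 'D_v (fun q => Y 0 0 *: 'D_e0 x q + Y 0 1 *: 'D_e1 x q) p.
    refine (eq_on_derive v oU _ Up) => q Uq.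
    exact: derive2E (Cinf_diff cx Uq).
  have dz (s : R) w : differentiable (fun q => s *: 'D_w x q) p.
    exact: differentiableZ.
  refine (etrans e (etrans (derive_add v (dz _ _) (dz _ _)) _)).
  exact: congr2 (derive_Zc _ _ (dd _)) (derive_Zc _ _ (dd _)).
have sw : 'D_e1 ('D_e0 x) p = 'D_e0 ('D_e1 x) p by exact: schwarz oU cx Up.
refine (etrans (derive2E X (dd Y)) _).
refine (etrans (congr2 (fun a b => _ *: a + _ *: b) (h _) (h _)) _).
refine (etrans (congr1 (fun a => _ + _ *: (_ *: a + _)) sw) _).
exact: second_derivative_alg.
Qed.

(** Two orthonormal bases of the Lorentz plane: the second vector (p2, q2) is,
    up to the sign eps, the reflection (q1, p1) of the first. *)
Lemma hyperbolic_bases (a b : 'rV[R]_4) (p1 q1 p2 q2 E : R) :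
  E < 0 -> dot a a = E -> dot b b = - E -> dot a b = 0 ->
  dot (p1 *: a + q1 *: b) (p1 *: a + q1 *: b) = -1 ->
  dot (p2 *: a + q2 *: b) (p2 *: a + q2 *: b) = 1 ->
  dot (p1 *: a + q1 *: b) (p2 *: a + q2 *: b) = 0 ->
  p1 ^+ 2 - q1 ^+ 2 = (- E)^-1 /\
  exists eps : R, [/\ eps ^+ 2 = 1, p2 = eps * q1 & q2 = eps * p1].
Proof.
move=> E0 haa hbb hab; rewrite !dot_lin (dotC b a) haa hbb hab => h1 h2 h3.
have En0 : E != 0 by rewrite lt_eqF.
rewrite invrN; pose e' := - E^-1.
have k1 : p1 ^+ 2 - q1 ^+ 2 = e'.
  by apply: (mulfI En0); rewrite /e' mulrN divff //; lra.
have k2 : q2 ^+ 2 - p2 ^+ 2 = e'.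
  by apply: (mulfI En0); rewrite /e' mulrN divff //; lra.
have k3 : p1 * p2 = q1 * q2 by apply: (mulfI En0); lra.
have e'0 : e' != 0 by rewrite /e' oppr_eq0 invr_eq0.
(* the determinant of the change of basis, divided by the conformal factor *)
pose eps := (p1 * q2 - q1 * p2) / e'.
have hA : eps * e' = p1 * q2 - q1 * p2 by rewrite divfK.
have hp2 : p2 = eps * q1.
  apply: (mulfI e'0); apply/subr0_eq.
  transitivity (p1 * (p1 * p2 - q1 * q2)); last by rewrite k3 subrr mulr0.
  by rewrite mulrA [e' * eps]mulrC hA -k1; ring.
have hq2 : q2 = eps * p1.
  apply: (mulfI e'0); apply/subr0_eq.
  transitivity (q1 * (p1 * p2 - q1 * q2)); last by rewrite k3 subrr mulr0.
  by rewrite mulrA [e' * eps]mulrC hA -k1; ring.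
clearbody eps; split=> //; exists eps; split=> //.
apply: (mulIf e'0); rewrite mul1r.
transitivity ((eps * p1) ^+ 2 - (eps * q1) ^+ 2); first by rewrite -k1; ring.
by rewrite -hp2 -hq2.
Qed.

(** A change of orthonormal tangent basis multiplies the determinant by a
    power of the conformal factor only. *)
Lemma frame_curvature_alg (a b c d e : 'rV[R]_4) (p1 q1 p2 q2 E : R) :
  E < 0 -> dot a a = E -> dot b b = - E -> dot a b = 0 -> e = c ->
  dot (p1 *: a + q1 *: b) (p1 *: a + q1 *: b) = -1 ->
  dot (p2 *: a + q2 *: b) (p2 *: a + q2 *: b) = 1 ->
  dot (p1 *: a + q1 *: b) (p2 *: a + q2 *: b) = 0 ->
  det4 (p1 *: a + q1 *: b) (p2 *: a + q2 *: b)
   (((p1 * p1) *: c + (p1 * q1 + q1 * p1) *: d + (q1 * q1) *: e) +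
    ((p2 * p2) *: c + (p2 * q2 + q2 * p2) *: d + (q2 * q2) *: e))
   ((p1 * p2) *: c + (p1 * q2 + q1 * p2) *: d + (q1 * q2) *: e)
  = 2 * det4 a b c d / (- E) ^+ 3.
Proof.
move=> E0 haa hbb hab -> h1 h2 h3.
have [k1 [eps [eps2 hp2 hq2]]] := hyperbolic_bases E0 haa hbb hab h1 h2 h3.
have -> : (p1 * p1) *: c + (p1 * q1 + q1 * p1) *: d + (q1 * q1) *: c +
   ((p2 * p2) *: c + (p2 * q2 + q2 * p2) *: d + (q2 * q2) *: c) =
   (p1 ^+ 2 + q1 ^+ 2 + p2 ^+ 2 + q2 ^+ 2) *: c + (2 * (p1 * q1 + p2 * q2)) *: d.
  by apply/rowP => i; rewrite !mxE; ring.
have -> : (p1 * p2) *: c + (p1 * q2 + q1 * p2) *: d + (q1 * q2) *: c =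
   (p1 * p2 + q1 * q2) *: c + (p1 * q2 + q1 * p2) *: d.
  by apply/rowP => i; rewrite !mxE; ring.
rewrite det4_lin -exprVn -k1 hp2 hq2.
transitivity (eps ^+ 2 * (1 + eps ^+ 2) * (det4 a b c d * (p1 ^+ 2 - q1 ^+ 2) ^+ 3)).
  by ring.
by rewrite eps2; ring.
Qed.

Lemma orthonormal_second_alg (a b c d e : 'rV[R]_4) (p1 q1 p2 q2 E : R) :
  E < 0 -> dot a a = E -> dot b b = - E -> dot a b = 0 -> e = c ->
  dot (p1 *: a + q1 *: b) (p1 *: a + q1 *: b) = -1 ->
  dot (p2 *: a + q2 *: b) (p2 *: a + q2 *: b) = 1 ->
  dot (p1 *: a + q1 *: b) (p2 *: a + q2 *: b) = 0 ->
  (p1 * p1) *: c + (p1 * q1 + q1 * p1) *: d + (q1 * q1) *: e =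
  (p2 * p2) *: c + (p2 * q2 + q2 * p2) *: d + (q2 * q2) *: e.
Proof.
move=> E0 haa hbb hab -> h1 h2 h3.
have [k1 [eps [eps2 -> ->]]] := hyperbolic_bases E0 haa hbb hab h1 h2 h3.
have -> : eps * q1 * (eps * q1) = q1 * q1 by rewrite mulrACA -expr2 eps2 mul1r.
have -> : eps * p1 * (eps * p1) = p1 * p1 by rewrite mulrACA -expr2 eps2 mul1r.
have -> : eps * q1 * (eps * p1) = q1 * p1 by rewrite mulrACA -expr2 eps2 mul1r.
have -> : eps * p1 * (eps * q1) = p1 * q1 by rewrite mulrACA -expr2 eps2 mul1r.
by rewrite [q1 * p1 + _]addrC [RHS]addrC [RHS]addrCA [RHS]addrC -!addrA; congr (_ + _);
  rewrite addrC.
Qed.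

Lemma frame_curvature_isothermal x U p X1 X2 : open U -> Cinf U x -> U p ->
  dot (du x p) (du x p) = - dot (dv x p) (dv x p) -> dot (du x p) (dv x p) = 0 ->
  dot (du x p) (du x p) < 0 -> 'D_e1 ('D_e1 x) p = 'D_e0 ('D_e0 x) p ->
  orthonormal_tangent x p X1 X2 ->
  frame_curvature x p X1 X2 = 2 * det4 (du x p) (dv x p) ('D_e0 ('D_e0 x) p) ('D_e0 ('D_e1 x) p)
    / (- dot (du x p) (du x p)) ^+ 3.
Proof.
move=> oU cx Up hE hF E0 hm [].
have h1 := du_dvE X1 (Cinf_diff cx Up).
have h2 := du_dvE X2 (Cinf_diff cx Up).
have h11 := second_derivativeE X1 X1 oU cx Up.
have h12 := second_derivativeE X1 X2 oU cx Up.
have h22 := second_derivativeE X2 X2 oU cx Up.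
rewrite /frame_curvature h1 h2 => k1 k2 k3.
refine (etrans (congr2 (fun s t => det4 _ _ s t)
   (congr2 (fun s t => s + t) h11 h22) h12) _).
refine (frame_curvature_alg _ E0 _ _ hF hm k1 k2 k3); first by [].
exact: (etrans (esym (opprK _)) (congr1 -%R (esym hE))).
Qed.

Lemma derive_comp_field (W U : set V) x (f : V -> V) Y q : open U -> open W ->
  (forall q, U q -> W (f q)) -> Cinf U f -> Cinf W x -> U q ->
  'D_Y (x \o f) q = 'D_('D_Y f q) x (f q).
Proof.
move=> oU oW fU cf cx Uq.
exact: derive_comp (Cinf_diff cf Uq) (Cinf_diff cx (fU q Uq)).
Qed.

(** The first term is tangential, so the second fundamental form is
    transported by the differential of f. *)
Lemma second_comp (W U : set V) x (f : V -> V) X Y p : open U -> open W ->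
  (forall q, U q -> W (f q)) -> Cinf U f -> Cinf W x -> U p ->
  'D_X ('D_Y (x \o f)) p = 'D_('D_X ('D_Y f) p) x (f p)
    + 'D_('D_X f p) ('D_('D_Y f p) x) (f p).
Proof.
move=> oU oW fU cf cx Up.
have cY := Cinf_derive Y cf.
have dY : differentiable ('D_Y f) p := Cinf_diff cY Up.
have /(Cinf_mxP oU) cYc := cY.
pose z (i : 'I_2) := fun q => 'D_Y f q 0 i.
have dz i : differentiable (z i) p := Cinf_diff (cYc 0 i) Up.
have ce v : Cinf U ('D_v x \o f) := Cinf_comp oU oW fU cf (Cinf_derive v cx).
have de v : differentiable ('D_v x \o f) p := Cinf_diff (ce v) Up.
have e : 'D_X ('D_Y (x \o f)) p =
   'D_X (fun q => z 0 q *: ('D_e0 x \o f) q + z 1 q *: ('D_e1 x \o f) q) p.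
  refine (eq_on_derive X oU _ Up) => q Uq.
  refine (etrans (derive_comp_field Y oU oW fU cf cx Uq) _).
  exact: derive2E (Cinf_diff cx (fU q Uq)).
have [s0 t0] := derive_scale X (dz 0) (de e0).
have [s1 t1] := derive_scale X (dz 1) (de e1).
have k v : 'D_X ('D_v x \o f) p = 'D_('D_X f p) ('D_v x) (f p).
  exact: derive_comp (Cinf_diff cf Up) (Cinf_diff (Cinf_derive v cx) (fU p Up)).
have dxf := Cinf_diff cx (fU p Up).
have c i : ('D_X ('D_Y f) p) 0 i = 'D_X (z i) p := derive_coord X 0 i dY.
have r1 := etrans (derive2E ('D_X ('D_Y f) p) dxf)
  (congr2 (fun s t => s *: _ + t *: _) (c 0) (c 1)).
have ddx v := Cinf_diff (Cinf_derive v cx) (fU p Up).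
have r2 : 'D_('D_X f p) ('D_('D_Y f p) x) (f p) =
   z 0 p *: 'D_('D_X f p) ('D_e0 x) (f p) + z 1 p *: 'D_('D_X f p) ('D_e1 x) (f p).
  have e' : 'D_('D_X f p) ('D_('D_Y f p) x) (f p) = 'D_('D_X f p)
     (fun q => z 0 p *: 'D_e0 x q + z 1 p *: 'D_e1 x q) (f p).
    refine (eq_on_derive _ oW _ (fU p Up)) => q Wq.
    exact: derive2E (Cinf_diff cx Wq).
  have dzz (s : R) w : differentiable (fun q => s *: 'D_w x q) (f p).
    by apply: differentiableZ; exact: ddx.
  refine (etrans e' (etrans (derive_add _ (dzz _ _) (dzz _ _)) _)).
  refine (congr2 +%R (derive_Zc (z 0 p) _ (ddx e0)) (derive_Zc (z 1 p) _ (ddx e1))).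
refine (etrans e (etrans (derive_add X t0 t1) _)).
refine (etrans (congr2 +%R s0 s1) _).
refine (etrans _ (esym (congr2 +%R r1 r2))).
refine (etrans (congr2 (fun a b => (_ + _ *: a) + (_ + _ *: b)) (k e0) (k e1)) _).
exact: addrACA.
Qed.

Lemma normal_det4_eq (t1 t2 n1 n2 v w v' w' : 'rV[R]_4) :
  orthonormal4 t1 t2 n1 n2 -> det4 t1 t2 n1 n2 = 1 ->
  (forall n, dot t1 n = 0 -> dot t2 n = 0 -> dot v n = dot v' n) ->
  (forall n, dot t1 n = 0 -> dot t2 n = 0 -> dot w n = dot w' n) ->
  det4 t1 t2 v w = det4 t1 t2 v' w'.
Proof.
move=> ho d1 hv hw; rewrite !(det4_normal _ _ ho d1).
have [_ [_ _ [h1 h2 h3 h4]]] := ho.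
by rewrite (hv n1) // (hv n2) // (hw n1) // (hw n2).
Qed.

Lemma dot_add_orth (a b n : 'rV[R]_4) : dot a n = 0 -> dot (a + b) n = dot b n.
Proof. by rewrite dotDl => ->; rewrite add0r. Qed.

Lemma dot_add_orth2 (a b a' b' n : 'rV[R]_4) : dot a n = 0 -> dot a' n = 0 ->
  dot ((a + b) + (a' + b')) n = dot (b + b') n.
Proof. by rewrite !dotDl => -> ->; rewrite !add0r. Qed.

(** The tangential terms D_(D^2 f) x do not contribute to the determinant. *)
Lemma frame_curvature_comp (W U : set V) x (f : V -> V) (X1 X2 : V) n1 n2 p :
  open U -> open W ->
  (forall q, U q -> W (f q)) -> Cinf U f -> Cinf W x -> U p ->
  adapted_at x (f p) ('D_X1 f p) ('D_X2 f p) n1 n2 ->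
  orthonormal_tangent (x \o f) p X1 X2 /\
  frame_curvature x (f p) ('D_X1 f p) ('D_X2 f p) = frame_curvature (x \o f) p X1 X2.
Proof.
move=> oU oW fU cf cx Up had.
have dx := Cinf_diff cx (fU p Up).
have [ho d1 _ _ _] := adapted_atP dx had.
have h v := derive_comp_field v oU oW fU cf cx Up.
split.
  have [[k1 k2 k3] _ _] := had.
  by split; [rewrite (h X1)|rewrite (h X2)|rewrite (h X1) (h X2)].
have tn v n : dot ('D_('D_X1 f p) x (f p)) n = 0 ->
    dot ('D_('D_X2 f p) x (f p)) n = 0 -> dot ('D_v x (f p)) n = 0.
  move=> m1 m2; have [hot _ _] := had.
  exact: (etrans (dotC _ _) (normal_to_frame dx hot (etrans (dotC _ _) m1)
    (etrans (dotC _ _) m2) v)).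
have g X Y := second_comp X Y oU oW fU cf cx Up.
refine (etrans _ (esym (congr2 (fun a b => det4 a b _ _) (h X1) (h X2)))).
apply: (normal_det4_eq ho d1) => n m1 m2; apply/esym.
  refine (etrans (congr1 (fun a => dot a n) (congr2 +%R (g X1 X1) (g X2 X2))) _).
  exact: dot_add_orth2 (tn _ _ m1 m2) (tn _ _ m1 m2).
refine (etrans (congr1 (fun a => dot a n) (g X1 X2)) _).
exact: dot_add_orth (tn _ _ m1 m2).
Qed.

(** Minimality without projections: this form is visibly independent of the
    parameters. *)
Definition normal_minimal x p : Prop :=
  forall (X1 X2 : V) n, orthonormal_tangent x p X1 X2 ->
  (forall v, dot n ('D_v x p) = 0) ->
  dot ('D_X1 ('D_X1 x) p) n = dot ('D_X2 ('D_X2 x) p) n.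

Lemma dot_oppD (a b n : 'rV[R]_4) : dot (- a + b) n = - dot a n + dot b n.
Proof. by rewrite !dot_lin. Qed.

Lemma normal_proj_dot x p w n : differentiable x p ->
  dot (du x p) (du x p) * dot (dv x p) (dv x p) - dot (du x p) (dv x p) ^+ 2 != 0 ->
  (forall v, dot n ('D_v x p) = 0) -> dot (w *m normal_proj x p) n = dot w n.
Proof.
move=> dx g0 hn; have [_ _ [s [t e]] _] := orth_projP w g0.
exact: dot_subr_comb e (hn e0) (hn e1).
Qed.

Lemma minimal_normal_minimal (M : surface R) p : minimal_timelike M -> dom M p ->
  normal_minimal (pos M) p.
Proof.
move=> [[[oU _] /smoothP cx _ _] hm] Up X1 X2 n ho hn.
have dx := Cinf_diff cx Up.
have [_ g0] := orthonormal_tangent_basis dx ho.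
have h := congr1 (fun w => dot w n) (hm p Up X1 X2 ho).
have k w := normal_proj_dot w dx g0 hn.
have {}h : - dot ('D_X1 ('D_X1 (pos M)) p) n + dot ('D_X2 ('D_X2 (pos M)) p) n = 0.
  refine (etrans (congr2 (fun a b => - a + b) (esym (k _)) (esym (k _))) _).
  exact: etrans (esym (dot_oppD _ _ _)) (etrans h (dot0l _)).
exact: esym (subr0_eq (etrans (addrC _ _) h)).
Qed.

Lemma normal_minimal_comp (W U : set V) x (f : V -> V) p :
  open U -> open W ->
  (forall q, U q -> W (f q)) -> Cinf U f -> Cinf W x -> U p ->
  (forall v, exists u, v = 'D_u f p) ->
  normal_minimal x (f p) -> normal_minimal (x \o f) p.
Proof.
move=> oU oW fU cf cx Up sf hm X1 X2 n.
have h v := derive_comp_field v oU oW fU cf cx Up.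
have g X Y := second_comp X Y oU oW fU cf cx Up.
move=> ho hn.
have hn' v : dot n ('D_v x (f p)) = 0.
  by have [u ->] := sf v; refine (etrans (congr1 (fun a => dot n a) (esym (h u))) (hn u)).
have ho' : orthonormal_tangent x (f p) ('D_X1 f p) ('D_X2 f p).
  move: ho => [k1 k2 k3]; split.
  - exact: etrans (congr1 (fun a => dot a a) (esym (h X1))) k1.
  - exact: etrans (congr1 (fun a => dot a a) (esym (h X2))) k2.
  - exact: etrans (congr2 (fun a b => dot a b) (esym (h X1)) (esym (h X2))) k3.
have e X : dot ('D_X ('D_X (x \o f)) p) n =
    dot ('D_('D_X f p) ('D_('D_X f p) x) (f p)) n.
  refine (etrans (congr1 (fun a => dot a n) (g X X)) _).
  exact: dot_add_orth (etrans (dotC _ _) (hn' _)).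
refine (etrans (e X1) (etrans (hm ('D_X1 f p) ('D_X2 f p) n ho' hn') (esym (e X2)))).
Qed.

End Curvature.

(** * Isothermal minimal surfaces *)

(** An opaque copy of the directional derivative. Otherwise comparing
    derivatives of one map in two different constant directions unfolds the
    limits that define them. *)
Fact dir_key : {D : forall (R : realType) (V W : normedModType R), V -> (V -> W) -> V -> W |
  D = fun R V W v f p => 'D_v f p}.
Proof. by exists (fun R V W v f p => 'D_v f p). Qed.
Definition dir (R : realType) (V W : normedModType R) : V -> (V -> W) -> V -> W :=
  sval dir_key R V W.

Section Dir.
Variables (R : realType) (V : normedModType R).
Implicit Types (p v w : V).

Lemma dirF (W : normedModType R) v (f : V -> W) : dir v f = 'D_v f.
Proof. by rewrite /dir (svalP dir_key). Qed.

Lemma dirE (W : normedModType R) v (f : V -> W) p : dir v f p = 'D_v f p.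
Proof. by rewrite dirF. Qed.

Lemma dirEE (W : normedModType R) v w (f : V -> W) p : dir v (dir w f) p = 'D_v ('D_w f) p.
Proof. by rewrite !dirF. Qed.

Section OnOpen.
Variable U : set V.
Hypothesis oU : open U.

Lemma Cinf_dir (W : normedModType R) (f : V -> W) v : Cinf U f -> Cinf U (dir v f).
Proof. by rewrite dirF; exact: Cinf_derive. Qed.

Lemma dir_eq (W : normedModType R) (f g : V -> W) v p :
  (forall q, U q -> f q = g q) -> U p -> dir v f p = dir v g p.
Proof. by rewrite !dirF; exact: eq_on_derive. Qed.

Lemma dir_cst (W : normedModType R) (f : V -> W) (c : W) v p :
  (forall q, U q -> f q = c) -> U p -> dir v f p = 0.
Proof.
move=> h Up; rewrite (@dir_eq _ f (fun=> c) v p h Up) dirF; exact: derive_const.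
Qed.

Lemma dirD (W : normedModType R) (f g : V -> W) v p : Cinf U f -> Cinf U g -> U p ->
  dir v (fun q => f q + g q) p = dir v f p + dir v g p.
Proof.
move=> cf cg Up; rewrite !dirF; exact: derive_add (Cinf_diff cf Up) (Cinf_diff cg Up).
Qed.

Lemma dirB (W : normedModType R) (f g : V -> W) v p : Cinf U f -> Cinf U g -> U p ->
  dir v (fun q => f q - g q) p = dir v f p - dir v g p.
Proof.
move=> cf cg Up; rewrite !dirF; exact: derive_sub (Cinf_diff cf Up) (Cinf_diff cg Up).
Qed.

Lemma dir_scalec (W : normedModType R) (s : R) (f : V -> W) v p : Cinf U f -> U p ->
  dir v (fun q => s *: f q) p = s *: dir v f p.
Proof. by move=> cf Up; rewrite !dirF; exact: derive_Zc (Cinf_diff cf Up). Qed.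

Lemma dir_dot (f g : V -> 'rV[R]_4) v p : Cinf U f -> Cinf U g -> U p ->
  dir v (fun q => dot (f q) (g q)) p = dot (dir v f p) (g p) + dot (f p) (dir v g p).
Proof.
move=> cf cg Up; rewrite !dirF; exact: derive_dot (Cinf_diff cf Up) (Cinf_diff cg Up).
Qed.

Lemma dir_mulmxr m n l (f : V -> 'M[R]_(m, n)) (A : 'M[R]_(n, l)) v p : Cinf U f ->
  U p -> dir v (fun q => f q *m A) p = dir v f p *m A.
Proof. by move=> cf Up; rewrite !dirF; exact: derive_mulmxr (Cinf_diff cf Up). Qed.

Lemma dir_mulmx m n l (f : V -> 'M[R]_(m, n)) (g : V -> 'M[R]_(n, l)) v p :
  Cinf U f -> Cinf U g -> U p ->
  dir v (fun q => f q *m g q) p = dir v f p *m g p + f p *m dir v g p.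
Proof.
move=> cf cg Up; rewrite !dirF; exact: derive_mulmx (Cinf_diff cf Up) (Cinf_diff cg Up).
Qed.

Lemma dirC m n (f : V -> 'M[R]_(m, n)) v w p : Cinf U f -> U p ->
  dir v (dir w f) p = dir w (dir v f) p.
Proof. by move=> cf Up; rewrite !dirF; exact: schwarz oU cf Up. Qed.

Lemma dir_lin (W : normedModType R) (f : V -> W) a b v w p : Cinf U f -> U p ->
  dir (a *: v + b *: w) f p = a *: dir v f p + b *: dir w f p.
Proof. by move=> cf Up; rewrite !dirF; exact: derive_lin (Cinf_diff cf Up). Qed.

Lemma dir_dot_cst (f g : V -> 'rV[R]_4) (c : R) p v : Cinf U f -> Cinf U g ->
  (forall q, U q -> dot (f q) (g q) = c) -> U p ->
  dot (dir v f p) (g p) + dot (f p) (dir v g p) = 0.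
Proof.
by move=> cf cg h Up; rewrite -(dir_dot v cf cg Up); exact: dir_cst h Up.
Qed.

End OnOpen.
End Dir.

Section IsoMin.
Variable R : realType.
Local Notation V := 'rV[R]_2.
Implicit Types (x : V -> 'rV[R]_4) (p q X Y : V) (U : set V).
Local Notation e0 := (delta_mx 0 0 : V).
Local Notation e1 := (delta_mx 0 1 : V).

Lemma duE x p : du x p = dir e0 x p. Proof. by rewrite dirF. Qed.
Lemma dvE x p : dv x p = dir e1 x p. Proof. by rewrite dirF. Qed.

Lemma dir_coordE U x X p : Cinf U x -> U p ->
  dir X x p = X 0 0 *: dir e0 x p + X 0 1 *: dir e1 x p.
Proof. by move=> cx Up; rewrite {1}(row2E X); exact: dir_lin cx Up. Qed.

Definition isothermal_at x p : Prop :=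
  [/\ dot (dir e0 x p) (dir e0 x p) = - dot (dir e1 x p) (dir e1 x p),
      dot (dir e0 x p) (dir e1 x p) = 0 & dot (dir e0 x p) (dir e0 x p) < 0].

Definition iso_minimal U x : Prop :=
  Cinf U x /\ forall p, U p ->
    isothermal_at x p /\ dir e1 (dir e1 x) p = dir e0 (dir e0 x) p.

Lemma iso_minimal_sub U U' x : U' `<=` U -> iso_minimal U x -> iso_minimal U' x.
Proof.
by move=> sU [cx h]; split; [exact: Cinf_sub cx|move=> p /sU; exact: h].
Qed.

Lemma isothermal_signs x p : isothermal_at x p ->
  (exists X, dot (dir X x p) (dir X x p) < 0) /\
  (exists Y, 0 < dot (dir Y x p) (dir Y x p)).
Proof.
move=> [h1 _ h3]; split; first by exists e0.
by exists e1; move: h3; rewrite h1 oppr_lt0.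
Qed.

(** The normal curvature in isothermal parameters on a minimal surface. *)
Definition iso_curvature x p : R :=
  2 * det4 (dir e0 x p) (dir e1 x p) (dir e0 (dir e0 x) p) (dir e0 (dir e1 x) p)
    / (- dot (dir e0 x p) (dir e0 x p)) ^+ 3.

Lemma frame_curvature_iso_minimal U x p X1 X2 : open U -> Cinf U x -> U p ->
  isothermal_at x p -> dir e1 (dir e1 x) p = dir e0 (dir e0 x) p ->
  orthonormal_tangent x p X1 X2 -> frame_curvature x p X1 X2 = iso_curvature x p.
Proof.
move=> oU cx Up; rewrite /isothermal_at /iso_curvature !dirF => -[h1 h2 h3] hm ho.
exact: frame_curvature_isothermal oU cx Up h1 h2 h3 hm ho.
Qed.

Lemma normal_curvature_frame_dir x U p : open U -> Cinf U x -> U p ->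
  (exists X, dot (dir X x p) (dir X x p) < 0) ->
  (exists Y, 0 < dot (dir Y x p) (dir Y x p)) ->
  exists (X1 X2 : V) n1 n2, adapted_at x p X1 X2 n1 n2 /\
    normal_curvature x p = frame_curvature x p X1 X2.
Proof.
move=> oU cx Up [X hX] [Y hY]; rewrite !dirF in hX hY.
exact: normal_curvature_frame oU cx Up (ex_intro _ X hX) (ex_intro _ Y hY).
Qed.

Lemma normal_curvature_iso_minimal U x p : open U -> iso_minimal U x -> U p ->
  normal_curvature x p = iso_curvature x p.
Proof.
move=> oU [cx h] Up; have [hi hm] := h p Up.
have [hX hY] := isothermal_signs hi.
have [X1 [X2 [n1 [n2 [[ho _ _] ->]]]]] := normal_curvature_frame_dir oU cx Up hX hY.
exact: frame_curvature_iso_minimal oU cx Up hi hm ho.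
Qed.

Lemma dir_comp (W U : set V) x (f : V -> V) Y q :
  (forall q, U q -> W (f q)) -> Cinf U f -> Cinf W x -> U q ->
  dir Y (x \o f) q = dir (dir Y f q) x (f q).
Proof.
move=> fU cf cx Uq; rewrite !dirF.
exact: derive_comp (Cinf_diff cf Uq) (Cinf_diff cx (fU q Uq)).
Qed.

Lemma normal_curvature_comp (W U : set V) x (f : V -> V) p :
  open U -> open W -> (forall q, U q -> W (f q)) -> Cinf U f -> Cinf W x -> U p ->
  (forall v, exists u, v = 'D_u f p) -> iso_minimal U (x \o f) ->
  normal_curvature x (f p) = iso_curvature (x \o f) p.
Proof.
move=> oU oW fU cf cx Up sf [cxf h]; have [hi hm] := h p Up.
have [[X hX] [Y hY]] := isothermal_signs hi.
have e v := dir_comp v fU cf cx Up.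
have hX' : exists X, dot (dir X x (f p)) (dir X x (f p)) < 0.
  by exists (dir X f p); rewrite -(e X).
have hY' : exists Y, 0 < dot (dir Y x (f p)) (dir Y x (f p)).
  by exists (dir Y f p); rewrite -(e Y).
have [X1 [X2 [n1 [n2 [had ->]]]]] := normal_curvature_frame_dir oW cx (fU p Up) hX' hY'.
have [Y1 eY1] := sf X1; have [Y2 eY2] := sf X2.
rewrite eY1 eY2 in had *.
have [ho ->] := frame_curvature_comp oU oW fU cf cx Up had.
exact: frame_curvature_iso_minimal oU cxf Up hi hm ho.
Qed.

(** Split any test vector into its tangential and normal parts. *)
Lemma eq_of_normal_tangent (a b c d : 'rV[R]_4) :
  dot a a * dot b b - dot a b ^+ 2 != 0 ->
  dot c a = dot d a -> dot c b = dot d b ->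
  (forall n, dot n a = 0 -> dot n b = 0 -> dot c n = dot d n) -> c = d.
Proof.
move=> g0 ha hb hn; apply/subr0_eq/dot_nondeg => v.
have [h1 h2 [s [t e]] _] := orth_projP v g0.
have k1 := hn _ h1 h2.
rewrite -[v](subrK (v *m orth_proj a b)) e dotDl dotNl !dotDr !dotZr ha hb k1.
by rewrite subrr.
Qed.

Lemma normal_minimal_dir x p (X1 X2 : V) n : normal_minimal x p ->
  orthonormal_tangent x p X1 X2 -> (forall v, dot n (dir v x p) = 0) ->
  dot (dir X1 (dir X1 x) p) n = dot (dir X2 (dir X2 x) p) n.
Proof.
move=> h ho hn.
refine (etrans (congr1 (fun a => dot a n) (dirEE X1 X1 x p))
  (etrans (h X1 X2 n ho _) (esym (congr1 (fun a => dot a n) (dirEE X2 X2 x p))))).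
move=> v; refine (etrans (congr1 (fun a => dot n a) (esym (dirE v x p))) (hn v)).
Qed.

(** Minimality says that x_vv - x_uu has no normal part; differentiating x_u ^
    2 + x_v ^ 2 = 0 and x_u . x_v = 0 shows that it has no tangential part. *)
Lemma iso_minimal_of_normal_minimal U x : open U -> Cinf U x ->
  (forall p, U p -> isothermal_at x p) -> (forall p, U p -> normal_minimal x p) ->
  iso_minimal U x.
Proof.
move=> oU cx hi hm; split=> // p Up; split; first exact: hi.
have [hE hF E0] := hi p Up.
have dd v := Cinf_dir v cx.
have sw : dir e1 (dir e0 x) p = dir e0 (dir e1 x) p by refine (dirC oU e1 e0 cx Up).
have F0 q : U q -> dot (dir e0 x q) (dir e1 x q) = 0 by move=> /hi[].
have dF v := dir_dot_cst oU v (dd e0) (dd e1) F0 Up.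
have dE v : dot (dir v (dir e0 x) p) (dir e0 x p) + dot (dir v (dir e1 x) p) (dir e1 x p) = 0.
  have cE w := Cinf_dot oU (dd w) (dd w).
  have h : dir v (fun q => dot (dir e0 x q) (dir e0 x q) + dot (dir e1 x q) (dir e1 x q)) p = 0.
    apply: (dir_cst oU (c := 0) _ _ Up) => q /hi[-> _ _]; exact: addNr.
  rewrite (dirD v (cE e0) (cE e1) Up) !(dir_dot v (dd _) (dd _) Up) in h.
  rewrite (dotC (dir e0 x p)) (dotC (dir e1 x p)) in h.
  by apply: double_eq0; rewrite -[RHS]h; ring.
have g0 : dot (dir e0 x p) (dir e0 x p) * dot (dir e1 x p) (dir e1 x p)
    - dot (dir e0 x p) (dir e1 x p) ^+ 2 != 0.
  by rewrite hF expr0n subr0 mulf_eq0 negb_or lt_eqF //= -oppr_eq0 -hE lt_eqF.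
apply: (eq_of_normal_tangent g0).
- have := dF e1; have := dE e0; rewrite sw addrC => /eqP; rewrite addr_eq0 => /eqP h1.
  rewrite addrC [dot (dir e0 x p) _]dotC => /eqP; rewrite addr_eq0 => /eqP ->.
  by rewrite h1 opprK.
- have := dF e0; have := dE e1; rewrite sw addrC => /eqP; rewrite addr_eq0 => /eqP h1.
  move=> /eqP; rewrite addr_eq0 => /eqP ->.
  by rewrite h1 [dot (dir e0 x p) _]dotC.
move=> n n1 n2.
have hn v : dot n (dir v x p) = 0.
  rewrite (dir_coordE v cx Up); exact: dot_comb0.
(* l e0 and l e1 are mapped to an orthonormal tangent basis *)
pose l := (Num.sqrt (- dot (dir e0 x p) (dir e0 x p)))^-1.
have l2 : l ^+ 2 * dot (dir e0 x p) (dir e0 x p) = -1.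
  rewrite /l exprVn sqr_sqrtr ?oppr_ge0 ?ltW // invrN mulNr mulVf //.
  by rewrite lt_eqF.
have ln0 : l ^+ 2 != 0.
  apply/eqP => l0; move: l2; rewrite l0 mul0r => /eqP.
  by rewrite eq_sym oppr_eq0 oner_eq0.
clearbody l.
have el v q : U q -> dir (l *: v) x q = l *: dir v x q.
  by move=> Uq; have := dir_lin l 0 v 0 cx Uq; rewrite !scale0r !addr0.
have ho : orthonormal_tangent x p (l *: e0) (l *: e1).
  rewrite /orthonormal_tangent -!dirE !el // !dotZl !dotZr hF !mulr0.
  move: hE => /eqP; rewrite -eqr_oppLR => /eqP <-.
  by split=> //; rewrite mulrA -expr2 ?mulrN l2 ?opprK.
have e2 v : dir (l *: v) (dir (l *: v) x) p = (l ^+ 2) *: dir v (dir v x) p.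
  have := dir_lin l 0 v 0 (Cinf_dir (l *: v) cx) Up; rewrite !scale0r !addr0 => ->.
  rewrite expr2 -scalerA; congr (_ *: _).
  rewrite -(dir_scalec l v (dd v) Up); apply: (dir_eq oU) => // q; exact: el.
have := normal_minimal_dir (hm p Up) ho hn.
by rewrite !e2 !dotZl => h; apply/esym/(mulfI ln0)/h.
Qed.

End IsoMin.

(** * The associated families *)

Section Surfaces.
Variable R : realType.
Local Notation V := 'rV[R]_2.
Implicit Types (x : V -> 'rV[R]_4) (p q X Y : V) (U : set V).
Local Notation e0 := (delta_mx 0 0 : V).
Local Notation e1 := (delta_mx 0 1 : V).

Lemma iso_minimal_isothermal U x : iso_minimal U x -> isothermal (Surface U x).
Proof. by move=> [cx h] p /= Up; rewrite !duE !dvE; have [[]] := h p Up. Qed.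

Lemma row2_eq0 X : X 0 0 = 0 -> X 0 1 = 0 -> X = 0.
Proof. by move=> h0 h1; rewrite (row2E X) h0 h1 !scale0r addr0. Qed.

Lemma second_dir U x p X : open U -> Cinf U x -> U p ->
  dir X (dir X x) p = (X 0 0 * X 0 0) *: dir e0 (dir e0 x) p
   + (X 0 0 * X 0 1 + X 0 1 * X 0 0) *: dir e0 (dir e1 x) p
   + (X 0 1 * X 0 1) *: dir e1 (dir e1 x) p.
Proof. by move=> oU cx Up; rewrite !dirEE; exact: second_derivativeE oU cx Up. Qed.

Lemma second_formE x p X : second_form x p X X = dir X (dir X x) p *m normal_proj x p.
Proof. by rewrite dirEE. Qed.

(** By [hyperbolic_bases] the sums - S11 + S22 reduce to a multiple of x_vv -
    x_uu. *)
Lemma iso_minimal_minimal_timelike U x :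
  domain U -> iso_minimal U x -> minimal_timelike (Surface U x).
Proof.
move=> dU [cx h]; split; first split=> //.
- exact/smoothP.
- move=> p /= Up X; have [[hE hF E0] _] := h p Up.
  rewrite -dirE (dir_coordE X cx Up) => hX.
  have E1 : dot (dir e1 x p) (dir e1 x p) != 0.
    by rewrite -oppr_eq0 -hE lt_eqF.
  apply: row2_eq0.
    have := congr1 (fun a => dot a (dir e0 x p)) hX.
    rewrite /= dotDl !dotZl dot0l [dot (dir e1 x p) _]dotC hF mulr0 addr0 => /eqP.
    by rewrite mulf_eq0 (lt_eqF E0) orbF => /eqP.
  have := congr1 (fun a => dot a (dir e1 x p)) hX.
  rewrite /= dotDl !dotZl dot0l hF mulr0 add0r => /eqP.
  by rewrite mulf_eq0 (negPf E1) orbF => /eqP.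
- move=> p /= Up; have [hi _] := h p Up.
  have [[X hX] [Y hY]] := isothermal_signs hi.
  by split; [exists X|exists Y]; rewrite -dirE.
move=> p /= Up X1 X2 ho; have [[hE hF E0] hm] := h p Up.
have oU : open U by case: dU.
rewrite !second_formE (second_dir X1 oU cx Up) (second_dir X2 oU cx Up) -mulNmx -mulmxDl.
have [] := ho; rewrite -!dirE (dir_coordE X1 cx Up) (dir_coordE X2 cx Up) => k1 k2 k3.
have hE' : dot (dir e1 x p) (dir e1 x p) = - dot (dir e0 x p) (dir e0 x p).
  by rewrite hE opprK.
rewrite (orthonormal_second_alg (dir e0 (dir e1 x) p) E0 _ hE' hF hm k1 k2 k3) //.
by rewrite addNr mul0mx.
Qed.

Lemma minimal_iso_minimal (M : surface R) : minimal_timelike M -> isothermal M ->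
  iso_minimal (dom M) (pos M).
Proof.
move=> hM hi; have [[[oU _] /smoothP cx _ _] _] := hM.
apply: (iso_minimal_of_normal_minimal oU cx) => p Up.
  by have [] := hi p Up; rewrite !duE !dvE.
exact: minimal_normal_minimal hM Up.
Qed.

Lemma dot_iso_minimal U x p X Y : iso_minimal U x -> U p ->
  dot ('D_X x p) ('D_Y x p) =
    (X 0 0 * Y 0 0 - X 0 1 * Y 0 1) * dot (dir e0 x p) (dir e0 x p).
Proof.
move=> [cx h] Up; have [[hE hF _] _] := h p Up.
rewrite -!dirE (dir_coordE X cx Up) (dir_coordE Y cx Up) !dot_lin.
rewrite [dot (dir e1 x p) (dir e0 x p)]dotC hF hE; ring.
Qed.

(** The metric coefficient and the determinant in [iso_curvature]; for
    isothermal minimal surfaces equality of these data means that the identity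
    is a strong isometry. *)
Definition curvature_data x p : R * R :=
  (dot (dir e0 x p) (dir e0 x p),
   det4 (dir e0 x p) (dir e1 x p) (dir e0 (dir e0 x) p) (dir e0 (dir e1 x) p)).

Lemma iso_curvature_data x z p :
  curvature_data x p = curvature_data z p -> iso_curvature x p = iso_curvature z p.
Proof. by rewrite /iso_curvature => -[-> ->]. Qed.

Lemma derive_idfun (X p : V) : 'D_X (fun q : V => q) p = X.
Proof. exact: derive_id. Qed.

Lemma Cinf_id U : open U -> Cinf U (fun q : V => q).
Proof.
move=> oU [|k]; first by split.
split=> // v; apply: (Ck_eq oU (f := fun=> v)); last exact: Ck_cst.
by move=> q _; rewrite derive_idfun.
Qed.

Lemma strong_isometry_data U x z : domain U -> iso_minimal U x -> iso_minimal U z ->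
  (forall p, U p -> curvature_data x p = curvature_data z p) ->
  strongly_isometric (Surface U x) (Surface U z).
Proof.
move=> dU hx hz h; have oU : open U by case: dU.
exists id; split.
- exact: iso_minimal_minimal_timelike.
- exact: iso_minimal_minimal_timelike.
- have s : smooth U (id : V -> V) by apply/smoothP; exact: Cinf_id.
  by split=> //=; [rewrite image_id|exists id].
- move=> p Up X Y /=; rewrite !derive_idfun.
  by rewrite (dot_iso_minimal X Y hz Up) (dot_iso_minimal X Y hx Up); have [-> _] := h p Up.
move=> p Up /=.
rewrite (normal_curvature_iso_minimal oU hz Up) (normal_curvature_iso_minimal oU hx Up).
by apply/esym/iso_curvature_data/h.
Qed.

(** Both families are covered: k = 1, A = 1, (a, b) = (cosh theta, sinh theta)
    for the family of a surface, and k = -1, (a, b) = (0, 1) for its conjugate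
    surface composed with the anti-isometry A. *)
Lemma iso_minimal_linear U x z (A : 'M[R]_4) (k a b : R) : open U -> iso_minimal U x ->
  Cinf U z ->
  (forall p, U p -> dir e0 z p = (a *: dir e0 x p + b *: dir e1 x p) *m A) ->
  (forall p, U p -> dir e1 z p = (a *: dir e1 x p + b *: dir e0 x p) *m A) ->
  (forall v w, dot (v *m A) (w *m A) = k * dot v w) -> \det A = 1 ->
  k * (a ^+ 2 - b ^+ 2) = 1 -> (a ^+ 2 - b ^+ 2) ^+ 2 = 1 ->
  iso_minimal U z /\ forall p, U p -> curvature_data z p = curvature_data x p.
Proof.
move=> oU [cx h] cz z0 z1 hA dA kab ab2.
have dd v := Cinf_dir v cx.
have lin c d v w u p : U p -> dir u (fun q => (c *: dir v x q + d *: dir w x q) *m A) p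
    = (c *: dir u (dir v x) p + d *: dir u (dir w x) p) *m A.
  move=> Up.
  have c1 := Cinf_scale oU (Cinf_cst U c) (dd v).
  have c2 := Cinf_scale oU (Cinf_cst U d) (dd w).
  rewrite (dir_mulmxr A u (CinfD oU c1 c2) Up) (dirD u c1 c2 Up).
  by rewrite (dir_scalec c u (dd v) Up) (dir_scalec d u (dd w) Up).
have z00 p : U p -> dir e0 (dir e0 z) p =
    (a *: dir e0 (dir e0 x) p + b *: dir e0 (dir e1 x) p) *m A.
  by move=> Up; rewrite -(lin _ _ _ _ _ _ Up); exact: (dir_eq oU).
have z01 p : U p -> dir e0 (dir e1 z) p =
    (a *: dir e0 (dir e1 x) p + b *: dir e0 (dir e0 x) p) *m A.
  by move=> Up; rewrite -(lin _ _ _ _ _ _ Up); exact: (dir_eq oU).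
have z11 p : U p -> dir e1 (dir e1 z) p =
    (a *: dir e1 (dir e1 x) p + b *: dir e1 (dir e0 x) p) *m A.
  by move=> Up; rewrite -(lin _ _ _ _ _ _ Up); exact: (dir_eq oU).
have hd p : U p -> curvature_data z p = curvature_data x p.
  move=> Up; have [[hE hF _] _] := h p Up.
  rewrite /curvature_data z00 // z01 // z0 // z1 //; congr pair.
    rewrite hA !dot_lin [dot (dir e1 x p) (dir e0 x p)]dotC hF.
    have -> : dot (dir e1 x p) (dir e1 x p) = - dot (dir e0 x p) (dir e0 x p).
      by rewrite hE opprK.
    by rewrite -[RHS]mul1r -kab; ring.
  rewrite det4_mulmx dA mulr1.
  rewrite [a *: dir e1 x p + _]addrC [a *: dir e0 (dir e1 x) p + _]addrC det4_lin.
  by rewrite -[RHS]mul1r -ab2; ring.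
split=> //; split=> // p Up; have [[hE hF E0] hm] := h p Up.
have hE' : dot (dir e1 x p) (dir e1 x p) = - dot (dir e0 x p) (dir e0 x p).
  by rewrite hE opprK.
split.
  have [d1 _] := hd p Up; split; last by rewrite d1.
    rewrite z0 // z1 // !hA !dot_lin [dot (dir e1 x p) (dir e0 x p)]dotC hF hE'; ring.
  rewrite z0 // z1 // !hA !dot_lin [dot (dir e1 x p) (dir e0 x p)]dotC hF hE'; ring.
rewrite z00 // z11 // hm.
by have -> : dir e1 (dir e0 x) p = dir e0 (dir e1 x) p by refine (dirC oU e1 e0 cx Up).
Qed.

Lemma cosh2_sinh2 (t : R) : cosh t ^+ 2 - sinh t ^+ 2 = 1.
Proof.
have h : expR t * expR (- t) = 1 by rewrite -expRD subrr expR0.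
rewrite /cosh /sinh.
transitivity (expR t * expR (- t)); last exact: h.
by field.
Qed.

Lemma harmonic_conjugateP (M : surface R) y : harmonic_conjugate M y ->
  Cinf (dom M) y /\ forall p, dom M p ->
    dir e0 y p = dir e1 (pos M) p /\ dir e1 y p = dir e0 (pos M) p.
Proof.
move=> [/smoothP cy h]; split=> // p Up; have [h1 h2] := h p Up.
by rewrite !duE !dvE in h1 h2.
Qed.

Lemma associated_iso_minimal U x y theta : open U -> iso_minimal U x ->
  harmonic_conjugate (Surface U x) y ->
  let z := fun t => cosh theta *: x t + sinh theta *: y t in
  [/\ iso_minimal U z, (forall p, U p -> curvature_data z p = curvature_data x p),
   (forall p, U p -> dir e0 z p = cosh theta *: dir e0 x p + sinh theta *: dir e1 x p) &
   (forall p, U p -> dir e1 z p = cosh theta *: dir e1 x p + sinh theta *: dir e0 x p)].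
Proof.
move=> oU hx /harmonic_conjugateP[cy hy] z; have [cx h] := hx.
have c1 := Cinf_scale oU (Cinf_cst U (cosh theta)) cx.
have c2 := Cinf_scale oU (Cinf_cst U (sinh theta)) cy.
have dz v p : U p -> dir v z p = cosh theta *: dir v x p + sinh theta *: dir v y p.
  move=> Up; rewrite (dirD v c1 c2 Up).
  by rewrite (dir_scalec _ v cx Up) (dir_scalec _ v cy Up).
have d0 p : U p -> dir e0 z p = cosh theta *: dir e0 x p + sinh theta *: dir e1 x p.
  by move=> Up; rewrite dz //; have [-> _] := hy p Up.
have d1 p : U p -> dir e1 z p = cosh theta *: dir e1 x p + sinh theta *: dir e0 x p.
  by move=> Up; rewrite dz //; have [_ ->] := hy p Up.
have m0 p : U p -> dir e0 z p = (cosh theta *: dir e0 x p + sinh theta *: dir e1 x p) *m 1%:M.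
  by move=> Up; rewrite mulmx1 d0.
have m1 p : U p -> dir e1 z p = (cosh theta *: dir e1 x p + sinh theta *: dir e0 x p) *m 1%:M.
  by move=> Up; rewrite mulmx1 d1.
have hA (v w : 'rV[R]_4) : dot (v *m 1%:M) (w *m 1%:M) = 1 * dot v w.
  by rewrite !mulmx1 mul1r.
have k1 : 1 * (cosh theta ^+ 2 - sinh theta ^+ 2) = 1 by rewrite mul1r cosh2_sinh2.
have k2 : (cosh theta ^+ 2 - sinh theta ^+ 2) ^+ 2 = 1 by rewrite cosh2_sinh2 expr1n.
have cz : Cinf U z := CinfD oU c1 c2.
have [hz hd] := iso_minimal_linear oU hx cz m0 m1 hA (det1 _ _) k1 k2.
by split.
Qed.

Lemma conjugate_iso_minimal U x y (A : 'M[R]_4) b : open U -> iso_minimal U x ->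
  harmonic_conjugate (Surface U x) y -> anti_isometry A -> \det A = 1 ->
  let z := fun t => y t *m A + b in
  [/\ iso_minimal U z, (forall p, U p -> curvature_data z p = curvature_data x p),
   (forall p, U p -> dir e0 z p = dir e1 x p *m A) &
   (forall p, U p -> dir e1 z p = dir e0 x p *m A)].
Proof.
move=> oU hx /harmonic_conjugateP[cy hy] hA dA z; have [cx h] := hx.
have c1 := Cinf_mulmx oU cy (Cinf_cst U A).
have dz v p : U p -> dir v z p = dir v y p *m A.
  move=> Up; rewrite (dirD v c1 (Cinf_cst U b) Up).
  have -> : dir v (fun=> b) p = 0 by apply: (dir_cst oU (c := b)) Up => q _.
  by rewrite addr0 (dir_mulmxr A v cy Up).
have d0 p : U p -> dir e0 z p = dir e1 x p *m A.
  by move=> Up; rewrite dz //; have [-> _] := hy p Up.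
have d1 p : U p -> dir e1 z p = dir e0 x p *m A.
  by move=> Up; rewrite dz //; have [_ ->] := hy p Up.
have m0 p : U p -> dir e0 z p = (0 *: dir e0 x p + 1 *: dir e1 x p) *m A.
  by move=> Up; rewrite scale0r add0r scale1r d0.
have m1 p : U p -> dir e1 z p = (0 *: dir e1 x p + 1 *: dir e0 x p) *m A.
  by move=> Up; rewrite scale0r add0r scale1r d1.
have hA' v w : dot (v *m A) (w *m A) = -1 * dot v w by rewrite hA mulN1r.
have k1 : -1 * (0 ^+ 2 - 1 ^+ 2) = 1 :> R by ring.
have k2 : (0 ^+ 2 - 1 ^+ 2) ^+ 2 = 1 :> R by ring.
have cz : Cinf U z := CinfD oU c1 (Cinf_cst U b).
have [hz hd] := iso_minimal_linear oU hx cz m0 m1 hA' dA k1 k2.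
by split.
Qed.

Lemma jmulK (t : V) : jmul (jmul t) = t.
Proof. by apply/rowP => i; rewrite !mxE rev_ordK. Qed.

(** The two exchanges of parameters cancel. *)
Lemma anti_conjugateE (M : surface R) y A b :
  anti_surface (conjugate_surface M y) A b =
  Surface (dom M) (fun t => y t *m A + b).
Proof.
rewrite /anti_surface /conjugate_surface /=; congr Surface.
  apply/seteqP; split=> [t [s [r rM <-] <-]|t tM]; first by rewrite jmulK.
  by exists (jmul t); [exists t|rewrite jmulK].
by apply/funext => t; rewrite jmulK.
Qed.

(** All these surfaces have the same [curvature_data]. *)
Theorem associated_strongly_isometric (M : surface R) y :
  minimal_timelike M -> isothermal M -> harmonic_conjugate M y ->
  (forall theta : R, strongly_isometric (associated M y theta) M) /\
  (forall (A : 'M[R]_4) (b : 'rV[R]_4) (y' : 'rV[R]_2 -> 'rV[R]_4),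
     anti_isometry A -> \det A = 1 ->
     let Ma := anti_surface (conjugate_surface M y) A b in
     harmonic_conjugate Ma y' ->
     forall theta : R, strongly_isometric (associated Ma y' theta) M).
Proof.
case: M => U x hM hi hy; have [[dU _ _ _] _] := hM; have oU : open U by case: dU.
have hx := minimal_iso_minimal hM hi; rewrite /= in dU hx.
split=> [theta|A b y' hA dA].
  have [hz hd _ _] := associated_iso_minimal theta oU hx hy.
  exact: strong_isometry_data.
rewrite anti_conjugateE /= => hy' theta.
have [hz hd _ _] := conjugate_iso_minimal b oU hx hy hA dA.
have [hw hd' _ _] := associated_iso_minimal theta oU hz hy'.
apply: strong_isometry_data => // p Up.
by rewrite hd' // hd.
Qed.

End Surfaces.

(** * Rigidity *)

Section Rigidity.
Variable R : realType.
Local Notation V := 'rV[R]_2.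
Implicit Types (x : V -> 'rV[R]_4) (p q : V) (U : set V).

(** Proper isometries preserve the determinants that define the vector
    product. *)
Lemma cross_isometry (A : 'M[R]_4) (a b c : 'rV[R]_4) : proper_isometry A ->
  cross a b c *m A = cross (a *m A) (b *m A) (c *m A).
Proof.
move=> [iso dA].
have uA : A \in unitmx by rewrite unitmxE dA unitr1.
apply/subr0_eq/dot_nondeg => w; rewrite -[w](mulmxKV uA) dotDl dotNl iso !dot_cross.
by rewrite det4_mulmx dA mulr1 subrr.
Qed.

Lemma det4_swap2 (a b c d : 'rV[R]_4) : det4 b a d c = det4 a b c d.
Proof.
have := det4_lin 0 1 1 0 0 1 1 0 a b c d.
rewrite !scale0r !scale1r !add0r !addr0 => ->; ring.
Qed.

(** The isotropic fields P and Q of a minimal surface; a and b are the two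
    isotropic directions, and b annihilates P while a annihilates Q. The
    definition is symmetric under exchanging (a, P) and (b, Q). *)
Definition null_data U (a b : V) (P Q : V -> 'rV[R]_4) : Prop :=
  [/\ Cinf U P, Cinf U Q, (forall q, U q -> dir b P q = 0),
      (forall q, U q -> dir a Q q = 0) &
      forall q, U q -> [/\ dot (P q) (P q) = 0, dot (Q q) (Q q) = 0
                         & dot (P q) (Q q) != 0]].

Lemma null_data_sym U a b P Q : null_data U a b P Q -> null_data U b a Q P.
Proof.
move=> [cP cQ dP dQ h]; split=> // q Uq; have [h1 h2 h3] := h q Uq.
by split=> //; rewrite dotC.
Qed.

(** The invariants that determine the surface up to proper motions. *)
Definition same_null U (a b : V) (P Q P1 Q1 : V -> 'rV[R]_4) : Prop :=
  forall q, U q ->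
   [/\ dot (P q) (Q q) = dot (P1 q) (Q1 q),
       dot (dir a P q) (dir a P q) = dot (dir a P1 q) (dir a P1 q),
       dot (dir b Q q) (dir b Q q) = dot (dir b Q1 q) (dir b Q1 q) &
       det4 (P q) (Q q) (dir a P q) (dir b Q q) =
       det4 (P1 q) (Q1 q) (dir a P1 q) (dir b Q1 q)].

Lemma same_null_sym U a b P Q P1 Q1 : same_null U a b P Q P1 Q1 ->
  same_null U b a Q P Q1 P1.
Proof.
move=> h q Uq; have [h1 h2 h3 h4] := h q Uq; split=> //.
  by rewrite dotC h1 dotC.
by rewrite det4_swap2 h4 det4_swap2.
Qed.

Section NullDots.
Variables (U : set V) (a b : V) (P Q : V -> 'rV[R]_4).
Hypothesis oU : open U.
Hypothesis hPQ : null_data U a b P Q.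
Local Notation P' := (dir a P).
Local Notation Q' := (dir b Q).

Lemma dir_cross_null p : U p -> dir b P' p = 0.
Proof.
move=> Up; have [cP _ dP _ _] := hPQ.
have -> : dir b P' p = dir a (dir b P) p by refine (dirC oU b a cP Up).
exact: (dir_cst oU (c := 0)) dP Up.
Qed.

(** All scalar products among P, Q, P', Q' except P' ^ 2 and Q' ^ 2 are
    derivatives of P.Q. *)
Lemma null_dots p : U p ->
  [/\ dot (P p) (P' p) = 0, dot (Q p) (P' p) = dir a (fun q => dot (P q) (Q q)) p,
      dot (Q' p) (P p) = dir b (fun q => dot (P q) (Q q)) p,
      dot (Q' p) (Q p) = 0 &
      dot (Q' p) (P' p) = dir b (fun q => dot (Q q) (P' q)) p].
Proof.
move=> Up; have [cP cQ dP dQ h] := hPQ.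
have hP q : U q -> dot (P q) (P q) = 0 by move=> /h[].
have hQ q : U q -> dot (Q q) (Q q) = 0 by move=> /h[].
split.
- have := dir_dot_cst oU a cP cP hP Up; rewrite [dot (dir a P p) _]dotC.
  exact: double_eq0.
- by rewrite (dir_dot a cP cQ Up) dQ // dot0r addr0 dotC.
- by rewrite (dir_dot b cP cQ Up) dP // dot0l add0r dotC.
- have := dir_dot_cst oU b cQ cQ hQ Up; rewrite [dot (Q p) (dir b Q p)]dotC.
  exact: double_eq0.
- rewrite (dir_dot b cQ (Cinf_dir a cP) Up) dir_cross_null //.
  by rewrite dot0r addr0.
Qed.

Lemma null_cross2 p : U p ->
  dot (cross (P p) (Q p) (P' p)) (cross (P p) (Q p) (P' p)) =
  - dot (P p) (Q p) ^+ 2 * dot (P' p) (P' p).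
Proof.
move=> Up; have [h1 _ _ _ _] := null_dots Up.
have [_ _ _ _ h] := hPQ; have [k1 k2 _] := h p Up.
by rewrite dot_cross_cross h1 k1 k2; ring.
Qed.

End NullDots.

Section Half.
Variables (U : set V) (a b : V) (P Q P1 Q1 : V -> 'rV[R]_4).
Hypothesis oU : open U.
Hypothesis hPQ : null_data U a b P Q.
Hypothesis hPQ1 : null_data U a b P1 Q1.
Hypothesis hs : same_null U a b P Q P1 Q1.
Hypothesis hA : forall q, U q -> dot (dir a P q) (dir a P q) != 0.

Let C q := cross (P q) (Q q) (dir a P q).
Let C1 q := cross (P1 q) (Q1 q) (dir a P1 q).

Let cP : Cinf U P. Proof. by case: hPQ. Qed.
Let cQ : Cinf U Q. Proof. by case: hPQ. Qed.
Let cP1 : Cinf U P1. Proof. by case: hPQ1. Qed.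
Let cQ1 : Cinf U Q1. Proof. by case: hPQ1. Qed.
Let cC : Cinf U C. Proof. exact: Cinf_cross (Cinf_dir a cP). Qed.
Let cC1 : Cinf U C1. Proof. exact: Cinf_cross (Cinf_dir a cP1). Qed.

Let G_eq q : U q -> dot (P q) (Q q) = dot (P1 q) (Q1 q).
Proof. by move=> /hs[]. Qed.
Let A_eq q : U q -> dot (dir a P q) (dir a P q) = dot (dir a P1 q) (dir a P1 q).
Proof. by move=> /hs[]. Qed.
Let D_eq q : U q -> det4 (P q) (Q q) (dir a P q) (dir b Q q) =
       det4 (P1 q) (Q1 q) (dir a P1 q) (dir b Q1 q).
Proof. by move=> /hs[]. Qed.
Let g_eq q : U q -> dot (Q q) (dir a P q) = dot (Q1 q) (dir a P1 q).
Proof.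
move=> Uq; have [_ -> _ _ _] := null_dots oU hPQ Uq.
have [_ -> _ _ _] := null_dots oU hPQ1 Uq; refine (dir_eq oU a G_eq Uq).
Qed.
Let CC_eq q : U q -> dot (C q) (C q) = dot (C1 q) (C1 q).
Proof.
by move=> Uq; rewrite (null_cross2 oU hPQ Uq) (null_cross2 oU hPQ1 Uq) G_eq // A_eq.
Qed.
Let CC0 q : U q -> dot (C q) (C q) != 0.
Proof.
move=> Uq; rewrite (null_cross2 oU hPQ Uq) mulf_neq0 ?hA // oppr_eq0 expf_neq0 //.
by have [_ _ _ _ h] := hPQ; have [] := h q Uq.
Qed.

Let F4 q := det4 (P q) (Q q) (dir a P q) (C q).
Let D0 q : U q -> F4 q != 0. Proof. by move=> Uq; rewrite /F4 -dot_cross CC0. Qed.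
Let DD q : U q -> det4 (P1 q) (Q1 q) (dir a P1 q) (C1 q) = F4 q.
Proof. by move=> Uq; rewrite /F4 -!dot_cross; apply/esym/CC_eq. Qed.

Let sd q w w' := same_dots (P q) (Q q) (dir a P q) (C q) w
  (P1 q) (Q1 q) (dir a P1 q) (C1 q) w'.

Let CP q : dot (C q) (P q) = 0. Proof. by rewrite dot_cross det4_rep1. Qed.
Let CQ q : dot (C q) (Q q) = 0. Proof. by rewrite dot_cross det4_rep2. Qed.
Let CP' q : dot (C q) (dir a P q) = 0. Proof. by rewrite dot_cross det4_rep3. Qed.
Let CP1 q : dot (C1 q) (P1 q) = 0. Proof. by rewrite dot_cross det4_rep1. Qed.
Let CQ1 q : dot (C1 q) (Q1 q) = 0. Proof. by rewrite dot_cross det4_rep2. Qed.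
Let CP1' q : dot (C1 q) (dir a P1 q) = 0. Proof. by rewrite dot_cross det4_rep3. Qed.

Let sdP q : U q -> sd q (P q) (P1 q).
Proof.
move=> Uq; have [h1 _ _ _ _] := null_dots oU hPQ Uq.
have [h2 _ _ _ _] := null_dots oU hPQ1 Uq.
have [_ _ _ _ h] := hPQ; have [k1 _ _] := h q Uq.
have [_ _ _ _ h'] := hPQ1; have [k1' _ _] := h' q Uq.
split; first by rewrite k1 k1'.
- exact: G_eq.
- by rewrite h1 h2.
by rewrite ![dot _ (cross _ _ _)]dotC CP CP1.
Qed.

Let sdQ q : U q -> sd q (Q q) (Q1 q).
Proof.
move=> Uq.
have [_ _ _ _ h] := hPQ; have [_ k1 _] := h q Uq.
have [_ _ _ _ h'] := hPQ1; have [_ k1' _] := h' q Uq.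
split; first by rewrite dotC G_eq // dotC.
- by rewrite k1 k1'.
- exact: g_eq.
by rewrite ![dot _ (cross _ _ _)]dotC CQ CQ1.
Qed.

Let sdP' q : U q -> sd q (dir a P q) (dir a P1 q).
Proof.
move=> Uq; have [h1 _ _ _ _] := null_dots oU hPQ Uq.
have [h2 _ _ _ _] := null_dots oU hPQ1 Uq.
split; first by rewrite ![dot (dir _ _ _) _]dotC h1 h2.
- by rewrite dotC g_eq // dotC.
- exact: A_eq.
by rewrite ![dot _ (cross _ _ _)]dotC CP' CP1'.
Qed.

Let sdC q : U q -> sd q (C q) (C1 q).
Proof.
move=> Uq; split; rewrite ?CP ?CP1 ?CQ ?CQ1 ?CP' ?CP1' //.
exact: CC_eq.
Qed.

Let sdQ' q : U q -> sd q (dir b Q q) (dir b Q1 q).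
Proof.
move=> Uq; have [_ _ h1 h2 h3] := null_dots oU hPQ Uq.
have [_ _ k1 k2 k3] := null_dots oU hPQ1 Uq.
split.
- by rewrite h1 k1; refine (dir_eq oU b G_eq Uq).
- by rewrite h2 k2.
- by rewrite h3 k3; refine (dir_eq oU b g_eq Uq).
rewrite dotC [RHS]dotC !dot_cross; exact: D_eq.
Qed.

Let sdC' q : U q -> sd q (dir b C q) (dir b C1 q).
Proof.
move=> Uq.
have e (f g : V -> 'rV[R]_4) : Cinf U f -> Cinf U g -> (forall q, dot (f q) (g q) = 0) ->
    dot (dir b f q) (g q) = - dot (f q) (dir b g q).
  move=> cf cg h; have /eqP := dir_dot_cst oU b cf cg (fun q _ => h q) Uq.
  by rewrite addr_eq0 => /eqP.
have [_ _ dP _ _] := hPQ; have [_ _ dP1 _ _] := hPQ1.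
split.
- by rewrite !e // dP // dP1 // !dot0r.
- by rewrite !e // !dot_cross D_eq.
- have cP' := Cinf_dir a cP; have cP1' := Cinf_dir a cP1.
  by rewrite !e // (dir_cross_null oU hPQ) // (dir_cross_null oU hPQ1) // !dot0r.
apply: (mulfI (_ : 2 != 0 :> R)); first by rewrite pnatr_eq0.
transitivity (dir b (fun q => dot (C q) (C q)) q).
  by rewrite (dir_dot b cC cC Uq) [dot (C q) _]dotC; ring.
rewrite (dir_eq oU b CC_eq Uq).
by rewrite (dir_dot b cC1 cC1 Uq) [dot (C1 q) _]dotC; ring.
Qed.

Let H q := match_mx (P q) (Q q) (dir a P q) (C q) (P1 q) (Q1 q) (dir a P1 q) (C1 q).

Let HP q w w' : U q -> sd q w w' -> w *m H q = w'.
Proof.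
move=> Uq; exact: match_mxP (D0 Uq) (DD Uq) (sdP Uq) (sdQ Uq) (sdP' Uq) (sdC Uq) _ _.
Qed.

Let cH : Cinf U H.
Proof.
apply: Cinf_mulmx => //; last exact: Cinf_rows4 (Cinf_dir a cP1) cC1.
by apply: Cinf_invmx => //; exact: Cinf_rows4 (Cinf_dir a cP) cC.
Qed.

Lemma rows4_mul_eq0 (u v w z : 'rV[R]_4) (M : 'M[R]_4) : det4 u v w z != 0 ->
  u *m M = 0 -> v *m M = 0 -> w *m M = 0 -> z *m M = 0 -> M = 0.
Proof.
move=> d0 hu hv hw hz.
have uF : rows4 u v w z \in unitmx by rewrite unitmxE unitfE.
rewrite -[M](mulKmx uF) (_ : rows4 u v w z *m M = 0) ?mulmx0 //.
apply/row_matrixP => i; rewrite row_mul rowK row0.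
by case: i => -[|[|[|[|//]]]].
Qed.

(** H maps the frame (P, Q, P', C) to the corresponding frame, C being the
    vector product. Derivatives along b of the frame vectors, and Q' itself,
    have the same scalar products with the frame for both surfaces, so H maps
    them to their counterparts; differentiating f H = f1 for each frame vector
    f leaves f (D_b H) = 0. *)
Lemma half_rigidity : exists H : V -> 'M[R]_4, Cinf U H /\ forall q, U q ->
  [/\ proper_isometry (H q), dir b H q = 0,
   [/\ P q *m H q = P1 q, Q q *m H q = Q1 q, dir a P q *m H q = dir a P1 q
     & dir b Q q *m H q = dir b Q1 q] &
   forall M, proper_isometry M -> P q *m M = P1 q -> Q q *m M = Q1 q ->
     dir a P q *m M = dir a P1 q -> M = H q].
Proof.
exists H; split=> // q Uq.
have iso : proper_isometry (H q).
  exact: match_mx_isometry (D0 Uq) (DD Uq) (sdP Uq) (sdQ Uq) (sdP' Uq) (sdC Uq).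
split=> //.
(* differentiate f H = f1 along b *)
- have key (f f1 : V -> 'rV[R]_4) : Cinf U f -> Cinf U f1 ->
      (forall q, U q -> sd q (f q) (f1 q)) -> sd q (dir b f q) (dir b f1 q) ->
      f q *m dir b H q = 0.
    move=> cf cf1 h h'.
    have e1 := dir_mulmx b cf cH Uq.
    have e2 : dir b (fun q => f q *m H q) q = dir b f1 q.
      by apply: (dir_eq oU b _ Uq) => z Uz; exact: HP (h z Uz).
    move: e1; rewrite e2 (HP Uq h') => /esym/eqP.
    by rewrite -subr_eq0 addrC addKr => /eqP.
  have [_ _ dP _ _] := hPQ; have [_ _ dP1 _ _] := hPQ1.
  have s0 : sd q 0 0 by split; rewrite !dot0l.
  apply: (rows4_mul_eq0 (D0 Uq)).
  + by apply: key cP cP1 sdP _; rewrite dP // dP1.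
  + exact: key cQ cQ1 sdQ (sdQ' Uq).
  + apply: key (Cinf_dir a cP) (Cinf_dir a cP1) sdP' _.
    by rewrite (dir_cross_null oU hPQ) // (dir_cross_null oU hPQ1).
  + exact: key cC cC1 sdC (sdC' Uq).
- split; [exact: HP (sdP Uq)|exact: HP (sdQ Uq)|exact: HP (sdP' Uq)|].
  exact: HP (sdQ' Uq).
move=> M isoM h1 h2 h3; apply/subr0_eq/(rows4_mul_eq0 (D0 Uq)); rewrite mulmxBr.
- by rewrite h1 (HP Uq (sdP Uq)) subrr.
- by rewrite h2 (HP Uq (sdQ Uq)) subrr.
- by rewrite h3 (HP Uq (sdP' Uq)) subrr.
by rewrite (HP Uq (sdC Uq)) cross_isometry // h1 h2 h3 subrr.
Qed.

End Half.

End Rigidity.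

(** * Congruence of isothermal minimal surfaces *)

Section Congruence.
Variable R : realType.
Local Notation V := 'rV[R]_2.
Implicit Types (x : V -> 'rV[R]_4) (p q : V) (U : set V).
Local Notation e0 := (delta_mx 0 0 : V).
Local Notation e1 := (delta_mx 0 1 : V).
Local Notation ep := (1 *: e0 + 1 *: e1).
Local Notation em := (1 *: e0 + (-1) *: e1).

Lemma dir_ep (W : normedModType R) (f : V -> W) U p : Cinf U f -> U p ->
  dir ep f p = dir e0 f p + dir e1 f p.
Proof. by move=> cf Up; rewrite (dir_lin _ _ _ _ cf Up) !scale1r. Qed.

Lemma dir_em (W : normedModType R) (f : V -> W) U p : Cinf U f -> U p ->
  dir em f p = dir e0 f p - dir e1 f p.
Proof. by move=> cf Up; rewrite (dir_lin _ _ _ _ cf Up) scale1r scaleN1r. Qed.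

(** The two isotropic directions span the parameter plane. *)
Lemma dir0_of_null (W : normedModType R) (f : V -> W) U p : Cinf U f -> U p ->
  dir ep f p = 0 -> dir em f p = 0 -> forall v, dir v f p = 0.
Proof.
move=> cf Up; rewrite (dir_ep cf Up) (dir_em cf Up) => h1 h2 v.
have h0 : dir e0 f p = 0.
  have : 2 *: dir e0 f p = 0.
    rewrite -[RHS](addr0 0) -{1}h1 -h2 addrACA subrr addr0.
    by rewrite -[in RHS](scale1r (dir e0 f p)) -scalerDl.
  by move/eqP; rewrite scaler_eq0 pnatr_eq0 /= => /eqP.
have h0' : dir e1 f p = 0 by rewrite -h1 h0 add0r.
rewrite {1}(row2E v) (dir_lin _ _ _ _ cf Up) h0 h0' !scaler0 addr0 //.
Qed.

Lemma ball_dir0_cst p0 (r : R) m n (f : V -> 'M[R]_(m, n)) : 0 < r ->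
  Cinf (ball p0 r) f ->
  (forall q, ball p0 r q -> forall v, dir v f q = 0) ->
  forall q, ball p0 r q -> f q = f p0.
Proof.
move=> r0 cf h; apply: ball_derive0_cst => //.
  by move=> q bq; exact: Cinf_diff cf bq.
by move=> q v bq; rewrite -dirE; exact: h.
Qed.

Lemma ball_dir0_cst_scalar p0 (r : R) (f : V -> R) : 0 < r ->
  Cinf (ball p0 r) f ->
  (forall q, ball p0 r q -> forall v, dir v f q = 0) ->
  forall q, ball p0 r q -> f q = f p0.
Proof.
move=> r0 cf h q bq; rewrite -[in LHS](subrKC p0 q).
have bt (t : R) : 0 <= t <= 1 -> ball p0 r (p0 + t *: (q - p0)).
  by move=> t01; apply: ball_segment => //; exact: ballxx.
apply: derive0_line_cst => t /bt bt'; first exact: Cinf_diff cf bt'.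
by rewrite -dirE; exact: h.
Qed.

(** By [half_rigidity] the matching isometry H is constant along one isotropic
    direction. Exchanging P and Q gives a matching isometry constant along the
    other one, and by uniqueness it is the same H. *)
Lemma rigidity p0 (r : R) (P Q P1 Q1 : V -> 'rV[R]_4) : 0 < r ->
  let U := ball p0 r in
  null_data U ep em P Q -> null_data U ep em P1 Q1 ->
  same_null U ep em P Q P1 Q1 ->
  (forall q, U q -> dot (dir ep P q) (dir ep P q) != 0) ->
  (forall q, U q -> dot (dir em Q q) (dir em Q q) != 0) ->
  exists2 M, proper_isometry M &
    forall q, U q -> P q *m M = P1 q /\ Q q *m M = Q1 q.
Proof.
move=> r0 U n0 n1 hs hA hB; have oU : open U by exact: ball_open.
have [H [cH hH]] := half_rigidity oU n0 n1 hs hA.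
have [H' [cH' hH']] := half_rigidity oU (null_data_sym n0) (null_data_sym n1)
  (same_null_sym hs) hB.
have HH q : U q -> H q = H' q.
  move=> Uq; have [iso _ [h1 h2 h3 h4] _] := hH q Uq.
  by have [_ _ _ u] := hH' q Uq; exact: u.
have Hc q : U q -> H q = H p0.
  apply: (ball_dir0_cst r0 cH) => z Uz; apply: (dir0_of_null cH Uz).
    by rewrite (dir_eq oU ep HH Uz); have [] := hH' z Uz.
  by have [] := hH z Uz.
have U0 : U p0 by exact: ballxx.
exists (H p0); first by have [] := hH p0 U0.
by move=> q Uq; rewrite -(Hc q Uq); have [_ _ []] := hH q Uq.
Qed.

Definition nullP x q := dir e0 x q + dir e1 x q.
Definition nullQ x q := dir e0 x q - dir e1 x q.

Section Null.
Variables (U : set V) (x : V -> 'rV[R]_4).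
Hypothesis oU : open U.
Hypothesis hx : iso_minimal U x.

Let cx : Cinf U x. Proof. by case: hx. Qed.

Lemma Cinf_nullP : Cinf U (nullP x).
Proof. by refine (CinfD oU (Cinf_dir e0 cx) (Cinf_dir e1 cx)). Qed.
Lemma Cinf_nullQ : Cinf U (nullQ x).
Proof. by refine (CinfB oU (Cinf_dir e0 cx) (Cinf_dir e1 cx)). Qed.

Let dirP v q : U q -> dir v (nullP x) q = dir v (dir e0 x) q + dir v (dir e1 x) q.
Proof. by move=> Uq; refine (dirD v (Cinf_dir e0 cx) (Cinf_dir e1 cx) Uq). Qed.
Let dirQ v q : U q -> dir v (nullQ x) q = dir v (dir e0 x) q - dir v (dir e1 x) q.
Proof. by move=> Uq; refine (dirB v (Cinf_dir e0 cx) (Cinf_dir e1 cx) Uq). Qed.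

Let sw q : U q -> dir e1 (dir e0 x) q = dir e0 (dir e1 x) q.
Proof. by move=> Uq; refine (dirC oU e1 e0 cx Uq). Qed.

Lemma dir_nullP q : U q ->
  dir ep (nullP x) q = 2 *: dir e0 (dir e0 x) q + 2 *: dir e0 (dir e1 x) q.
Proof.
move=> Uq; rewrite (dir_ep Cinf_nullP Uq) !dirP // sw //.
have [_ h] := hx; have [_ ->] := h q Uq.
set s := dir e0 (dir e0 x) q; set t := dir e0 (dir e1 x) q.
by apply/rowP => i; rewrite !mxE; ring.
Qed.

Lemma dir_nullQ q : U q ->
  dir em (nullQ x) q = 2 *: dir e0 (dir e0 x) q + (-2) *: dir e0 (dir e1 x) q.
Proof.
move=> Uq; rewrite (dir_em Cinf_nullQ Uq) !dirQ // sw //.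
have [_ h] := hx; have [_ ->] := h q Uq.
set s := dir e0 (dir e0 x) q; set t := dir e0 (dir e1 x) q.
by apply/rowP => i; rewrite !mxE; ring.
Qed.

Lemma nullP_em q : U q -> dir em (nullP x) q = 0.
Proof.
move=> Uq; rewrite (dir_em Cinf_nullP Uq) !dirP // sw //.
have [_ h] := hx; have [_ ->] := h q Uq.
by rewrite [X in _ - X]addrC subrr.
Qed.

Lemma nullQ_ep q : U q -> dir ep (nullQ x) q = 0.
Proof.
move=> Uq; rewrite (dir_ep Cinf_nullQ Uq) !dirQ // sw //.
have [_ h] := hx; have [_ ->] := h q Uq.
by rewrite addrA subrK subrr.
Qed.

Lemma null_pair_dots q : U q ->
  [/\ dot (nullP x q) (nullP x q) = 0, dot (nullQ x q) (nullQ x q) = 0 &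
      dot (nullP x q) (nullQ x q) = 2 * dot (dir e0 x q) (dir e0 x q)].
Proof.
move=> Uq; have [_ h] := hx; have [[hE hF _] _] := h q Uq.
have hE' : dot (dir e1 x q) (dir e1 x q) = - dot (dir e0 x q) (dir e0 x q).
  by rewrite hE opprK.
rewrite /nullP /nullQ !dot_lin [dot (dir e1 x q) (dir e0 x q)]dotC hF hE'.
by split; ring.
Qed.

Lemma null_data_iso_minimal : null_data U ep em (nullP x) (nullQ x).
Proof.
split; [exact: Cinf_nullP|exact: Cinf_nullQ|exact: nullP_em|exact: nullQ_ep|].
move=> q Uq; have [h1 h2 ->] := null_pair_dots Uq; split=> //.
have [_ h] := hx; have [[_ _ E0] _] := h q Uq.
by rewrite mulf_neq0 ?pnatr_eq0 // lt_eqF.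
Qed.

Lemma null_det q : U q ->
  det4 (nullP x q) (nullQ x q) (dir ep (nullP x) q) (dir em (nullQ x) q) =
  16 * det4 (dir e0 x q) (dir e1 x q) (dir e0 (dir e0 x) q) (dir e0 (dir e1 x) q).
Proof.
move=> Uq; rewrite dir_nullP // dir_nullQ // /nullP /nullQ.
have := det4_lin 1 1 1 (-1) 2 2 2 (-2) (dir e0 x q) (dir e1 x q)
  (dir e0 (dir e0 x) q) (dir e0 (dir e1 x) q).
by rewrite !scale1r scaleN1r => ->; ring.
Qed.

(** The vector P' is orthogonal to the isotropic tangent vector P, so its
    square equals that of its normal part. *)
Definition normal_sqP x q := dot (dir ep (nullP x) q) (dir ep (nullP x) q).
Definition normal_sqQ x q := dot (dir em (nullQ x) q) (dir em (nullQ x) q).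

Lemma Cinf_normal_sqP : Cinf U (normal_sqP x).
Proof. by refine (Cinf_dot oU (Cinf_dir ep Cinf_nullP) (Cinf_dir ep Cinf_nullP)). Qed.
Lemma Cinf_normal_sqQ : Cinf U (normal_sqQ x).
Proof. by refine (Cinf_dot oU (Cinf_dir em Cinf_nullQ) (Cinf_dir em Cinf_nullQ)). Qed.

Lemma normal_sqP_em q : U q -> dir em (normal_sqP x) q = 0.
Proof.
move=> Uq; have c := Cinf_dir ep Cinf_nullP.
rewrite [LHS](dir_dot em c c Uq).
by rewrite (dir_cross_null oU null_data_iso_minimal Uq) dot0l dot0r addr0.
Qed.

Lemma normal_sqQ_ep q : U q -> dir ep (normal_sqQ x) q = 0.
Proof.
move=> Uq; have c := Cinf_dir em Cinf_nullQ.
rewrite [LHS](dir_dot ep c c Uq).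
by rewrite (dir_cross_null oU (null_data_sym null_data_iso_minimal) Uq) dot0l dot0r addr0.
Qed.

(** The Gram determinant of (P, Q, P', Q') involves P' ^ 2 and Q' ^ 2 only
    through their product. *)
Lemma gram_null_alg (P Q P' Q' : 'rV[R]_4) :
  dot P P = 0 -> dot Q Q = 0 -> dot P P' = 0 -> dot Q' Q = 0 ->
  det4 P Q P' Q' ^+ 2 = - dot P Q ^+ 2 * (dot P' P' * dot Q' Q')
    + (dot P Q * dot Q' P' - dot Q P' * dot Q' P) ^+ 2.
Proof.
move=> h1 h2 h3 h4; rewrite expr2 det4_gram.
rewrite (det4_fun (fun i j => dot [:: P; Q; P'; Q']`_i [:: P; Q; P'; Q']`_j)) /=.
rewrite (dotC Q P) (dotC P' P) (dotC P' Q) (dotC P Q') (dotC Q Q') (dotC P' Q').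
rewrite h1 h2 h3 h4; ring.
Qed.

End Null.

Lemma normal_sq_prod_eq U x z : open U -> iso_minimal U x -> iso_minimal U z ->
  (forall q, U q -> curvature_data x q = curvature_data z q) ->
  forall q, U q -> normal_sqP x q * normal_sqQ x q = normal_sqP z q * normal_sqQ z q.
Proof.
move=> oU hx hz hd q Uq.
have nx := null_data_iso_minimal oU hx; have nz := null_data_iso_minimal oU hz.
have hG p : U p -> dot (nullP x p) (nullQ x p) = dot (nullP z p) (nullQ z p).
  move=> Up; have [_ _ ->] := null_pair_dots hx Up.
  by have [_ _ ->] := null_pair_dots hz Up; have [-> _] := hd p Up.
have hg p : U p -> dot (nullQ x p) (dir ep (nullP x) p) =
    dot (nullQ z p) (dir ep (nullP z) p).
  move=> Up; have [_ -> _ _ _] := null_dots oU nx Up.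
  by have [_ -> _ _ _] := null_dots oU nz Up; refine (dir_eq oU ep hG Up).
have hD : det4 (nullP x q) (nullQ x q) (dir ep (nullP x) q) (dir em (nullQ x) q) =
    det4 (nullP z q) (nullQ z q) (dir ep (nullP z) q) (dir em (nullQ z) q).
  by rewrite (null_det oU hx Uq) (null_det oU hz Uq); have [_ ->] := hd q Uq.
have [a1 _ a3 a4 a5] := null_dots oU nx Uq.
have [b1 _ b3 b4 b5] := null_dots oU nz Uq.
have [k1 k2 _] := null_pair_dots hx Uq; have [l1 l2 _] := null_pair_dots hz Uq.
have gx := gram_null_alg k1 k2 a1 a4; have gz := gram_null_alg l1 l2 b1 b4.
have e3 : dot (dir em (nullQ x) q) (nullP x q) = dot (dir em (nullQ z) q) (nullP z q).
  by rewrite a3 b3; refine (dir_eq oU em hG Uq).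
have e5 : dot (dir em (nullQ x) q) (dir ep (nullP x) q) =
    dot (dir em (nullQ z) q) (dir ep (nullP z) q).
  by rewrite a5 b5; refine (dir_eq oU em hg Uq).
have G0 : dot (nullP z q) (nullQ z q) != 0.
  by have [_ _ _ _ h] := nz; have [] := h q Uq.
move: gx; rewrite hD gz hG // hg // e3 e5 => /addIr.
by move/(mulfI (_ : - dot (nullP z q) (nullQ z q) ^+ 2 != 0)) => ->;
  rewrite // oppr_eq0 expf_neq0.
Qed.

Lemma dirM (U : set V) (f g : V -> R) v p : Cinf U f -> Cinf U g -> U p ->
  dir v (fun q => f q * g q) p = f p * dir v g p + g p * dir v f p.
Proof.
move=> cf cg Up; rewrite !dirE.
by apply: deriveM; apply: diff_derivable; [exact: Cinf_diff cf Up|exact: Cinf_diff cg Up].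
Qed.

(** The ratio of the values of P' ^ 2 is constant along em, that of Q' ^ 2
    along ep, and by [normal_sq_prod_eq] they are inverse to each other. *)
Lemma normal_sq_ratio p0 (r : R) x z : 0 < r -> let U := ball p0 r in
  iso_minimal U x -> iso_minimal U z ->
  (forall q, U q -> curvature_data x q = curvature_data z q) ->
  (forall q, U q -> normal_sqP x q != 0 /\ normal_sqQ x q != 0) ->
  (forall q, U q -> normal_sqP z q != 0 /\ normal_sqQ z q != 0) ->
  exists2 c : R, c != 0 & forall q, U q ->
    normal_sqP z q = c * normal_sqP x q /\ normal_sqQ x q = c * normal_sqQ z q.
Proof.
move=> r0 U hx hz hd nx nz; have oU : open U by exact: ball_open.
have cPx := Cinf_normal_sqP oU hx; have cPz := Cinf_normal_sqP oU hz.
have cQx := Cinf_normal_sqQ oU hx; have cQz := Cinf_normal_sqQ oU hz.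
have nPx q (Uq : U q) : normal_sqP x q != 0 by have [] := nx q Uq.
pose c q := normal_sqP z q * (normal_sqP x q)^-1.
have cc : Cinf U c by refine (CinfM oU cPz (CinfV oU nPx cPx)).
have h1 q : U q -> normal_sqP z q = c q * normal_sqP x q.
  by move=> Uq; rewrite /c divfK // nPx.
have h2 q : U q -> normal_sqQ x q = c q * normal_sqQ z q.
  move=> Uq; apply: (mulfI (nPx q Uq)).
  by rewrite (normal_sq_prod_eq oU hx hz hd Uq) h1 // mulrCA mulrA.
have c0 q : U q -> forall v, dir v c q = 0.
  move=> Uq; apply: (dir0_of_null cc Uq).
    have := dirM ep cc cQz Uq; rewrite -(dir_eq oU ep h2 Uq).
    rewrite (normal_sqQ_ep oU hx Uq) (normal_sqQ_ep oU hz Uq) mulr0 add0r => /esym/eqP.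
    by have [_ k] := nz q Uq; rewrite mulf_eq0 (negPf k) => /eqP.
  have := dirM em cc cPx Uq; rewrite -(dir_eq oU em h1 Uq).
  rewrite (normal_sqP_em oU hx Uq) (normal_sqP_em oU hz Uq) mulr0 add0r => /esym/eqP.
  by rewrite mulf_eq0 (negPf (nPx q Uq)) => /eqP.
have hc := ball_dir0_cst_scalar r0 cc c0.
have U0 : U p0 by exact: ballxx.
exists (c p0).
  by apply/eqP => c00; have := h1 p0 U0; rewrite c00 mul0r; apply/eqP; have [] := nz p0 U0.
by move=> q Uq; rewrite -(hc q Uq) -h1 // -h2.
Qed.

(** The difference of z and the image of x under the isometry found in
    [rigidity] has zero derivative. *)
Lemma congruence p0 (r : R) x z : 0 < r -> let U := ball p0 r in
  iso_minimal U x -> iso_minimal U z ->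
  (forall q, U q -> curvature_data x q = curvature_data z q) ->
  (forall q, U q -> normal_sqP x q != 0 /\ normal_sqQ x q != 0) ->
  (forall q, U q -> normal_sqP z q = normal_sqP x q /\ normal_sqQ x q = normal_sqQ z q) ->
  exists M c, proper_isometry M /\ forall q, U q -> z q = x q *m M + c.
Proof.
move=> r0 U hx hz hd nx hsq; have oU : open U by exact: ball_open.
have dx := null_data_iso_minimal oU hx; have dz := null_data_iso_minimal oU hz.
have hs : same_null U ep em (nullP x) (nullQ x) (nullP z) (nullQ z).
  move=> q Uq; have [k1 k2] := hsq q Uq; split.
  - have [_ _ ->] := null_pair_dots hx Uq.
    by have [_ _ ->] := null_pair_dots hz Uq; have [-> _] := hd q Uq.
  - exact: esym k1.
  - exact: k2.
  - by rewrite (null_det oU hx Uq) (null_det oU hz Uq); have [_ ->] := hd q Uq.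
have nP q (Uq : U q) : dot (dir ep (nullP x) q) (dir ep (nullP x) q) != 0.
  by have [] := nx q Uq.
have nQ q (Uq : U q) : dot (dir em (nullQ x) q) (dir em (nullQ x) q) != 0.
  by have [] := nx q Uq.
have [M iso hM] := rigidity r0 dx dz hs nP nQ.
have [cx _] := hx; have [cz _] := hz.
have cxM := Cinf_mulmx oU cx (Cinf_cst U M).
have cd := CinfB oU cz cxM.
have hc q : U q -> forall v, dir v (fun q => z q - x q *m M) q = 0.
  move=> Uq; have [h1 h2] := hM q Uq; apply: (dir0_of_null cd Uq).
    rewrite (dirB ep cz cxM Uq) (dir_mulmxr M ep cx Uq).
    rewrite (dir_ep cz Uq) (dir_ep cx Uq).
    by move: h1; rewrite /nullP => ->; rewrite subrr.
  rewrite (dirB em cz cxM Uq) (dir_mulmxr M em cx Uq).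
  rewrite (dir_em cz Uq) (dir_em cx Uq).
  by move: h2; rewrite /nullQ => ->; rewrite subrr.
exists M, (z p0 - x p0 *m M); split=> // q Uq.
have := ball_dir0_cst r0 cd hc Uq => /= <-.
by rewrite addrC subrK.
Qed.

End Congruence.

(** * Surfaces of general type *)

Section GeneralType.
Variable R : realType.
Local Notation V := 'rV[R]_2.
Implicit Types (x : V -> 'rV[R]_4) (p q : V) (U : set V).
Local Notation e0 := (delta_mx 0 0 : V).
Local Notation e1 := (delta_mx 0 1 : V).
Local Notation ep := (1 *: e0 + 1 *: e1).
Local Notation em := (1 *: e0 + (-1) *: e1).

Lemma d_reD (s t : dnum R) : d_re (s + t) = d_re s + d_re t. Proof. by []. Qed.
Lemma d_imD (s t : dnum R) : d_im (s + t) = d_im s + d_im t. Proof. by []. Qed.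
Lemma d_reN (s : dnum R) : d_re (- s) = - d_re s. Proof. by []. Qed.
Lemma d_imN (s : dnum R) : d_im (- s) = - d_im s. Proof. by []. Qed.
Lemma d_reM (s t : dnum R) : d_re (s * t) = d_re s * d_re t + d_im s * d_im t.
Proof. by []. Qed.
Lemma d_imM (s t : dnum R) : d_im (s * t) = d_re s * d_im t + d_im s * d_re t.
Proof. by []. Qed.

Lemma co_dnum4 (a b : 'rV[R]_4) k : co (to_dnum4 a b) k = Dnum (co a k) (co b k).
Proof. by rewrite /co mxE. Qed.

Lemma dot_dnum4 (a b : 'rV[R]_4) : dot (to_dnum4 a b) (to_dnum4 a b) =
  Dnum (dot a a + dot b b) (2 * dot a b).
Proof.
rewrite !dotE !co_dnum4; apply: dnum_eqP;
  rewrite ?(d_reD, d_imD, d_reN, d_imN, d_reM, d_imM) /=; ring.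
Qed.

(** The norm of s + j t is s ^ 2 - t ^ 2. *)
Lemma isotropic_dnumE (s t : R) : isotropic_dnum (Dnum s t) <-> s ^+ 2 = t ^+ 2.
Proof.
rewrite /isotropic_dnum; split=> [h|h].
  have := congr1 (@d_re R) h; rewrite d_reM /= => h'.
  by apply/subr0_eq; rewrite -[RHS]h'; ring.
apply: dnum_eqP; rewrite ?(d_reM, d_imM) /=; last by ring.
transitivity (s ^+ 2 - t ^+ 2); first by ring.
by rewrite h subrr.
Qed.

Lemma half_dt (a b c d : 'rV[R]_4) :
  Dnum (2^-1) 0 *: (to_dnum4 a b + dj R *: to_dnum4 c d) =
  to_dnum4 (2^-1 *: (a + d)) (2^-1 *: (b + c)).
Proof.
apply/rowP => i; rewrite !mxE; apply: dnum_eqP;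
  rewrite ?(d_reD, d_imD, d_reM, d_imM) /=; ring.
Qed.

Lemma to_dnum4_mulmx (a b : 'rV[R]_4) (P : 'M[R]_4) :
  to_dnum4 a b *m map_mx (fun r => Dnum r 0) P = to_dnum4 (a *m P) (b *m P).
Proof.
apply/rowP => i; rewrite !mxE; apply: dnum_eqP => /=.
  rewrite (big_morph (@d_re R) d_reD (erefl : d_re (0 : dnum R) = 0)).
  by apply: eq_bigr => k _; rewrite !mxE /= mulr0 addr0.
rewrite (big_morph (@d_im R) d_imD (erefl : d_im (0 : dnum R) = 0)).
by apply: eq_bigr => k _; rewrite !mxE /= mulr0 add0r.
Qed.

Lemma Phi_reim x : (fun q => map_mx (@d_re R) (Phi x q)) = dir e0 x /\
  (fun q => map_mx (@d_im R) (Phi x q)) = dir e1 x.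
Proof.
by split; apply/funext => q; apply/rowP => i; rewrite -?duE -?dvE !mxE.
Qed.

Lemma Phi'_normalE U x p : open U -> iso_minimal U x -> U p ->
  Phi'_normal x p = to_dnum4 (dir e0 (dir e0 x) p *m normal_proj x p)
    (dir e0 (dir e1 x) p *m normal_proj x p).
Proof.
move=> oU [cx h] Up; rewrite /Phi'_normal /d_t; have [-> ->] := Phi_reim x.
rewrite !duE !dvE half_dt to_dnum4_mulmx.
have [_ ->] := h p Up.
have -> : dir e1 (dir e0 x) p = dir e0 (dir e1 x) p by refine (dirC oU e1 e0 cx Up).
have hv (a : 'rV[R]_4) : 2^-1 *: (a + a) = a.
  by rewrite -[a in a + _]scale1r -[a in _ + a]scale1r -scalerDl scalerA mulVf ?scale1r
    // pnatr_eq0.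
by rewrite !hv.
Qed.

(** The tangential part of w is orthogonal to the isotropic vector a + e b,
    hence a multiple of it, hence isotropic. *)
Lemma normal_part_sq (a b w : 'rV[R]_4) (E e : R) : E != 0 -> e ^+ 2 = 1 ->
  dot a a = E -> dot b b = - E -> dot a b = 0 -> dot w (a + e *: b) = 0 ->
  dot (w *m orth_proj a b) (w *m orth_proj a b) = dot w w.
Proof.
move=> E0 e2 haa hbb hab hw.
have g0 : dot a a * dot b b - dot a b ^+ 2 != 0.
  by rewrite haa hbb hab expr0n subr0 mulf_neq0 // oppr_eq0.
have [h1 h2 [s [t h]] _] := orth_projP w g0.
set w' := w *m _ in h1 h2 h *.
have hw' : w = w' + (s *: a + t *: b) by rewrite -h addrC subrK.
have st : s = e * t.
  apply: (mulIf E0); move: hw; rewrite hw' !dot_lin haa hbb hab (dotC b a) hab h1 h2.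
  by move=> k; apply/subr0_eq; rewrite -[RHS]k; ring.
rewrite hw' !dot_lin haa hbb hab (dotC b a) hab (dotC a w') (dotC b w') h1 h2 st.
transitivity (dot w' w' + (e ^+ 2 - 1) * t ^+ 2 * E); last by ring.
by rewrite e2; ring.
Qed.

(** With alpha and beta the normal parts of x_uu and x_uv, the norm of (alpha
    + j beta) ^ 2 is (alpha + beta) ^ 2 (alpha - beta) ^ 2, and P' = 2 (x_uu +
    x_uv), Q' = 2 (x_uu - x_uv). *)
Lemma general_type_normal_sq U x p : open U -> iso_minimal U x -> U p ->
  ~ isotropic_dnum (dot (Phi'_normal x p) (Phi'_normal x p)) ->
  normal_sqP x p != 0 /\ normal_sqQ x p != 0.
Proof.
move=> oU hx Up; rewrite (Phi'_normalE oU hx Up) dot_dnum4 isotropic_dnumE.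
rewrite normal_projE duE dvE; have [_ h] := hx; have [[hE hF E0] _] := h p Up.
have En0 : dot (dir e0 x p) (dir e0 x p) != 0 by rewrite lt_eqF.
have hE' : dot (dir e1 x p) (dir e1 x p) = - dot (dir e0 x p) (dir e0 x p).
  by rewrite hE opprK.
have dx := null_data_iso_minimal oU hx.
have [h1 _ _ h4 _] := null_dots oU dx Up.
rewrite /normal_sqP /normal_sqQ; move: h1 h4.
rewrite (dir_nullP oU hx Up) (dir_nullQ oU hx Up) /nullP /nullQ.
set s := dir e0 (dir e0 x) p; set t := dir e0 (dir e1 x) p.
set P := orth_proj _ _.
have -> : 2 *: s + 2 *: t = 2 *: (s + t) by rewrite scalerDr.
have -> : 2 *: s + -2 *: t = 2 *: (s - t) by rewrite scalerBr scaleNr.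
rewrite dotZr dotZl => /eqP; rewrite mulf_eq0 pnatr_eq0 /= dotC => /eqP h1.
move=> /eqP; rewrite mulf_eq0 pnatr_eq0 /= => /eqP h2.
have k1 : dot ((s + t) *m P) ((s + t) *m P) = dot (s + t) (s + t).
  by apply: (normal_part_sq En0 (expr1n _ 2) erefl hE' hF); rewrite scale1r.
have k2 : dot ((s - t) *m P) ((s - t) *m P) = dot (s - t) (s - t).
  apply: (normal_part_sq (e := -1) En0 _ erefl hE' hF); first by rewrite sqrrN expr1n.
  by rewrite scaleN1r.
rewrite mulmxDl in k1; rewrite mulmxBl in k2.
move=> hn; rewrite !dotZl !dotZr -k1 -k2.
suff : dot (s *m P + t *m P) (s *m P + t *m P) * dot (s *m P - t *m P) (s *m P - t *m P) != 0.
  rewrite mulf_eq0 negb_or => /andP[m1 m2].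
  by rewrite !mulf_neq0 ?pnatr_eq0.
apply/eqP => h0; apply: hn; apply/subr0_eq; rewrite -[RHS]h0 !dot_lin.
by rewrite (dotC (t *m P) (s *m P)); ring.
Qed.

End GeneralType.

(** * The converse *)

Section Converse.
Variable R : realType.
Local Notation V := 'rV[R]_2.
Implicit Types (x : V -> 'rV[R]_4) (p q : V) (U W : set V).
Local Notation e0 := (delta_mx 0 0 : V).
Local Notation e1 := (delta_mx 0 1 : V).
Local Notation ep := (1 *: e0 + 1 *: e1).
Local Notation em := (1 *: e0 + (-1) *: e1).

Lemma smooth_sub n m (U U' : set 'rV[R]_n) (f : 'rV[R]_n -> 'rV[R]_m) : U' `<=` U ->
  smooth U f -> smooth U' f.
Proof. by move=> sU /smoothP cf; apply/smoothP; exact: Cinf_sub sU cf. Qed.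

(** The inverse of f is smooth on W, which makes images of open sets open. *)
Lemma domain_image U U' W (f : V -> V) : diffeomorphism U W f -> open W ->
  U' `<=` U -> domain U' -> domain (f @` U') /\ diffeomorphism U' (f @` U') f.
Proof.
move=> [sf fU [g sg gf]] oW sU [oU' cU'].
have fg q : W q -> f (g q) = q by rewrite -fU => -[p Up <-]; rewrite gf.
have sub : f @` U' `<=` W by move=> _ [p Up <-]; rewrite -fU; exists p => //; exact: sU.
split; last first.
  split=> //; first exact: smooth_sub sf.
  by exists g; [exact: smooth_sub sg|move=> p /sU; exact: gf].
split; last first.
  apply: connected_continuous_connected => //.
  apply: continuous_in_subspaceT => p; rewrite inE => Up.
  have /smoothP cf := sf.
  exact: differentiable_continuous (Cinf_diff cf (sU p Up)).
have -> : f @` U' = W `&` (g @^-1` U').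
  apply/seteqP; split=> [q fq|q [Wq gq]].
    split; first exact: sub.
    by have [p Up <-] := fq; rewrite /preimage /= gf //; exact: sU.
  by exists (g q) => //; exact: fg.
rewrite openE => q [Wq gq]; rewrite /interior.
have /smoothP cg := sg.
have cgq : {for q, continuous g} := differentiable_continuous (Cinf_diff cg Wq).
apply: filterI; first exact: open_nbhs_nbhs.
by apply: cgq; exact: open_nbhs_nbhs.
Qed.

Lemma diffeomorphism_derive_onto U W (f : V -> V) p : open U -> open W ->
  diffeomorphism U W f -> U p -> forall v, exists u, v = 'D_u f p.
Proof.
move=> oU oW [sf fU [g sg gf]] Up v.
have fg q : W q -> f (g q) = q by rewrite -fU => -[z Uz <-]; rewrite gf.
have Wp : W (f p) by rewrite -fU; exists p.
have /smoothP cf := sf; have /smoothP cg := sg.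
exists ('D_v g (f p)); apply/esym.
have dg := Cinf_diff cg Wp.
have df : differentiable f (g (f p)) by rewrite gf //; exact: Cinf_diff cf Up.
have h := derive_comp v dg df.
rewrite (gf p Up) in h.
refine (etrans (esym h) _).
refine (etrans (eq_on_derive v oW (g := fun q => q) fg Wp) _).
exact: derive_idfun.
Qed.

Lemma curvature_data_eq x z p : dot (dir e0 x p) (dir e0 x p) != 0 ->
  dot (dir e0 z p) (dir e0 z p) = dot (dir e0 x p) (dir e0 x p) ->
  iso_curvature z p = iso_curvature x p -> curvature_data z p = curvature_data x p.
Proof.
move=> E0 hE; rewrite /iso_curvature /curvature_data hE => h; congr pair.
have E3 : (- dot (dir e0 x p) (dir e0 x p)) ^+ 3 != 0 by rewrite expf_neq0 // oppr_eq0.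
by move/(divIf E3)/(mulfI (_ : 2 != 0 :> R)): h => -> //; rewrite pnatr_eq0.
Qed.

(** In the parameters of M the surface N has the metric of M, hence is
    isothermal; minimality and the normal curvature do not depend on
    parameters. *)
Lemma strong_isometry_pullback (M N : surface R) U W f :
  minimal_timelike M -> isothermal M -> minimal_timelike N ->
  domain U -> U `<=` dom M -> open W -> W `<=` dom N ->
  strong_isometry (subsurface M U) (subsurface N W) f ->
  iso_minimal U (pos N \o f) /\
  forall q, U q -> curvature_data (pos N \o f) q = curvature_data (pos M) q.
Proof.
move=> hM hi hN [oU cU] sU oW sW [_ _ dfo iso curvE] /=.
have [sf fU _] := dfo; rewrite /= in sf fU.
have hx := iso_minimal_sub sU (minimal_iso_minimal hM hi).
have /smoothP cf := sf.
have [[[oN _] /smoothP cN _ _] _] := hN.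
have cN' := Cinf_sub sW cN.
have fW q : U q -> W (f q) by move=> Uq; rewrite -fU; exists q.
have cF : Cinf U (pos N \o f) by refine (Cinf_comp oU oW fW cf cN').
have dF X Y q : U q -> dot (dir X (pos N \o f) q) (dir Y (pos N \o f) q) =
    dot (dir X (pos M) q) (dir Y (pos M) q).
  move=> Uq; rewrite !(dir_comp _ fW cf cN' Uq) !dirE; exact: iso.
have hiF q : U q -> isothermal_at (pos N \o f) q.
  move=> Uq; rewrite /isothermal_at !dF //.
  by have [_ h] := hx; have [] := h q Uq.
have onto q (Uq : U q) := diffeomorphism_derive_onto oU oW dfo Uq.
have hF : iso_minimal U (pos N \o f).
  apply: (iso_minimal_of_normal_minimal oU cF hiF) => q Uq.
  apply: (normal_minimal_comp oU oW fW cf cN' Uq (onto q Uq)).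
  exact: minimal_normal_minimal hN (sW _ (fW q Uq)).
split=> // q Uq; have [_ h] := hx; have [[_ _ E0] _] := h q Uq.
apply: curvature_data_eq; [by rewrite lt_eqF|exact: dF|].
rewrite -(normal_curvature_comp oU oW fW cf cN' Uq (onto q Uq) hF).
rewrite -(normal_curvature_iso_minimal oU hx Uq); exact: curvE.
Qed.

Lemma general_type_normal_sq_pullback (N : surface R) U W f : domain U -> domain W ->
  diffeomorphism U W f -> W `<=` dom N -> general_type N ->
  iso_minimal U (pos N \o f) ->
  forall q, U q -> normal_sqP (pos N \o f) q != 0 /\ normal_sqQ (pos N \o f) q != 0.
Proof.
move=> dU dW dfo sW hg hF q Uq; have [sf fU hgf] := dfo.
have oU : open U by case: dU.
apply: (general_type_normal_sq oU hF Uq).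
have := hg U f; apply=> //; split=> //.
- by rewrite fU.
- by rewrite fU.
- by rewrite fU; split.
exact: iso_minimal_isothermal.
Qed.

Lemma general_type_normal_sq_isothermal (M : surface R) : domain (dom M) -> general_type M ->
  iso_minimal (dom M) (pos M) ->
  forall q, dom M q -> normal_sqP (pos M) q != 0 /\ normal_sqQ (pos M) q != 0.
Proof.
move=> dM hg hx q Mq; have oM : open (dom M) by case: dM.
have s : smooth (dom M) (id : V -> V) by apply/smoothP; exact: Cinf_id.
apply: (@general_type_normal_sq_pullback M (dom M) (dom M) id) => //.
by split=> //; [rewrite image_id|exists id].
Qed.

Lemma normal_sqP_scale U x z (A : 'M[R]_4) (a k : R) q : open U -> iso_minimal U x -> U q ->
  (forall v w, dot (v *m A) (w *m A) = k * dot v w) ->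
  (forall q, U q -> nullP z q = a *: (nullP x q *m A)) ->
  normal_sqP z q = a ^+ 2 * k * normal_sqP x q.
Proof.
move=> oU hx Uq hA h; have c := Cinf_nullP oU hx.
have cA := Cinf_mulmx oU c (Cinf_cst U A).
have e : dir ep (nullP z) q = a *: (dir ep (nullP x) q *m A).
  rewrite (dir_eq oU ep h Uq) (dir_scalec a ep cA Uq); congr (_ *: _).
  exact: dir_mulmxr c Uq.
by rewrite /normal_sqP e dotZl dotZr hA; ring.
Qed.

Lemma normal_sqQ_scale U x z (A : 'M[R]_4) (a k : R) q : open U -> iso_minimal U x -> U q ->
  (forall v w, dot (v *m A) (w *m A) = k * dot v w) ->
  (forall q, U q -> nullQ z q = a *: (nullQ x q *m A)) ->
  normal_sqQ z q = a ^+ 2 * k * normal_sqQ x q.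
Proof.
move=> oU hx Uq hA h; have c := Cinf_nullQ oU hx.
have cA := Cinf_mulmx oU c (Cinf_cst U A).
have e : dir em (nullQ z) q = a *: (dir em (nullQ x) q *m A).
  rewrite (dir_eq oU em h Uq) (dir_scalec a em cA Uq); congr (_ *: _).
  exact: dir_mulmxr c Uq.
by rewrite /normal_sqQ e dotZl dotZr hA; ring.
Qed.

Lemma cosh_sinhD (t : R) : cosh t + sinh t = expR t.
Proof. by rewrite /cosh /sinh; field. Qed.
Lemma cosh_sinhB (t : R) : cosh t - sinh t = expR (- t).
Proof. by rewrite /cosh /sinh; field. Qed.

Lemma associated_normal_sq U x y theta q : open U -> iso_minimal U x ->
  harmonic_conjugate (Surface U x) y -> U q ->
  let z := fun t => cosh theta *: x t + sinh theta *: y t in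
  normal_sqP z q = expR theta ^+ 2 * normal_sqP x q /\
  normal_sqQ z q = expR (- theta) ^+ 2 * normal_sqQ x q.
Proof.
move=> oU hx hy Uq z; have [_ _ d0 d1] := associated_iso_minimal theta oU hx hy.
have h1 (v w : 'rV[R]_4) : dot (v *m 1%:M) (w *m 1%:M) = 1 * dot v w.
  by rewrite !mulmx1 mul1r.
split.
  rewrite (normal_sqP_scale (a := expR theta) oU hx Uq h1) ?mulr1 // => p Up.
  rewrite mulmx1 -cosh_sinhD /nullP d0 // d1 // scalerDl !scalerDr.
  by rewrite addrACA [X in _ + _ + X]addrC.
rewrite (normal_sqQ_scale (a := expR (- theta)) oU hx Uq h1) ?mulr1 // => p Up.
rewrite mulmx1 -cosh_sinhB /nullQ d0 // d1 //.
set s := dir _ _ _; set t := dir _ _ _.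
by apply/rowP => i; rewrite !mxE; ring.
Qed.

Lemma conjugate_normal_sq U x y (A : 'M[R]_4) b q : open U -> iso_minimal U x ->
  harmonic_conjugate (Surface U x) y -> anti_isometry A -> \det A = 1 -> U q ->
  let z := fun t => y t *m A + b in
  normal_sqP z q = - normal_sqP x q /\ normal_sqQ z q = - normal_sqQ x q.
Proof.
move=> oU hx hy hA dA Uq z; have [_ _ d0 d1] := conjugate_iso_minimal b oU hx hy hA dA.
have h1 v w : dot (v *m A) (w *m A) = -1 * dot v w by rewrite hA mulN1r.
split.
  rewrite (normal_sqP_scale (a := 1) oU hx Uq h1); first by rewrite expr1n mul1r mulN1r.
  by move=> p Up; rewrite scale1r /nullP d0 // d1 // mulmxDl addrC.
rewrite (normal_sqQ_scale (a := -1) oU hx Uq h1); first by rewrite sqrrN expr1n mul1r mulN1r.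
by move=> p Up; rewrite scaleN1r /nullQ d0 // d1 // mulmxBl opprB.
Qed.

Lemma congruent_of_ball (S N : surface R) U W f p0 q0 (r : R) :
  0 < r -> ball p0 r `<=` U -> ball p0 r `<=` dom S -> open W -> W `<=` dom N ->
  diffeomorphism U W f -> f p0 = q0 ->
  (exists B c, proper_isometry B /\
    forall q, ball p0 r q -> (pos N \o f) q = pos S q *m B + c) ->
  locally_properly_congruent S p0 N q0.
Proof.
move=> r0 sU sS oW sW dfo fp [B [c [hB h]]].
have db : domain (ball p0 r) by split; [exact: ball_open|exact: connected_ball].
have [dV dfo'] := domain_image dfo oW sU db.
have b0 : ball p0 r p0 by exact: ballxx.
exists (ball p0 r), (f @` ball p0 r), f, B, c; split=> //.
split=> //; first by exists p0.
move=> _ [p bp <-]; apply: sW; have [_ <- _] := dfo; exists p => //; exact: sU.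
Qed.

Lemma expR_half_ln_sq (c : R) : 0 < c ->
  expR (ln c / 2) ^+ 2 = c /\ expR (- (ln c / 2)) ^+ 2 = c^-1.
Proof.
move=> c0; have e : expR (ln c / 2) ^+ 2 = c.
  by rewrite expr2 -expRD -mulrDl -mulr2n -[_ *+ 2]mulr_natr mulfK ?pnatr_eq0 // lnK.
by split=> //; rewrite expRN exprVn e.
Qed.

(** The sign of the constant c of [normal_sq_ratio] decides between the two
    families, and its absolute value is e^(2 theta). *)
Theorem strongly_isometric_congruent (M N : surface R) (y : V -> 'rV[R]_4)
     (A : 'M[R]_4) (b : 'rV[R]_4) (y' : V -> 'rV[R]_4) (p0 q0 : V) :
  minimal_timelike M -> isothermal M -> general_type M ->
  minimal_timelike N -> general_type N ->
  harmonic_conjugate M y -> anti_isometry A -> \det A = 1 ->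
  let Ma := anti_surface (conjugate_surface M y) A b in
  harmonic_conjugate Ma y' ->
  (exists U V f,
     [/\ neighborhood M p0 U, neighborhood N q0 V,
         strong_isometry (subsurface M U) (subsurface N V) f & f p0 = q0]) ->
  exists theta : R,
    locally_properly_congruent (associated M y theta) p0 N q0 \/
    locally_properly_congruent (associated Ma y' theta) p0 N q0.
Proof.
case: M => DM x hM hi gM hN gN hy hA dA; rewrite anti_conjugateE /=.
move=> hy' [U [W [f [[dU U0 sU] [dW W0 sW] hf fp]]]].
have [_ _ dfo _ _] := hf; rewrite /= in dfo sU.
have [oU _] := dU; have [oW _] := dW.
have hx := minimal_iso_minimal hM hi; rewrite /= in hx.
have [[dM _ _ _] _] := hM; rewrite /= in dM; have [oM _] := dM.
have [hF hFd] := strong_isometry_pullback hM hi hN dU sU oW sW hf.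
rewrite /= in hFd.
have nM := @general_type_normal_sq_isothermal (Surface DM x) dM gM hx; rewrite /= in nM.
have nF := general_type_normal_sq_pullback dU dW dfo sW gN hF.
have [r r0 sr] := open_sub_ball oU U0.
set Bl := ball p0 r in sr.
have srM : Bl `<=` DM by move=> q /sr /sU.
have hxb := iso_minimal_sub srM hx; have hFb := iso_minimal_sub sr hF.
have [c c0 hc] := @normal_sq_ratio _ p0 r x (pos N \o f) r0 hxb hFb
  (fun q bq => esym (hFd q (sr q bq))) (fun q bq => nM q (srM q bq))
  (fun q bq => nF q (sr q bq)).
have [|cneg|ceq] := ltgtP 0 c; last by rewrite -ceq eqxx in c0.
- move=> cpos; exists (ln c / 2); left.
  have [k1 k2] := expR_half_ln_sq cpos.
  have [hz hd _ _] := associated_iso_minimal (ln c / 2) oM hx hy.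
  have hsq q (Mq : DM q) := associated_normal_sq (ln c / 2) oM hx hy Mq.
  apply: (congruent_of_ball r0 sr _ oW sW dfo fp) => //=.
  apply: (congruence r0 (iso_minimal_sub srM hz) hFb).
  + by move=> q bq; rewrite hd ?(hFd q (sr q bq)) //; exact: srM.
  + move=> q bq; have [-> ->] := hsq q (srM q bq); have [m1 m2] := nM q (srM q bq).
    by rewrite k1 k2 !mulf_neq0 // invr_eq0.
  move=> q bq; have [-> ->] := hsq q (srM q bq); have [-> ->] := hc q bq.
  by rewrite k1 k2 mulKf.
exists (ln (- c) / 2); right.
have [k1 k2] : expR (ln (- c) / 2) ^+ 2 = - c /\ expR (- (ln (- c) / 2)) ^+ 2 = (- c)^-1.
  by apply: expR_half_ln_sq; rewrite oppr_gt0.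
have [ha hda _ _] := conjugate_iso_minimal b oM hx hy hA dA.
have hsqa q (Mq : DM q) := conjugate_normal_sq b oM hx hy hA dA Mq.
have [hz hd _ _] := associated_iso_minimal (ln (- c) / 2) oM ha hy'.
have hsq q (Mq : DM q) := associated_normal_sq (ln (- c) / 2) oM ha hy' Mq.
apply: (congruent_of_ball r0 sr _ oW sW dfo fp) => //=.
apply: (congruence r0 (iso_minimal_sub srM hz) hFb).
+ by move=> q bq; rewrite hd ?hda ?(hFd q (sr q bq)) //; exact: srM.
+ move=> q bq; have [-> ->] := hsq q (srM q bq); have [-> ->] := hsqa q (srM q bq).
  have [m1 m2] := nM q (srM q bq).
  by rewrite k1 k2 !mulf_neq0 ?oppr_eq0 // invr_eq0 oppr_eq0.
move=> q bq; have [-> ->] := hsq q (srM q bq); have [-> ->] := hsqa q (srM q bq).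
have [-> ->] := hc q bq.
by rewrite k1 k2 mulrNN invrN mulrNN mulKf.
Qed.

End Converse.

Theorem theorem7p11 (R : realType) :
  (forall (M : surface R) (y : 'rV[R]_2 -> 'rV[R]_4),
     minimal_timelike M -> isothermal M -> general_type M ->
     harmonic_conjugate M y ->
     (forall theta : R, strongly_isometric (associated M y theta) M) /\
     (forall (A : 'M[R]_4) (b : 'rV[R]_4) (y' : 'rV[R]_2 -> 'rV[R]_4),
        anti_isometry A -> \det A = 1 ->
        let Ma := anti_surface (conjugate_surface M y) A b in
        harmonic_conjugate Ma y' ->
        forall theta : R, strongly_isometric (associated Ma y' theta) M))
  /\
  (forall (M N : surface R) (y : 'rV[R]_2 -> 'rV[R]_4)
     (A : 'M[R]_4) (b : 'rV[R]_4) (y' : 'rV[R]_2 -> 'rV[R]_4)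
     (p0 q0 : 'rV[R]_2),
     minimal_timelike M -> isothermal M -> general_type M ->
     minimal_timelike N -> general_type N ->
     dom M p0 -> dom N q0 ->
     harmonic_conjugate M y ->
     anti_isometry A -> \det A = 1 ->
     let Ma := anti_surface (conjugate_surface M y) A b in
     harmonic_conjugate Ma y' ->
     (exists U V f,
        [/\ neighborhood M p0 U, neighborhood N q0 V,
            strong_isometry (subsurface M U) (subsurface N V) f & f p0 = q0]) ->
     exists theta : R,
       locally_properly_congruent (associated M y theta) p0 N q0 \/
       locally_properly_congruent (associated Ma y' theta) p0 N q0).
Proof.
split=> [M y hM hi _ hy|M N y A b y' p0 q0 hM hi gM hN gN _ _ hy hA dA Ma hy' hf].
  exact: associated_strongly_isometric hM hi hy.
exact: strongly_isometric_congruent hM hi gM hN gN hy hA dA hy' hf.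
Qed.
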